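(* Let $\Bbbk$ be an algebraically closed field of characteristic $0$, let $m=4t$ with $t\ge 3$, and let $\mathbb D_m$ be the dihedral group of order $2m$. Let $\mathfrak B(M)$ be a finite-dimensional Nichols algebra of an object $M$ of ${}^{\Bbbk\mathbb D_m}_{\Bbbk\mathbb D_m}\mathcal{YD}$. Then $\mathfrak B(M)\simeq\bigwedge M$, and $M$ is isomorphic in ${}^{\Bbbk\mathbb D_m}_{\Bbbk\mathbb D_m}\mathcal{YD}$ either to $M_I$ with $I\in\mathcal I$, or to $M_L$ with $L\in\mathcal L$, or to $M_{I,L}$ with $(I,L)\in\mathcal K$.
   Context: Set $n=m/2=2t$, $\mathbb D_m=\langle x,y\mid x^2=1=y^m,\ xy=y^{-1}x\rangle$, and fix a primitive $m$-th root of unity $\omega\in\Bbbk$. ${}^{\Bbbk\mathbb D_m}_{\Bbbk\mathbb D_m}\mathcal{YD}$ is the category of left Yetter-Drinfeld modules over $\Bbbk\mathbb D_m$: left $\mathbb D_m$-modules $M=\bigoplus_{g\in\mathbb D_m}M_g$ with coaction $\delta(u)=g\otimes u$ for $u\in M_g$ and $h\cdot M_g\subseteq M_{hgh^{-1}}$; the braiding is $c(u\otimes v)=g\cdot v\otimes u$ for $u\in M_g$. $\mathfrak B(M)$ is the Nichols algebra of $M$. $\bigwedge M=T(M)/(u\otimes v+v\otimes u:\ u,v\in M)$. $J=\{(i,k):\ 1\le i\le n-1,\ 1\le k\le m-1,\ \omega^{ik}=-1\}$. For $(i,k),(p,q)\in J$ write $(i,k)\sim(p,q)$ if $\omega^{iq+pk}=1$.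 For $1\le i\le n-1$ and $0\le k\le m-1$, $M_{i,k}$ is the irreducible Yetter-Drinfeld module with basis $a_{i,k},b_{i,k}$ and $x\cdot a_{i,k}=b_{i,k}$, $y\cdot a_{i,k}=\omega^k a_{i,k}$, $\delta(a_{i,k})=y^i\otimes a_{i,k}$; $x\cdot b_{i,k}=a_{i,k}$, $y\cdot b_{i,k}=\omega^{-k}b_{i,k}$, $\delta(b_{i,k})=y^{-i}\otimes b_{i,k}$. For $1\le \ell<n$ odd, $M_\ell$ is the irreducible Yetter-Drinfeld module with basis $c_\ell,d_\ell$ and $x\cdot c_\ell=d_\ell$, $y\cdot c_\ell=\omega^\ell c_\ell$, $\delta(c_\ell)=y^n\otimes c_\ell$; $x\cdot d_\ell=c_\ell$, $y\cdot d_\ell=\omega^{-\ell}d_\ell$, $\delta(d_\ell)=y^n\otimes d_\ell$. $\mathcal I$ is the set of finite families (disjoint unions of singletons, i.e. repetitions allowed; possibly empty) $I=\coprod_{s=1}^r\{(i_s,k_s)\}$ with $(i_s,k_s)\in J$ and $(i_s,k_s)\sim(i_p,k_p)$ for all $1\le s,p\le r$. $\mathcal L$ is the set of finite families (repetitions allowed; possibly empty) $L=\coprod_{s=1}^r\{\ell_s\}$ of odd integers $1\le\ell_s<n$. $\mathcal K$ is the set of pairs $(I,L)$ with $I\in\mathcal I$, $L\in\mathcal L$ such that for all $(i,k)\in I$ and $\ell\in L$: $k$ is odd and $(i,\ell)\in J$. $M_I=\bigoplus_{(i,k)\in I}M_{i,k}$, $M_L=\bigoplus_{\ell\in L}M_\ell$,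 $M_{I,L}=M_I\oplus M_L$. *)

(* Defs.v *)
From HB Require Import structures.
From mathcomp Require Import all_boot all_order all_fingroup all_algebra.
From mathcomp Require Import generic_quotient boolp finmap.
From mathcomp.multinomials Require Import monalg.

Set Implicit Arguments.
Unset Strict Implicit.
Unset Printing Implicit Defensive.

Import GRing.Theory.
Local Open Scope ring_scope.

Section Span.
Context (F : fieldType) (V : lmodType F) (S : V -> Prop).
Local Open Scope quotient_scope.

Inductive lspan : V -> Prop :=
| lspan0 : lspan 0
| lspan_cons a u v : S u -> lspan v -> lspan (a *: u + v).

Lemma lspan_gen u : S u -> lspan u.
Proof. by move=> Su; rewrite -[u]addr0 -[u]scale1r; apply: lspan_cons => //; exact: lspan0. Qed.

Lemma lspanD u v : lspan u -> lspan v -> lspan (u + v).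
Proof.
by elim=> [|a u' v' Su _ IH] sv; rewrite ?add0r // -addrA; apply: lspan_cons => //; exact: IH.
Qed.

Lemma lspanZ a u : lspan u -> lspan (a *: u).
Proof.
elim=> [|b u' v' Su _ IH]; first by rewrite scaler0; exact: lspan0.
by rewrite scalerDr scalerA; apply: lspan_cons.
Qed.

Definition in_lspan : {pred V} := fun v => `[< lspan v >].

Lemma in_lspanP v : reflect (lspan v) (v \in in_lspan).
Proof. exact: asboolP. Qed.

Lemma in_lspan_zmod : zmod_closed in_lspan.
Proof.
split=> [|u v /in_lspanP su /in_lspanP sv]; apply/in_lspanP; first exact: lspan0.
by apply: lspanD => //; rewrite -scaleN1r; exact: lspanZ.
Qed.

HB.instance Definition _ := GRing.isZmodClosed.Build V in_lspan in_lspan_zmod.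

Definition quot_mod := Quotient.quot in_lspan.

HB.instance Definition _ := EqQuotient.on quot_mod.
HB.instance Definition _ := Choice.on quot_mod.
HB.instance Definition _ := GRing.Zmodule.on quot_mod.

Definition qpi (v : V) : quot_mod := \pi_(quot_mod) v.

Lemma qpi_eq u v : qpi u = qpi v <-> lspan (u - v).
Proof.
split=> [/eqP|su]; first by rewrite -Quotient.idealrBE => /in_lspanP.
by apply/eqP; rewrite -Quotient.idealrBE; apply/in_lspanP.
Qed.

Lemma qpiK (q : quot_mod) : qpi (repr q) = q.
Proof. exact: reprK. Qed.

Lemma qpi_eq0 u : qpi u = 0 <-> lspan u.
Proof.
have -> : 0 = qpi 0 by rewrite /qpi piE.
by rewrite qpi_eq subr0.
Qed.

Lemma qpiD u v : qpi (u + v) = qpi u + qpi v.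
Proof. by rewrite /qpi !piE. Qed.

Definition qscale (a : F) (q : quot_mod) : quot_mod := qpi (a *: repr q).

Lemma qscaleE a u : qscale a (qpi u) = qpi (a *: u).
Proof.
apply/qpi_eq; rewrite -scalerBr; apply: lspanZ.
by apply/qpi_eq; rewrite qpiK.
Qed.

Lemma qscaleA a b q : qscale a (qscale b q) = qscale (a * b) q.
Proof. by rewrite -[q]qpiK !qscaleE scalerA. Qed.
Lemma qscale1 : left_id 1 qscale.
Proof. by move=> q; rewrite -[q]qpiK !qscaleE scale1r. Qed.
Lemma qscaleDr : right_distributive qscale +%R.
Proof. by move=> a p q; rewrite -[p]qpiK -[q]qpiK -qpiD !qscaleE -qpiD scalerDr. Qed.
Lemma qscaleDl q : {morph qscale^~ q : a b / a + b}.
Proof. by move=> a b; rewrite -[q]qpiK !qscaleE -qpiD scalerDl. Qed.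

HB.instance Definition _ :=
  GRing.Zmodule_isLmodule.Build F quot_mod qscaleA qscale1 qscaleDr qscaleDl.

Lemma qpi_linear : linear qpi.
Proof. by move=> a u v; rewrite qpiD -qscaleE. Qed.

HB.instance Definition _ := GRing.isLinear.Build F V quot_mod _ qpi qpi_linear.

End Span.

Definition finite_dim (F : fieldType) (V : lmodType F) : Prop :=
  exists s : seq V, forall v, lspan (fun u => u \in s) v.

Definition ideal (F : fieldType) (A : algType F) (S : A -> Prop) : A -> Prop :=
  lspan (fun z => exists a s b, S s /\ z = a * s * b).

Section QuotAlg.
Context (F : fieldType) (A : algType F) (S : A -> Prop).

Lemma idealMl a z : ideal S z -> ideal S (a * z).
Proof.
elim=> [|c u v [b [s [d [Ss ->]]]] _ IH]; first by rewrite mulr0; exact: lspan0.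
rewrite mulrDr -scalerAr; apply: lspan_cons => //.
by exists (a * b), s, d; rewrite !mulrA.
Qed.

Lemma idealMr a z : ideal S z -> ideal S (z * a).
Proof.
elim=> [|c u v [b [s [d [Ss ->]]]] _ IH]; first by rewrite mul0r; exact: lspan0.
rewrite mulrDl -scalerAl; apply: lspan_cons => //.
by exists b, s, (d * a); rewrite !mulrA.
Qed.

Definition quot_alg :=
  quot_mod (fun z => exists a s b, S s /\ z = a * s * b).

HB.instance Definition _ := EqQuotient.on quot_alg.
HB.instance Definition _ := GRing.Lmodule.on quot_alg.

Definition qproj (z : A) : quot_alg := qpi _ z.

Lemma qproj_eq u v : qproj u = qproj v <-> ideal S (u - v).
Proof. exact: qpi_eq. Qed.

Lemma qprojK (q : quot_alg) : qproj (repr q) = q.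
Proof. exact: qpiK. Qed.

Lemma qproj_linear : linear qproj.
Proof. exact: qpi_linear. Qed.

HB.instance Definition _ := GRing.isLinear.Build F A quot_alg _ qproj qproj_linear.

Definition qmul (p q : quot_alg) : quot_alg := qproj (repr p * repr q).

Lemma qmulE u v : qmul (qproj u) (qproj v) = qproj (u * v).
Proof.
have hu : ideal S (repr (qproj u) - u) by apply/qproj_eq; rewrite qprojK.
have hv : ideal S (repr (qproj v) - v) by apply/qproj_eq; rewrite qprojK.
apply/qproj_eq; rewrite -[X in X - _](subrK (repr (qproj u) * v)) -mulrBr.
by rewrite -addrA -mulrBl; apply: lspanD; [exact: idealMl | exact: idealMr].
Qed.

Lemma qmulA : associative qmul.
Proof. by move=> p q r; rewrite -[p]qprojK -[q]qprojK -[r]qprojK !qmulE mulrA. Qed.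
Lemma qmul1l : left_id (qproj 1) qmul.
Proof. by move=> p; rewrite -[p]qprojK !qmulE mul1r. Qed.
Lemma qmul1r : right_id (qproj 1) qmul.
Proof. by move=> p; rewrite -[p]qprojK !qmulE mulr1. Qed.
Lemma qmulDl : left_distributive qmul +%R.
Proof.
move=> p q r; rewrite -[p]qprojK -[q]qprojK -[r]qprojK.
by rewrite -raddfD !qmulE mulrDl raddfD.
Qed.
Lemma qmulDr : right_distributive qmul +%R.
Proof.
move=> p q r; rewrite -[p]qprojK -[q]qprojK -[r]qprojK.
by rewrite -raddfD !qmulE mulrDr raddfD.
Qed.

(* Only a pzRingType: the quotient is zero when S generates the unit ideal. *)
HB.instance Definition _ := GRing.Zmodule_isPzRing.Build quot_alg
  qmulA qmul1l qmul1r qmulDl qmulDr.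

Lemma qproj_is_monoid_morphism : monoid_morphism qproj.
Proof. by split=> [|u v]; [exact: erefl | rewrite -[LHS]qmulE]. Qed.

HB.instance Definition _ :=
  GRing.isMonoidMorphism.Build A quot_alg qproj qproj_is_monoid_morphism.

Lemma qprojM u v : qproj (u * v) = qproj u * qproj v.
Proof. exact: rmorphM. Qed.

Lemma qprojZ (a : F) u : qproj (a *: u) = a *: qproj u.
Proof. exact: linearZ. Qed.

Lemma qscaleAl (a : F) (p q : quot_alg) : a *: (p * q) = (a *: p) * q.
Proof.
rewrite -[p]qprojK -[q]qprojK; move: (repr p) (repr q) => u v.
by rewrite -(qprojZ a u) -!qprojM -qprojZ scalerAl.
Qed.

Lemma qscaleAr (a : F) (p q : quot_alg) : a *: (p * q) = p * (a *: q).
Proof.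
rewrite -[p]qprojK -[q]qprojK; move: (repr p) (repr q) => u v.
by rewrite -(qprojZ a v) -!qprojM -qprojZ scalerAr.
Qed.

End QuotAlg.

Lemma mul_linear_comb (F : fieldType) (A : algType F) (p q x y z : A) (a : F) :
  p * (x - (a *: y + z)) * q = p * x * q - (a *: (p * y * q) + p * z * q).
Proof. by rewrite mulrBr mulrDr mulrBl mulrDl -scalerAr -scalerAl. Qed.

Section TensorAlgebra.
Context (F : fieldType) (V : lmodType F).

(* T(V) is the free algebra on the underlying set of V modulo linearity of the
   generators. *)
Definition free_alg := {malg F[{fmonom V}]}.

HB.instance Definition _ := GRing.Lalgebra.on free_alg.

Lemma free_scaleAr (a : F) (p q : free_alg) : a *: (p * q) = p * (a *: q).
Proof.
apply/malgP => w; rewrite mcoeffZ [in LHS]mcoeffMl [in RHS](mcoeffMlw _ (fsubset_refl _) (msuppZ_le a q)).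
rewrite mulr_sumr; apply: eq_bigr => u _.
rewrite mulr_sumr; apply: eq_bigr => v _.
by rewrite mcoeffZ mulrnAr mulrCA.
Qed.

HB.instance Definition _ := GRing.Lalgebra_isAlgebra.Build F free_alg free_scaleAr.

Definition gen (v : V) : free_alg := << fmu v >>.

Definition tensor_rel (z : free_alg) : Prop :=
  exists (a : F) (u v : V), z = gen (a *: u + v) - (a *: gen u + gen v).

Definition tensor_alg := quot_alg tensor_rel.

HB.instance Definition _ := EqQuotient.on tensor_alg.
HB.instance Definition _ := GRing.Lmodule.on tensor_alg.
HB.instance Definition _ := GRing.PzRing.on tensor_alg.

Definition free_counit (z : free_alg) : F := mcoeff (@mone {fmonom V}) (z : {malg F[{fmonom V}]}).

Lemma ideal_tensor_rel_counit (z : free_alg) : ideal tensor_rel z -> free_counit z = 0.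
Proof.
have gen0 v : mcoeff (@mone {fmonom V}) (gen v : {malg F[{fmonom V}]}) = 0 by rewrite mcoeffU -fdeg_eq0 fdegU.
elim=> [|a u v [b [s [c [[d [p [q ->]]] ->]]]] _ IH]; first exact: mcoeff0.
move: IH; rewrite /free_counit => IH; rewrite mcoeffD mcoeffZ IH addr0 !rmorphM /= mcoeffB mcoeffD mcoeffZ !gen0.
by rewrite mulr0 addr0 subr0 mulr0 mul0r mulr0.
Qed.

Lemma tensor_alg_neq0 : (1 : tensor_alg) != 0.
Proof.
apply/eqP; rewrite -[1]/(qproj tensor_rel 1) => /qpi_eq0/ideal_tensor_rel_counit.
by rewrite /free_counit rmorph1 => /eqP; rewrite oner_eq0.
Qed.

HB.instance Definition _ := GRing.PzSemiRing_isNonZero.Build tensor_alg tensor_alg_neq0.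
HB.instance Definition _ :=
  GRing.Lmodule_isLalgebra.Build F tensor_alg (@qscaleAl _ _ tensor_rel).
HB.instance Definition _ :=
  GRing.Lalgebra_isAlgebra.Build F tensor_alg (@qscaleAr _ _ tensor_rel).

Definition iota (v : V) : tensor_alg := qproj tensor_rel (gen v).

Lemma iota_linear : linear iota.
Proof.
move=> a u v; rewrite /iota -linearP; apply/qproj_eq; apply: lspan_gen.
by exists 1, (gen (a *: u + v) - (a *: gen u + gen v)), 1; split; [exists a, u, v | rewrite mul1r mulr1].
Qed.

HB.instance Definition _ := GRing.isLinear.Build F V tensor_alg _ iota iota_linear.

(* word [:: v1; ..; vn] is the pure tensor v1 (x) .. (x) vn of T(V). *)
Definition word (w : seq V) : tensor_alg := \prod_(v <- w) iota v.

Definition tensor_deg (n : nat) : tensor_alg -> Prop :=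
  lspan (fun z => exists2 w, size w = n & z = word w).

Definition exterior_rel (z : tensor_alg) : Prop :=
  exists u v : V, z = iota u * iota v + iota v * iota u.

Definition exterior := quot_alg exterior_rel.

HB.instance Definition _ := GRing.Lmodule.on exterior.
HB.instance Definition _ := GRing.PzRing.on exterior.

Lemma malgUM (u w : {fmonom V}) :
  << u >> * << w >> = << mmul u w >> :> {malg F[{fmonom V}]}.
Proof. by rewrite malgM_def fgmulUU mulr1. Qed.

Lemma gen_cons (v : V) (w : seq V) :
  (<< FMonom (v :: w) >> : free_alg) = gen v * (<< FMonom w >> : free_alg).
Proof.
rewrite [RHS]malgUM; congr mkmalgU.
by apply/eqP; rewrite fmP fmM fmU.
Qed.

Lemma gen_word (v : V) (w1 w2 : seq V) :
  (<< FMonom w1 >> : free_alg) * gen v * (<< FMonom w2 >> : free_alg) =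
  (<< FMonom (w1 ++ v :: w2) >> : free_alg).
Proof.
rewrite -mulrA -gen_cons [LHS]malgUM; congr mkmalgU.
by apply/eqP; rewrite fmP fmM.
Qed.

Lemma gen_rel_word (w1 w2 : seq V) (a : F) (u v : V) (W := fun x =>
    << FMonom (w1 ++ x :: w2) >> : free_alg) :
  (<< FMonom w1 >> : free_alg) * (gen (a *: u + v) - (a *: gen u + gen v)) *
    (<< FMonom w2 >> : free_alg) = W (a *: u + v) - (a *: W u + W v).
Proof. by rewrite /W -!gen_word; exact: mul_linear_comb. Qed.

Lemma qproj_word (w : {fmonom V}) :
  qproj tensor_rel (<< w >> : free_alg) = word w.
Proof.
case: w => w; rewrite /word /=; elim: w => [|v w IH].
  by rewrite big_nil -fmoneE.
by rewrite big_cons -IH gen_cons qprojM.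
Qed.

End TensorAlgebra.

Section TensorProduct.
Context (F : fieldType) (U W : lmodType F).

Definition pure (u : U) (w : W) : {malg F[(U * W)%type]} := << (u, w) >>.

Definition bilinear_rel (z : {malg F[(U * W)%type]}) : Prop :=
  (exists (a : F) (u u' : U) (w : W),
     z = pure (a *: u + u') w - (a *: pure u w + pure u' w)) \/
  (exists (a : F) (u : U) (w w' : W),
     z = pure u (a *: w + w') - (a *: pure u w + pure u w')).

Definition tprod := quot_mod bilinear_rel.

HB.instance Definition _ := GRing.Lmodule.on tprod.

Definition tens (u : U) (w : W) : tprod := qpi _ (pure u w).

Lemma tens_linear_l w : linear (tens^~ w).
Proof.
move=> a u u'; rewrite /tens -linearP; apply/qpi_eq; apply: lspan_gen.
by left; exists a, u, u', w.
Qed.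

Lemma tens_linear_r u : linear (tens u).
Proof.
move=> a w w'; rewrite /tens -linearP; apply/qpi_eq; apply: lspan_gen.
by right; exists a, u, w, w'.
Qed.

End TensorProduct.

Record ydModule (F : fieldType) (G : finGroupType) := YDModule {
  yd_mod :> lmodType F;
  yd_act : G -> yd_mod -> yd_mod;
  (* yd_comp g v is the component v_g of v in M_g, so that the coaction is
     delta(v) = \sum_g g (x) yd_comp g v. *)
  yd_comp : G -> yd_mod -> yd_mod;
  yd_act_linear : forall g, linear (yd_act g);
  yd_act1 : forall v, yd_act 1%g v = v;
  yd_actM : forall g h v, yd_act (g * h)%g v = yd_act g (yd_act h v);
  yd_comp_linear : forall g, linear (yd_comp g);
  yd_comp_comp : forall g h v,
    yd_comp g (yd_comp h v) = if g == h then yd_comp h v else 0;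
  yd_comp_sum : forall v, \sum_g yd_comp g v = v;
  yd_act_comp : forall g h v,
    yd_act h (yd_comp g v) = yd_comp (h * g * h^-1)%g (yd_act h v)
}.

Definition yd_iso (F : fieldType) (G : finGroupType) (M N : ydModule F G) : Prop :=
  exists f : M -> N,
    [/\ linear f, bijective f,
        forall g v, f (yd_act g v) = yd_act g (f v) &
        forall g v, f (yd_comp g v) = yd_comp g (f v)].

Section DirectSum.
Context (F : fieldType) (G : finGroupType).

Definition yd0_mod : lmodType F := 'rV[F]_0.

Definition yd0 : ydModule F G.
Proof.
by refine (@YDModule F G yd0_mod (fun _ v => v) (fun _ v => v) _ _ _ _ _ _ _);
  move=> *; do ?[exact: (@linearP _ _ _ _ idfun) | rewrite [LHS]thinmx0 [RHS]thinmx0].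
Defined.

Definition yd_sum (M N : ydModule F G) : ydModule F G.
Proof.
refine (@YDModule F G (M * N)%type
  (fun g v => (yd_act g v.1, yd_act g v.2))
  (fun g v => (yd_comp g v.1, yd_comp g v.2)) _ _ _ _ _ _ _).
- by move=> g a u v; rewrite /= !yd_act_linear.
- by case=> u v; rewrite /= !yd_act1.
- by move=> g h v; rewrite /= !yd_actM.
- by move=> g a u v; rewrite /= !yd_comp_linear.
- by move=> g h v; rewrite /= !yd_comp_comp; case: eqP.
- move=> v; rewrite [RHS]surjective_pairing.
  rewrite -[v.1 in RHS]yd_comp_sum -[v.2 in RHS]yd_comp_sum.
  by elim/big_rec3: _ => // g a b c _ ->.
- by move=> g h v; rewrite /= !yd_act_comp.
Defined.

Definition yd_bigsum (s : seq (ydModule F G)) : ydModule F G := foldr yd_sum yd0 s.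

End DirectSum.

Section Nichols.
Context (F : fieldType) (G : finGroupType) (M : ydModule F G).
Local Notation T := (tensor_alg M).

(* The terms of the braided coproduct of T(M) on v1 (x) ... (x) vn: as
   Delta(v) = v (x) 1 + 1 (x) v and Delta is multiplicative for the braided
   product of T(M) (x) T(M), Delta(v w) is obtained from Delta(w) = \sum p (x) q
   by (v (x) 1)(p (x) q) = v p (x) q and
   (1 (x) v)(p (x) q) = \sum_g g.p (x) v_g q. *)
Fixpoint coprod_words (w : seq M) : seq (seq M * seq M) :=
  if w is v :: w' then
    flatten [seq (v :: pq.1, pq.2) ::
                 [seq (map (yd_act g) pq.1, yd_comp g v :: pq.2) | g <- enum G]
            | pq <- coprod_words w']
  else [:: ([::], [::])].

Definition coprod_word (w : seq M) : tprod T T :=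
  \sum_(pq <- coprod_words w) tens (word pq.1) (word pq.2).

(* The choice of a representative is immaterial: see coprod_linear and
   coprod_wordE, which determine coprod. *)
Definition coprod (z : T) : tprod T T :=
  let r : {malg F[{fmonom M}]} := repr z in
  \sum_(w <- msupp r) r@_w *: coprod_word w.

Lemma coprod_words_sum (N : lmodType F) (f : seq M -> seq M -> N) v w :
  \sum_(pq <- coprod_words (v :: w)) f pq.1 pq.2 =
  \sum_(pq <- coprod_words w)
    (f (v :: pq.1) pq.2 +
     \sum_g f (map (yd_act g) pq.1) (yd_comp g v :: pq.2)).
Proof.
rewrite /= big_flatten big_map; apply: eq_bigr => pq _.
by rewrite big_cons big_map big_enum.
Qed.

Let multilin (N : lmodType F) (f : seq M -> seq M -> N) :=
  (forall p p' q a u v,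
     f (p ++ (a *: u + v) :: p') q = a *: f (p ++ u :: p') q + f (p ++ v :: p') q) /\
  (forall p q q' a u v,
     f p (q ++ (a *: u + v) :: q') = a *: f p (q ++ u :: q') + f p (q ++ v :: q')).

Lemma coprod_words_linear (N : lmodType F) (f : seq M -> seq M -> N) w1 w2 a u v :
  multilin f ->
  let S w := \sum_(pq <- coprod_words w) f pq.1 pq.2 in
  S (w1 ++ (a *: u + v) :: w2) = a *: S (w1 ++ u :: w2) + S (w1 ++ v :: w2).
Proof.
elim: w1 f => [|x w1 IH] f [fl fr] S; rewrite {}/S.
  rewrite !cat0s !coprod_words_sum scaler_sumr -big_split /=.
  apply: eq_bigr => pq _; rewrite scalerDr addrACA; congr (_ + _).
    exact: (fl [::]).
  rewrite scaler_sumr -big_split /=; apply: eq_bigr => g _.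
  by rewrite yd_comp_linear; exact: (fr _ [::]).
rewrite !cat_cons !coprod_words_sum; apply: (IH (fun p q => f (x :: p) q +
     \sum_g f (map (yd_act g) p) (yd_comp g x :: q))).
split=> p q q' b y z.
  rewrite scalerDr addrACA; congr (_ + _); first exact: (fl (x :: p)).
  rewrite scaler_sumr -big_split /=; apply: eq_bigr => g _.
  by rewrite !map_cat /= yd_act_linear fl.
rewrite scalerDr addrACA; congr (_ + _); first exact: fr.
rewrite scaler_sumr -big_split /=; apply: eq_bigr => g _.
exact: (fr _ (_ :: q)).
Qed.

Lemma word_linear (p p' : seq M) a u v :
  word (p ++ (a *: u + v) :: p') =
  a *: word (p ++ u :: p') + word (p ++ v :: p') :> T.
Proof.
rewrite /word !big_cat !big_cons /= linearP.
by rewrite mulrDl mulrDr -scalerAl -scalerAr.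
Qed.

Lemma coprod_word_linear w1 w2 a u v :
  coprod_word (w1 ++ (a *: u + v) :: w2) =
  a *: coprod_word (w1 ++ u :: w2) + coprod_word (w1 ++ v :: w2).
Proof.
apply: (coprod_words_linear (f := fun p q => tens (word p) (word q))).
by split=> *; rewrite word_linear ?tens_linear_l ?tens_linear_r.
Qed.

Let coprod_free (r : {malg F[{fmonom M}]}) : tprod T T :=
  \sum_(w <- msupp r) r@_w *: coprod_word w.

Let coprod_freew (r : {malg F[{fmonom M}]}) (d : {fset {fmonom M}}) :
  fsubset (msupp r) d -> coprod_free r = \sum_(w <- d) r@_w *: coprod_word w.
Proof.
move=> sd; rewrite /coprod_free (big_fset_incl _ sd) // => w _ nw.
by rewrite mcoeff_outdom // scale0r.
Qed.

Let coprod_free_linear : linear coprod_free.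
Proof.
move=> a r s.
pose d := fsetU (msupp (a *: r + s)) (fsetU (msupp r) (msupp s)).
rewrite (@coprod_freew _ d) ?fsubsetUl //.
rewrite (@coprod_freew r d); last first.
  by apply: fsubset_trans (fsubsetUr _ _); exact: fsubsetUl.
rewrite (@coprod_freew s d); last first.
  by apply: fsubset_trans (fsubsetUr _ _); exact: fsubsetUr.
rewrite scaler_sumr -big_split /=; apply: eq_bigr => w _.
by rewrite mcoeffD mcoeffZ scalerDl scalerA.
Qed.

Let coprod_free_comb (a : F) (p q r : {malg F[{fmonom M}]}) :
  coprod_free (p - (a *: q + r)) =
  coprod_free p - (a *: coprod_free q + coprod_free r).
Proof. by rewrite addrC -scaleN1r !coprod_free_linear scaleN1r addrC. Qed.

Let coprod_freeU (w : {fmonom M}) : coprod_free << w >> = coprod_word w.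
Proof. by rewrite /coprod_free msuppU1 big_seq_fset1 mcoeffUU scale1r. Qed.

Let coprod_free_ideal (z : free_alg M) :
  ideal (@tensor_rel F M) z -> coprod_free z = 0.
Proof.
pose L : {linear free_alg M -> tprod T T} :=
  HB.pack (coprod_free : free_alg M -> tprod T T)
    (GRing.isLinear.Build F (free_alg M) (tprod T T) _ coprod_free coprod_free_linear).
have malgZ (r : free_alg M) :
    r = \sum_(w <- msupp (r : {malg F[{fmonom M}]}))
      mcoeff w (r : {malg F[{fmonom M}]}) *: (<< w >> : free_alg M).
  rewrite [LHS](@monalgE _ _ (r : {malg F[{fmonom M}]})); apply: eq_bigr => w _.
  by apply/malgP => u; rewrite mcoeffZ !mcoeffU mulrnAr mulr1.
have lin0 (P : free_alg M -> tprod T T) : linear P ->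
    (forall w, P (<< w >> : free_alg M) = 0) -> forall r, P r = 0.
  move=> Pl P0 r; rewrite [r]malgZ.
  elim: (enum_fset _) => [|w d IH]; last by rewrite big_cons Pl P0 IH scaler0 addr0.
  by rewrite big_nil; have := Pl (-1) 0 0; rewrite scaler0 addr0 scaleN1r addNr.
have kill (s : free_alg M) : tensor_rel s -> forall b c : free_alg M, L (b * s * c) = 0.
  case=> a [u [v ->]] b c; move: c; apply: (lin0 (fun c => L (b * _ * c))) => [d c c'|w2].
    by rewrite mulrDr -scalerAr linearP.
  move: b; apply: (lin0 (fun b => L (b * _ * _))) => [d b b'|w1].
    by rewrite !mulrDl -!scalerAl linearP.
  case: w1 w2 => w1 [w2]; rewrite gen_rel_word.
  rewrite [LHS]coprod_free_comb !coprod_freeU /=.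
  by rewrite coprod_word_linear subrr.
elim=> [|a x y [b [s [c [rs ->]]]] _ IH]; first exact: (linear0 L).
by rewrite coprod_free_linear IH addr0; have := kill _ rs b c => /= ->; rewrite scaler0.
Qed.

Let coprod_qproj (r : free_alg M) :
  coprod (qproj (@tensor_rel F M) r) = coprod_free r.
Proof.
have : ideal (@tensor_rel F M) (repr (qproj (@tensor_rel F M) r) - r).
  by apply/qproj_eq; rewrite qprojK.
move/coprod_free_ideal; rewrite -[_ - _]addrC -scaleN1r coprod_free_linear.
by rewrite scaleN1r => /eqP; rewrite addrC subr_eq0 => /eqP.
Qed.

Lemma coprod_linear : linear coprod.
Proof.
move=> a u v; rewrite -[u]qprojK -[v]qprojK -qprojZ -raddfD /=.
by rewrite !coprod_qproj coprod_free_linear.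
Qed.

Lemma coprod_wordE w : coprod (word w) = coprod_word w.
Proof. by rewrite -(qproj_word (FMonom w)) coprod_qproj coprod_freeU. Qed.

Definition coideal (I : T -> Prop) : Prop :=
  forall z, I z ->
    lspan (fun t => exists p q, (I p \/ I q) /\ t = tens p q) (coprod z).

(* The union of all the two-sided ideals of T(M) that are generated by homogeneous
   elements of degree at least 2 and are coideals. Their sum, which is the ideal
   that the union generates, is the largest such ideal. *)
Definition nichols_rel (z : T) : Prop :=
  exists S : T -> Prop,
    [/\ forall s, S s -> exists2 n, (2 <= n)%N & tensor_deg n s,
        coideal (ideal S) & ideal S z].

Definition nichols := quot_alg nichols_rel.

HB.instance Definition _ := GRing.Lmodule.on nichols.
HB.instance Definition _ := GRing.PzRing.on nichols.

(* The isomorphism is one of algebras generated by M: it is the identity on M. *)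
Definition nichols_is_exterior : Prop :=
  exists phi : nichols -> exterior M,
    [/\ bijective phi, linear phi, monoid_morphism phi &
        forall v : M, phi (qproj nichols_rel (iota v)) =
                      qproj (@exterior_rel F M) (iota v)].

End Nichols.

Section Dihedral.
Context (gT : finGroupType) (m : nat) (x y : gT).
Local Open Scope group_scope.

(* gT is the group presented by x, y | x^2 = 1 = y^m, x y = y^-1 x: the latter
   has order 2m, so the order rules out proper quotients. *)
Definition dihedral_presented : Prop :=
  [/\ x ^+ 2 = 1, y ^+ m = 1, x * y = y^-1 * x,
      <<[set x; y]>> = [set: gT] & #|gT| = (2 * m)%N].

Hypothesis hD : dihedral_presented.

Lemma dih_m_gt0 : (0 < m)%N.
Proof.
case: hD => _ _ _ _ c; have : (0 < #|gT|)%N by apply/card_gt0P; exists 1.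
by rewrite c muln_gt0.
Qed.

Lemma dih_yV b : y ^- b = y ^+ (b * m.-1).
Proof.
case: hD => _ ym _ _ _; apply: (mulgI (y ^+ b)).
by rewrite mulgV -expgD -mulnS prednK ?dih_m_gt0 // mulnC expgM ym expg1n.
Qed.

Lemma dih_xy b : x * y ^+ b = y ^- b * x.
Proof.
case: hD => _ _ xy _ _; elim: b => [|b IH]; first by rewrite invg1 mulg1 mul1g.
by rewrite expgSr mulgA IH -mulgA xy mulgA -invMg -expgS expgSr.
Qed.

Definition dih_elt (p : nat * bool) : gT := y ^+ p.1 * x ^+ p.2.

Lemma dih_eltM p q :
  dih_elt p * dih_elt q =
  dih_elt ((p.1 + if p.2 then q.1 * m.-1 else q.1)%N, p.2 (+) q.2).
Proof.
case: hD => x2 _ _ _ _; case: p q => a [] [b f]; rewrite /dih_elt /= ?mulg1.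
  rewrite -mulgA [x ^+ _ * _]mulgA expg1 dih_xy dih_yV expgD -!mulgA; do 2 congr (_ * _).
  by case: f; rewrite /= ?mulg1 ?expg1.
by rewrite mulgA -expgD.
Qed.

Lemma dih_mod a : y ^+ (a %% m) = y ^+ a.
Proof. by case: hD => _ ym _ _ _; rewrite expg_mod. Qed.

Lemma dih_elt_surj g : exists p : 'I_m * bool, g == dih_elt (val p.1, p.2).
Proof.
pose A := [set dih_elt (val p.1, p.2) | p : 'I_m * bool].
have AP a e : dih_elt (a, e) \in A.
  apply/imsetP; exists (Ordinal (ltn_pmod a dih_m_gt0), e) => //.
  by rewrite /dih_elt /= dih_mod.
have gA : group_set A.
  apply/group_setP; split.
    by have := AP 0%N false; rewrite /dih_elt mulg1.
  move=> _ _ /imsetP[p _ ->] /imsetP[q _ ->]; rewrite dih_eltM; exact: AP.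
have sA : <<[set x; y]>> \subset Group gA.
  rewrite gen_subG; apply/subsetP => z; rewrite !inE => /orP[] /eqP ->.
    by have := AP 0%N true; rewrite /dih_elt /= mul1g.
  by have := AP 1%N false; rewrite /dih_elt /= mulg1.
have : g \in A.
  by case: hD => _ _ _ gE _; apply: (subsetP sA); rewrite gE inE.
by case/imsetP => p _ ->; exists p.
Qed.

Definition dih_coord (g : gT) : nat * bool :=
  let p := xchoose (dih_elt_surj g) in (val p.1, p.2).

Lemma dih_coordK g : dih_elt (dih_coord g) = g.
Proof. by apply/esym/eqP; exact: xchooseP (dih_elt_surj g). Qed.

Lemma dih_elt_inj p q :
  dih_elt p = dih_elt q -> p.1 = q.1 %[mod m] /\ p.2 = q.2.
Proof.
pose f (p : 'I_m * bool) := dih_elt (val p.1, p.2).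
have injf : injective f.
  suff /image_injP injf : #|image f predT| == #|{: 'I_m * bool}|.
    by move=> u v; apply: injf.
  rewrite card_prod card_ord card_bool mulnC.
  have -> : (2 * m)%N = #|gT| by case: hD.
  apply/eqP/eq_card => g; rewrite !inE; have [u /eqP ->] := dih_elt_surj g.
  exact: image_f.
move=> E.
have /injf[e1 e2] : f (Ordinal (ltn_pmod p.1 dih_m_gt0), p.2) =
                f (Ordinal (ltn_pmod q.1 dih_m_gt0), q.2).
  by rewrite /f /dih_elt /= !dih_mod.
by split.
Qed.

End Dihedral.

Section DihedralYD.
Context (F : fieldType) (gT : finGroupType) (m : nat) (omega : F) (x y : gT).
Hypotheses (homega : m.-primitive_root omega) (hD : dihedral_presented m x y).

Definition pair_mod : lmodType F := (F^o * F^o)%type.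

Definition dih_pair_act (q : nat) (c : nat * bool) (v : pair_mod) : pair_mod :=
  let u : pair_mod := if c.2 then (v.2, v.1) else v in
  (omega ^+ (q * c.1) * u.1, omega ^- (q * c.1) * u.2).

Definition dih_pair_comp (p : nat) (g : gT) (v : pair_mod) : pair_mod :=
  (if g == (y ^+ p)%g then v.1 else 0, if g == (y ^- p)%g then v.2 else 0).

Lemma dih_pair_act_eq q c d v : dih_elt x y c = dih_elt x y d ->
  dih_pair_act q c v = dih_pair_act q d v.
Proof.
case/(dih_elt_inj hD) => e1 e2; rewrite /dih_pair_act e2.
by rewrite !(mulnC q) !exprM -(prim_expr_mod homega c.1) e1 prim_expr_mod.
Qed.

Lemma omegaV j : omega ^+ (j * m.-1) = omega ^- j.
Proof.
have o1 : omega ^+ m = 1 by exact: prim_expr_order.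
have m0 := prim_order_gt0 homega.
have u0 : omega ^+ j != 0.
  by rewrite expf_neq0 //; apply/eqP => w0; move/eqP: o1; rewrite w0 expr0n eqn0Ngt m0 eq_sym oner_eq0.
apply: (mulfI u0); rewrite mulfV // -exprD -mulnS prednK //.
by rewrite mulnC exprM o1 expr1n.
Qed.

Lemma dih_pair_actM q c d v :
  dih_pair_act q ((c.1 + if c.2 then d.1 * m.-1 else d.1)%N, c.2 (+) d.2) v =
  dih_pair_act q c (dih_pair_act q d v).
Proof.
case: c d v => a e [b f] [v w]; rewrite /dih_pair_act /=.
by case: e; case: f => /=; rewrite mulnDr ?mulnA exprD ?omegaV invfM ?invrK ?omegaV ?invrK -!mulrA.
Qed.

Lemma dih_conj_rot (h : gT) p :
  let c := dih_coord hD h in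
  (h^-1 * y ^+ p * h = if c.2 then y ^- p else y ^+ p)%g.
Proof.
move=> c; rewrite -[h](dih_coordK hD) -/c; move: (c) => {c} [a e].
rewrite /dih_elt /=.
have cy : (y ^- a * y ^+ p * y ^+ a = y ^+ p)%g.
  by rewrite -mulgA -expgD addnC expgD mulKg.
rewrite invMg; case: e => /=; last by rewrite mulg1 invg1 mul1g.
rewrite expg1 !mulgA -[(x^-1 * _ * _)%g]mulgA -[(x^-1 * _ * _)%g]mulgA cy.
apply: (mulIg (y ^+ p)%g); rewrite mulVg -!mulgA (dih_xy hD) mulKVg.
exact: mulVg.
Qed.

(* The basis elements a and b are (1, 0) and (0, 1): a has degree y^p, b has degree
   y^-p, y a = omega^q a, y b = omega^-q b and x swaps a and b; see dih_yd_y,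
   dih_yd_x and dih_yd_comp. *)
Definition dih_yd (p q : nat) : ydModule F gT.
Proof.
refine (@YDModule F gT pair_mod
  (fun g => dih_pair_act q (dih_coord hD g)) (dih_pair_comp p) _ _ _ _ _ _ _).
- move=> g a u v; rewrite /dih_pair_act; case: ifP => _.
    by congr pair; rewrite /= mulrDr mulrCA.
  by congr pair; rewrite /= mulrDr mulrCA.
- move=> v; rewrite (@dih_pair_act_eq _ _ (0%N, false)); last first.
    by rewrite dih_coordK /dih_elt mulg1.
  by rewrite /dih_pair_act /= muln0 invr1 !mul1r; case: v.
- move=> g h v; rewrite -dih_pair_actM; apply: dih_pair_act_eq.
  by rewrite -dih_eltM // !dih_coordK.
- move=> g a u v; rewrite /dih_pair_comp /=.
  by congr pair; case: ifP => _ //=; rewrite scaler0 addr0.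
- move=> g h v; rewrite /dih_pair_comp /=; have [->|ne] := eqVneq g h.
    by rewrite ?eqxx; congr pair; case: ifP => // ->.
  congr pair; case: ifP => // /eqP Eg; case: ifP => // /eqP Eh;
    by rewrite Eg Eh eqxx in ne.
- move=> [v w]; rewrite [LHS]surjective_pairing.
  have -> : (\sum_g dih_pair_comp p g (v, w)).1 = \sum_g (dih_pair_comp p g (v, w)).1.
    by elim/big_rec2: _ => // g a b _ <-.
  have -> : (\sum_g dih_pair_comp p g (v, w)).2 = \sum_g (dih_pair_comp p g (v, w)).2.
    by elim/big_rec2: _ => // g a b _ <-.
  by rewrite /= -!big_mkcond !big_pred1_eq.
- move=> g h v; rewrite /dih_pair_comp.
  have E u : (h * g * h^-1 == u)%g = (g == h^-1 * u * h)%g.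
    apply/eqP/eqP => [<-|->]; first by rewrite !mulgA mulVg mul1g mulgKV.
    by rewrite !mulgA mulgV mul1g mulgK.
  have EV : (h^-1 * y ^- p * h = (h^-1 * y ^+ p * h)^-1)%g.
    by rewrite !invMg invgK mulgA.
  rewrite !E EV dih_conj_rot /dih_pair_act.
  case: (dih_coord hD h).2; rewrite ?invgK /=;
    by congr pair; case: ifP; rewrite ?mulr0.
Defined.

Lemma dih_yd_y p q : yd_act (y : gT) ((1, 0) : dih_yd p q) = (omega ^+ q, 0) /\
  yd_act y ((0, 1) : dih_yd p q) = (0, omega ^- q).
Proof.
by split; rewrite /= (@dih_pair_act_eq _ _ (1%N, false)) ?dih_coordK /dih_elt ?mulg1 //;
   rewrite /dih_pair_act /= muln1 ?mulr0 mulr1.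
Qed.

Lemma dih_yd_x p q : yd_act (x : gT) ((1, 0) : dih_yd p q) = (0, 1) /\
  yd_act x ((0, 1) : dih_yd p q) = (1, 0).
Proof.
by split; rewrite /= (@dih_pair_act_eq _ _ (0%N, true)) ?dih_coordK /dih_elt ?mul1g //;
   rewrite /dih_pair_act /= muln0 invr1 !mul1r.
Qed.

Lemma dih_yd_comp p q :
  yd_comp (y ^+ p)%g ((1, 0) : dih_yd p q) = (1, 0) /\
  yd_comp (y ^- p)%g ((0, 1) : dih_yd p q) = (0, 1).
Proof. by split; rewrite /= /dih_pair_comp /= eqxx; congr pair; case: ifP. Qed.

(* With m = 4t, n = m/2 = 2t. *)
Local Notation n := (m./2).

Definition M_ik (i k : nat) : ydModule F gT := dih_yd i k.

(* Both c and d have degree y^n, since y^-n = y^n. *)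
Definition M_l (l : nat) : ydModule F gT := dih_yd n l.

Definition in_J (p : nat * nat) : Prop :=
  [/\ (1 <= p.1 <= n - 1)%N, (1 <= p.2 <= m - 1)%N & omega ^+ (p.1 * p.2) = -1].

Definition simJ (p q : nat * nat) : Prop := omega ^+ (p.1 * q.2 + q.1 * p.2) = 1.

(* A finite family with repetitions is given by any list of its members. *)
Definition in_I (I : seq (nat * nat)) : Prop :=
  (forall p, p \in I -> in_J p) /\
  (forall p q, p \in I -> q \in I -> simJ p q).

Definition in_L (L : seq nat) : Prop :=
  forall l, l \in L -> odd l /\ (1 <= l < n)%N.

Definition in_K (I : seq (nat * nat)) (L : seq nat) : Prop :=
  [/\ in_I I, in_L L &
      forall p l, p \in I -> l \in L -> odd p.2 /\ in_J (p.1, l)].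

Definition M_I (I : seq (nat * nat)) : ydModule F gT :=
  yd_bigsum [seq M_ik p.1 p.2 | p <- I].

Definition M_L (L : seq nat) : ydModule F gT :=
  yd_bigsum [seq M_l l | l <- L].

Definition M_IL (I : seq (nat * nat)) (L : seq nat) : ydModule F gT :=
  yd_sum (M_I I) (M_L L).

End DihedralYD.

(* Main.v *)
From mathcomp Require Import all_boot all_order all_fingroup all_algebra.
From mathcomp Require Import generic_quotient boolp finmap.
From mathcomp.multinomials Require Import monalg.
From mathcomp Require Import ring zify.
Require Import Defs.

Set Implicit Arguments.
Unset Strict Implicit.
Unset Printing Implicit Defensive.

Import GRing.Theory.
Local Open Scope ring_scope.

(* The skew derivations of T(M), obtained by pairing the first tensor factor of the
   coproduct with a linear form on M, preserve the Nichols ideal, and the counit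
   kills it.  Hence B(M) has infinite dimension as soon as some composite E of skew
   derivations satisfies E(z^(k+1)) = c_k z^k with c_k <> 0 for an element z of
   positive degree; this happens for root vectors z of self-braiding 1.

   For a vector v of degree y^i on which y acts by omega^k, take z = v if
   omega^(ik) = 1, and the bracket of v and x v, of affine type A_1^(1), if
   omega^(ik) is not -1.  For two such vectors, of types (i,k) and (p,r), with
   omega^(ik) = omega^(pr) = -1 but omega^(ir+pk) <> 1, the vectors v, x v, w, x w
   span a diagram that is a square with vertices -1, and z is a root vector of its
   imaginary root.  For a nonzero v of degree a reflection, the vectors y^j v fall
   into the two classes of j even and j odd, and the quadratic vectors of degree
   y^2 and y^-2 mixing the classes contain u and u' with self-braiding omega^4 and
   mutual braidings omega^-4; since t >= 3, omega^4 is not a sign and the first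
   affine case applies.

   So M is a sum of modules generated by vectors of types (i,k) with
   omega^(ik) = -1 and omega^(ir+pk) = 1 for all pairs.  Since
   (ir - pk)^2 = (ir + pk)^2 - 4 (ik)(pr) is divisible by (4t)^2, so is ir - pk by
   4t, which gives omega^(ir) = -1: every group element g with M_g <> 0 acts by -1,
   the braiding is minus the flip, the skew derivations are superderivations, and
   Euler's formula identifies the Nichols ideal with the ideal of the exterior
   algebra. *)

(** * Linear maps out of spans, quotients and tensor products *)

Lemma lin0 (F : fieldType) (V N : lmodType F) (L : V -> N) : linear L -> L 0 = 0.
Proof. by move=> Ll; have := Ll (-1) 0 0; rewrite scaler0 addr0 scaleN1r addNr. Qed.

Lemma linD (F : fieldType) (V N : lmodType F) (L : V -> N) u v : linear L ->
  L (u + v) = L u + L v.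
Proof. by move=> Ll; rewrite -[u]scale1r Ll !scale1r. Qed.

Lemma linZ (F : fieldType) (V N : lmodType F) (L : V -> N) a u : linear L ->
  L (a *: u) = a *: L u.
Proof. by move=> Ll; rewrite -[_ *: u]addr0 Ll lin0 // addr0. Qed.

Lemma lspan_sum (F : fieldType) (V : lmodType F) (S : V -> Prop) (I : Type)
    (r : seq I) (P : pred I) (G : I -> V) :
  (forall i, P i -> lspan S (G i)) -> lspan S (\sum_(i <- r | P i) G i).
Proof.
by move=> H; elim/big_ind: _ => //; [exact: lspan0 | exact: lspanD].
Qed.

Lemma lspan_linear (F : fieldType) (V N : lmodType F) (S : V -> Prop) (S' : N -> Prop)
    (L : V -> N) :
  linear L -> (forall v, S v -> lspan S' (L v)) -> forall v, lspan S v -> lspan S' (L v).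
Proof.
move=> Ll H v; elim=> [|a u w Su _ IH].
  by rewrite lin0 //; exact: lspan0.
by rewrite Ll; apply: lspanD IH; apply: lspanZ; exact: H.
Qed.

Lemma lspan_kill (F : fieldType) (V N : lmodType F) (S : V -> Prop) (L : V -> N) :
  linear L -> (forall v, S v -> L v = 0) -> forall v, lspan S v -> L v = 0.
Proof.
move=> Ll H v; elim=> [|a u w Su _ IH].
  exact: lin0.
by rewrite Ll IH H // scaler0 addr0.
Qed.

Section MalgExtension.
Context (F : fieldType) (K : choiceType) (N : lmodType F).

Definition malg_ext (h : K -> N) (r : {malg F[K]}) : N :=
  \sum_(k <- msupp r) mcoeff k r *: h k.

Lemma malg_extw h (r : {malg F[K]}) (d : {fset K}) :
  fsubset (msupp r) d -> malg_ext h r = \sum_(k <- d) mcoeff k r *: h k.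
Proof.
move=> sd; rewrite /malg_ext (big_fset_incl _ sd) // => k _ nk.
by rewrite mcoeff_outdom // scale0r.
Qed.

Lemma malg_ext_linear h : linear (malg_ext h).
Proof.
move=> a r s.
pose d := fsetU (msupp (a *: r + s)) (fsetU (msupp r) (msupp s)).
rewrite (@malg_extw _ _ d) ?fsubsetUl //.
rewrite (@malg_extw _ r d); last first.
  by apply: fsubset_trans (fsubsetUr _ _); exact: fsubsetUl.
rewrite (@malg_extw _ s d); last first.
  by apply: fsubset_trans (fsubsetUr _ _); exact: fsubsetUr.
rewrite scaler_sumr -big_split /=; apply: eq_bigr => k _.
by rewrite mcoeffD mcoeffZ scalerDl scalerA.
Qed.

Lemma malg_extU h k : malg_ext h << k >> = h k.
Proof. by rewrite /malg_ext msuppU oner_eq0 big_seq_fset1 mcoeffUU scale1r. Qed.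

Lemma malg_lspan (r : {malg F[K]}) : lspan (fun s => exists k, s = << k >>) r.
Proof.
rewrite [r]monalgE; apply: lspan_sum => k _.
have -> : << mcoeff k r *g k >> = mcoeff k r *: << k >>.
  by apply/malgP => l; rewrite mcoeffZ !mcoeffU mulrnAr mulr1.
by apply: lspanZ; apply: lspan_gen; exists k.
Qed.

End MalgExtension.

Section QuotLift.
Context (F : fieldType) (V N : lmodType F) (S : V -> Prop).

Definition qlift (L : V -> N) (q : quot_mod S) : N := L (repr q).

Context (L : V -> N) (L_lin : linear L) (L_kill : forall s, S s -> L s = 0).

Lemma qliftE v : qlift L (qpi S v) = L v.
Proof.
have : lspan S (repr (qpi S v) - v) by apply/qpi_eq; rewrite qpiK.
move/(lspan_kill L_lin L_kill).
rewrite addrC -scaleN1r L_lin scaleN1r => /eqP.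
by rewrite addrC subr_eq0 => /eqP.
Qed.

Lemma qlift_linear : linear (qlift L).
Proof.
move=> a u v; rewrite -[u]qpiK -[v]qpiK -linearP !qliftE.
exact: L_lin.
Qed.

End QuotLift.

Section TensorLift.
Context (F : fieldType) (V N : lmodType F).

(** One function on all words stands for a multilinear map in every degree; by [tlift] this is the
    data of a linear map out of T(V). *)
Definition multilinear (h : seq V -> N) : Prop :=
  forall p p' a u v, h (p ++ (a *: u + v) :: p') = a *: h (p ++ u :: p') + h (p ++ v :: p').

Definition tlift (h : seq V -> N) : tensor_alg V -> N :=
  qlift (malg_ext (fun w : {fmonom V} => h w) : free_alg V -> N).

Lemma malg_ext_tensor_rel h (z : free_alg V) : multilinear h ->
  (exists a s b, tensor_rel s /\ z = a * s * b) ->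
  malg_ext (fun w : {fmonom V} => h w) z = 0.
Proof.
move=> hm [b [s [c [[a [u [v ->]]] ->]]]].
set L := malg_ext _; have Ll : linear (L : free_alg V -> N) := malg_ext_linear _.
have H (P : free_alg V -> N) : linear P -> (forall w, P << w >> = 0) -> forall r, P r = 0.
  move=> Pl P0 r; apply: (lspan_kill Pl _ (malg_lspan r)) => _ [w ->]; exact: P0.
(* By linearity the outer factors may be taken to be words, and then the relation is multilinearity
   of [h] in one slot. *)
move: c; apply: (H (fun c => L (b * _ * c))) => [d c c'|[w2]].
  by rewrite mulrDr -scalerAr Ll.
move: b; apply: (H (fun b => L (b * _ * _))) => [d b b'|[w1]].
  by rewrite !mulrDl -!scalerAl Ll.
rewrite gen_rel_word -scaleN1r addrC Ll Ll.
by rewrite /L !malg_extU /= hm scaleN1r addNr.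
Qed.

Lemma tlift_linear h : multilinear h -> linear (tlift h).
Proof.
move=> hm; apply: qlift_linear; first exact: malg_ext_linear.
by move=> s; exact: malg_ext_tensor_rel.
Qed.

Lemma tlift_word h w : multilinear h -> tlift h (word w) = h w.
Proof.
move=> hm; rewrite -(qproj_word (FMonom w)) /tlift [LHS]qliftE ?malg_extU //.
  exact: malg_ext_linear.
by move=> s; exact: malg_ext_tensor_rel.
Qed.

Lemma tensor_lspan (z : tensor_alg V) : lspan (fun s => exists w, s = word w) z.
Proof.
rewrite -[z]qprojK; move: (repr z) => r.
have Pl : linear (qproj (@tensor_rel F V) : free_alg V -> tensor_alg V).
  exact: qproj_linear.
apply: (lspan_linear Pl _ (malg_lspan r)) => _ [w ->].
by apply: lspan_gen; exists w; rewrite qproj_word.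
Qed.

End TensorLift.

Section TprodLift.
Context (F : fieldType) (U W N : lmodType F).

Definition blift (B : U -> W -> N) : tprod U W -> N :=
  qlift (malg_ext (fun p => B p.1 p.2)).

Context (B : U -> W -> N).
Hypotheses (Bl : forall w, linear (B^~ w)) (Br : forall u, linear (B u)).

Lemma blift_kill z : bilinear_rel z -> malg_ext (fun p => B p.1 p.2) z = 0.
Proof.
have Ll := malg_ext_linear (fun p : U * W => B p.1 p.2).
case=> [[a [u [u' [w ->]]]]|[a [u [w [w' ->]]]]]; rewrite -scaleN1r addrC Ll Ll !malg_extU /=.
  by rewrite (Bl w) scaleN1r addNr.
by rewrite (Br u) scaleN1r addNr.
Qed.

Lemma blift_linear : linear (blift B).
Proof. by apply: qlift_linear blift_kill; exact: malg_ext_linear. Qed.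

Lemma blift_tens u w : blift B (tens u w) = B u w.
Proof.
rewrite /blift [LHS](qliftE _ blift_kill) ?malg_extU //; exact: malg_ext_linear.
Qed.

End TprodLift.

(** * The tensor algebra and its skew derivations *)

Lemma scale_comb_l (F : fieldType) (V : lmodType F) (c a b : F) (w s s1 s2 : V) :
  s = c *: s1 + s2 -> (c * a + b) *: w + s = c *: (a *: w + s1) + (b *: w + s2).
Proof. by move=> ->; rewrite scalerDl scalerDr scalerA addrACA. Qed.

Lemma scale_comb_r (F : fieldType) (V : lmodType F) (c a : F) (w1 w2 s s1 s2 : V) :
  s = c *: s1 + s2 -> a *: (c *: w1 + w2) + s = c *: (a *: w1 + s1) + (a *: w2 + s2).
Proof. by move=> ->; rewrite !scalerDr !scalerA mulrC addrACA. Qed.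

Lemma formE (F : fieldType) (V : lmodType F) (f : V -> F^o) a u v :
  linear f -> f (a *: u + v) = (a * f u + f v : F).
Proof. by move=> ->. Qed.

(* An interface to T(M) and its coproduct: working with it rather than with the
   iterated quotients of Defs keeps unification away from their structure. *)
Record tensor_like (F : fieldType) (G : finGroupType) (M : ydModule F G) := TensorLike {
  tl_alg :> algType F;
  tl_in : M -> tl_alg;
  tl_in_linear : linear tl_in;
  tl_lift : forall N : lmodType F, (seq M -> N) -> tl_alg -> N;
  tl_lift_linear : forall (N : lmodType F) (h : seq M -> N),
    multilinear h -> linear (tl_lift h);
  tl_lift_word : forall (N : lmodType F) (h : seq M -> N) w,
    multilinear h -> tl_lift h (\prod_(v <- w) tl_in v) = h w;
  tl_span : forall z, lspan (fun s => exists w, s = \prod_(v <- w) tl_in v) z;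
  tl_prod : lmodType F;
  tl_tens : tl_alg -> tl_alg -> tl_prod;
  tl_tens_l : forall q, linear (tl_tens^~ q);
  tl_tens_r : forall p, linear (tl_tens p);
  tl_blift : forall N : lmodType F, (tl_alg -> tl_alg -> N) -> tl_prod -> N;
  tl_blift_linear : forall (N : lmodType F) (B : tl_alg -> tl_alg -> N),
    (forall q, linear (B^~ q)) -> (forall p, linear (B p)) -> linear (tl_blift B);
  tl_blift_tens : forall (N : lmodType F) (B : tl_alg -> tl_alg -> N) p q,
    (forall q, linear (B^~ q)) -> (forall p, linear (B p)) ->
    tl_blift B (tl_tens p q) = B p q;
  tl_coprod : tl_alg -> tl_prod;
  tl_coprod_linear : linear tl_coprod;
  tl_coprod_word : forall w, tl_coprod (\prod_(v <- w) tl_in v) =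
    \sum_(pq <- coprod_words w)
       tl_tens (\prod_(v <- pq.1) tl_in v) (\prod_(v <- pq.2) tl_in v)
}.

Definition tensor_alg_like (F : fieldType) (G : finGroupType) (M : ydModule F G) :
  tensor_like M :=
  @TensorLike F G M (tensor_alg M) (@iota F M) (@iota_linear F M)
    (@tlift F M) (@tlift_linear F M) (@tlift_word F M) (@tensor_lspan F M)
    (tprod (tensor_alg M) (tensor_alg M)) (@tens F _ _)
    (@tens_linear_l F _ _) (@tens_linear_r F _ _)
    (@blift F _ _) (@blift_linear F _ _)
    (fun N B p q Bl Br => @blift_tens F _ _ N B Bl Br p q)
    (@coprod F G M) (@coprod_linear F G M) (@coprod_wordE F G M).

Section TensorLikeTheory.
Context (F : fieldType) (G : finGroupType) (M : ydModule F G) (X : tensor_like M).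
Local Notation T := (tl_alg X).
Local Notation io := (@tl_in _ _ _ X).
Local Notation Fo := (F^o : lmodType F).
Implicit Types (f : M -> F^o) (v : M) (w : seq M) (z : T).

Definition tword w : T := \prod_(v <- w) io v.

Lemma tword_nil : tword [::] = 1.
Proof. exact: big_nil. Qed.

Lemma tword_cons v w : tword (v :: w) = io v * tword w.
Proof. exact: big_cons. Qed.

Lemma tword_cat p q : tword (p ++ q) = tword p * tword q.
Proof. exact: big_cat. Qed.

Lemma tword_linear p p' a u v :
  tword (p ++ (a *: u + v) :: p') = a *: tword (p ++ u :: p') + tword (p ++ v :: p').
Proof.
by rewrite !tword_cat !tword_cons tl_in_linear mulrDl mulrDr -scalerAl -scalerAr.
Qed.

Lemma tl_span_eq (N : lmodType F) (L L' : T -> N) : linear L -> linear L' ->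
  (forall w, L (tword w) = L' (tword w)) -> forall z, L z = L' z.
Proof.
move=> Ll Ll' H z; apply/eqP; rewrite -subr_eq0; apply/eqP.
apply: (lspan_kill (L := fun z => L z - L' z) _ _ (tl_span z)).
  by move=> a u v; rewrite Ll Ll' opprD addrACA scalerBr.
by move=> _ [w ->]; rewrite H subrr.
Qed.

Definition pi1_word (N : lmodType F) (f : M -> N) w : N := if w is [:: v] then f v else 0.

Definition pi1 (N : lmodType F) (f : M -> N) : T -> N := tl_lift (pi1_word f).

Lemma pi1_multilinear (N : lmodType F) (f : M -> N) : linear f ->
  multilinear (pi1_word f).
Proof.
move=> fl [|x p] p' a u v; last by case: p => [|? ?] /=; rewrite scaler0 addr0.
by case: p' => [|? ?] /=; rewrite ?fl ?scaler0 ?addr0.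
Qed.

Lemma pi1_linear (N : lmodType F) (f : M -> N) : linear f -> linear (pi1 f).
Proof. by move=> fl; exact/tl_lift_linear/pi1_multilinear. Qed.

Lemma pi1_tword (N : lmodType F) (f : M -> N) w : linear f ->
  pi1 f (tword w) = pi1_word f w.
Proof. by move=> fl; rewrite /pi1 tl_lift_word //; exact: pi1_multilinear. Qed.

Definition counit_word w : F^o := (nilp w)%:R.

Definition counit : T -> F^o := tl_lift counit_word.

Lemma counit_multilinear : multilinear counit_word.
Proof. by case=> [|? ?] p' a u v; rewrite /counit_word /= scaler0 addr0. Qed.

Lemma counit_linear : linear counit.
Proof. exact/tl_lift_linear/counit_multilinear. Qed.

Lemma counit_tword w : counit (tword w) = (nilp w)%:R.
Proof. by rewrite /counit tl_lift_word //; exact: counit_multilinear. Qed.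

Lemma counit1 : counit 1 = 1.
Proof. by rewrite -tword_nil counit_tword. Qed.

Lemma counit_inM v z : counit (io v * z) = 0.
Proof.
apply: (tl_span_eq (L := fun z => counit (io v * z)) (L' := fun=> 0)).
- by move=> a x y; rewrite mulrDr -scalerAr counit_linear.
- by move=> a x y; rewrite scaler0 addr0.
- by move=> w; rewrite -tword_cons counit_tword.
Qed.

Definition tdeg (n : nat) : T -> Prop := lspan (fun z => exists2 w, size w = n & z = tword w).

Definition homogeneous2 (S : T -> Prop) : Prop :=
  forall s, S s -> exists2 n, (2 <= n)%N & tdeg n s.

(** The generators have degree at least 2 and multiplication by words only lengthens them, so the
    ideal lies in the span of the words of length at least 2. *)
Lemma ideal_kill (N : lmodType F) (L : T -> N) (S : T -> Prop) : linear L ->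
  (forall w, (2 <= size w)%N -> L (tword w) = 0) -> homogeneous2 S ->
  forall z, ideal S z -> L z = 0.
Proof.
move=> Ll L0 hS z; apply: lspan_kill => // _ [a [s [b [Ss ->]]]].
have [n n2 ns] := hS s Ss.
apply: (lspan_kill (L := fun s => L (a * s * b)) _ _ ns) => [c x y|_ [w wn ->]].
  by rewrite mulrDr mulrDl -scalerAr -scalerAl Ll.
move: (tl_span a); apply: (lspan_kill (L := fun a => L (a * _ * b))) => [c x y|_ [p ->]].
  by rewrite !mulrDl -!scalerAl Ll.
move: (tl_span b); apply: (lspan_kill (L := fun b => L (_ * _ * b))) => [c x y|_ [q ->]].
  by rewrite mulrDr -scalerAr Ll.
rewrite -!tword_cat L0 // !size_cat wn addnAC addnC.
by apply: leq_trans n2 (leq_addr _ _).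
Qed.

Lemma ideal_gen (S : T -> Prop) z : S z -> ideal S z.
Proof. by move=> Sz; apply: lspan_gen; exists 1, z, 1; rewrite mul1r mulr1. Qed.

Lemma idealM2 (S : T -> Prop) a z b : ideal S z -> ideal S (a * z * b).
Proof. by move=> h; apply: idealMr; apply: idealMl. Qed.

(** The braided Leibniz rule: in the coproduct of v w, the factor 1 (x) v yields the terms g.p (x)
    v_g q, and pairing g.p with [f] replaces [f] by its composite with the action of g. *)
Fixpoint sder_word f w : T :=
  if w is v :: w' then
    (f v : F) *: tword w' + \sum_g io (yd_comp g v) * sder_word (fun u => f (yd_act g u)) w'
  else 0.

Lemma act_form_linear f g : linear f -> linear (fun u => f (yd_act g u)).
Proof. by move=> fl a u v; rewrite yd_act_linear fl. Qed.

Lemma sder_multilinear f : linear f -> multilinear (sder_word f).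
Proof.
move=> + p; elim: p f => [|x p IH] f fl p' a u v /=.
  rewrite formE //; apply: scale_comb_l.
  rewrite scaler_sumr -big_split /=; apply: eq_bigr => g _.
  by rewrite yd_comp_linear tl_in_linear mulrDl -scalerAl.
rewrite tword_linear; apply: scale_comb_r.
rewrite scaler_sumr -big_split /=; apply: eq_bigr => g _.
by rewrite IH ?mulrDr -?scalerAr //; exact: act_form_linear.
Qed.

(* The first tensor factor of the coproduct is projected to M and paired with f. *)
Definition sder f : T -> T := tl_lift (sder_word f).

Lemma sder_linear f : linear f -> linear (sder f).
Proof. by move=> fl; exact/tl_lift_linear/sder_multilinear. Qed.

Lemma sder_tword f w : linear f -> sder f (tword w) = sder_word f w.
Proof. by move=> fl; rewrite /sder tl_lift_word //; exact: sder_multilinear. Qed.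

Lemma sder1 f : linear f -> sder f 1 = 0.
Proof. by move=> fl; rewrite -tword_nil sder_tword. Qed.

Lemma sder_inM f v z : linear f ->
  sder f (io v * z) =
  (f v : F) *: z + \sum_g io (yd_comp g v) * sder (fun u => f (yd_act g u)) z.
Proof.
move=> fl; move: z; apply: tl_span_eq => [a x y|a x y|w].
- by rewrite mulrDr -scalerAr sder_linear.
- apply: scale_comb_r.
  rewrite scaler_sumr -big_split /=; apply: eq_bigr => g _.
  by rewrite sder_linear ?mulrDr -?scalerAr //; exact: act_form_linear.
- rewrite -tword_cons sder_tword //=; congr (_ + _); apply: eq_bigr => g _.
  by rewrite sder_tword //; exact: act_form_linear.
Qed.

Lemma coprod_words_counit w :
  \sum_(pq <- coprod_words w) (nilp pq.1)%:R *: tword pq.2 = tword w.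
Proof.
elim: w => [|v w IH]; first by rewrite big_seq1 scale1r.
rewrite (coprod_words_sum (fun p q => (nilp p)%:R *: tword q)).
under eq_bigr => pq _ do rewrite scale0r add0r.
rewrite exchange_big /=.
under eq_bigr => g _.
  under eq_bigr => pq _ do rewrite {1}/nilp size_map -/(nilp _) tword_cons scalerAr.
  by rewrite -mulr_sumr IH over.
rewrite -mulr_suml tword_cons; congr (_ * _).
have l0 : io 0 = 0 by exact: lin0 (@tl_in_linear _ _ _ X).
rewrite -[in RHS](yd_comp_sum v).
elim/big_rec2: _ => // g y1 y2 _ ->.
by rewrite -[yd_comp g v in RHS]scale1r tl_in_linear scale1r.
Qed.

Lemma coprod_words_sder f w :
  \sum_(pq <- coprod_words w) (@pi1_word Fo f pq.1 : F) *: tword pq.2 = sder_word f w.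
Proof.
elim: w f => [|v w IH] f; first by rewrite big_seq1 scale0r.
rewrite (coprod_words_sum (fun p q => (@pi1_word Fo f p : F) *: tword q)).
rewrite big_split /=; congr (_ + _).
  rewrite -[in RHS](coprod_words_counit w) scaler_sumr; apply: eq_bigr => -[[|? ?] ?] _ /=.
    by rewrite scale1r.
  by rewrite !scale0r scaler0.
rewrite exchange_big /=; apply: eq_bigr => g _.
rewrite -IH mulr_sumr; apply: eq_bigr => -[p q] _ /=.
by rewrite tword_cons -scalerAr; case: p => [|? [|? ?]].
Qed.

Lemma pi1_scale_l f : linear f -> forall q : T, linear (fun p : T => (@pi1 Fo f p : F) *: q).
Proof. by move=> fl q a x y; rewrite pi1_linear // scalerDl scalerA. Qed.

Lemma scale_linear (c : F) : linear (fun q : T => c *: q).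
Proof. by move=> a x y; rewrite scalerDr !scalerA mulrC. Qed.

Lemma sder_coprod f z : linear f ->
  sder f z = tl_blift (fun p q => (@pi1 Fo f p : F) *: q) (tl_coprod z).
Proof.
move=> fl; have Bl := pi1_scale_l fl; have Br p := scale_linear (@pi1 Fo f p).
have Ll := tl_blift_linear Bl Br.
move: z; apply: tl_span_eq => [|a x y|w]; first exact: sder_linear.
  by rewrite tl_coprod_linear Ll.
rewrite sder_tword // tl_coprod_word -coprod_words_sder.
elim: (coprod_words w) => [|pq s IH]; first by rewrite !big_nil lin0.
rewrite !big_cons IH -[tl_tens _ _]scale1r Ll scale1r tl_blift_tens //.
by rewrite -[\prod_(v <- pq.1) _]/(tword pq.1) pi1_tword.
Qed.

Definition tl_coideal (I : T -> Prop) : Prop :=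
  forall z, I z ->
    lspan (fun t => exists p q, (I p \/ I q) /\ t = tl_tens p q) (tl_coprod z).

Definition tl_nichols_rel (z : T) : Prop :=
  exists S : T -> Prop, [/\ homogeneous2 S, tl_coideal (ideal S) & ideal S z].

(** Write I for the ideal. The coproduct of z lies in I (x) T + T (x) I; the first summand dies
    because I has no component of degree 1, and the second lands in I. *)
Lemma sder_ideal f (S : T -> Prop) z : linear f -> homogeneous2 S ->
  tl_coideal (ideal S) -> ideal S z -> ideal S (sder f z).
Proof.
move=> fl hS cS Sz; rewrite sder_coprod //.
have Bl := pi1_scale_l fl; have Br p := scale_linear (@pi1 Fo f p).
apply: (lspan_linear (tl_blift_linear Bl Br) _ (cS z Sz)) => _ [p [q [pq ->]]].
rewrite tl_blift_tens //; case: pq => h; last exact: lspanZ.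
rewrite (ideal_kill (@pi1_linear Fo f fl) _ hS h) ?scale0r; first exact: lspan0.
move=> w w2; rewrite pi1_tword //.
by case: w w2 => [|? [|? ?]].
Qed.

Local Notation nichols_ideal := (ideal tl_nichols_rel).

Lemma nichols_ideal_kill (N : lmodType F) (L : T -> N) : linear L ->
  (forall w, (2 <= size w)%N -> L (tword w) = 0) ->
  forall z, nichols_ideal z -> L z = 0.
Proof.
move=> Ll L0 z; apply: lspan_kill => // _ [a [s [b [[S [hS _ Ss]] ->]]]].
by apply: (ideal_kill Ll L0 hS); exact: idealM2.
Qed.

Lemma nichols_ideal_counit z : nichols_ideal z -> counit z = 0.
Proof.
apply: nichols_ideal_kill; first exact: counit_linear.
by case=> // ? ? _; rewrite counit_tword.
Qed.

Lemma nichols_ideal_pi1 (N : lmodType F) (f : M -> N) z : linear f ->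
  nichols_ideal z -> pi1 f z = 0.
Proof.
move=> fl; apply: nichols_ideal_kill; first exact: pi1_linear.
by case=> [|? [|? ?]] // _; rewrite pi1_tword.
Qed.

Lemma nichols_ideal_sder f z : linear f -> nichols_ideal z -> nichols_ideal (sder f z).
Proof.
move=> fl; apply: lspan_linear; first exact: sder_linear.
move=> _ [a [s [b [[S [hS cS Ss]] ->]]]].
apply: ideal_gen; exists S; split => //.
by apply: sder_ideal => //; exact: idealM2.
Qed.

End TensorLikeTheory.

(** * Criteria for infinite dimension *)

Section FiniteCodimension.
Context (F : fieldType) (A : lmodType F).

Definition fin_codim (I : A -> Prop) : Prop :=
  exists s : seq A, forall z, lspan (fun y => y \in s \/ I y) z.

(** The coefficients are chosen before [L]: one family serves all functionals that vanish on [I], as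
    the rank argument below requires. *)
Lemma lspan_mod (I : A -> Prop) (s : seq A) z : lspan (fun y => y \in s \/ I y) z ->
  exists a : 'I_(size s) -> F, forall L : A -> F^o, linear L -> (forall y, I y -> L y = 0) ->
    L z = \sum_i a i * L s`_i.
Proof.
elim=> [|c u v h _ [a Ha]].
  by exists (fun=> 0) => L Ll _; rewrite lin0 // big1 // => i _; rewrite mul0r.
case: h => [us|Iu]; last first.
  by exists a => L Ll LI; rewrite formE // LI // mulr0 add0r Ha.
have iu : (index u s < size s)%N by rewrite index_mem.
exists (fun i => c * (i == Ordinal iu)%:R + a i) => L Ll LI.
rewrite formE // Ha //.
under [RHS]eq_bigr => i _ do rewrite mulrDl.
rewrite big_split /=; congr (_ + _).
rewrite (bigD1 (Ordinal iu)) //= eqxx mulr1 nth_index // big1 ?addr0 // => i ne.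
by rewrite (negPf ne) mulr0 mul0r.
Qed.

(** The functionals y -> eps (E^k y) vanish on [I], and their matrix on z_0, ..., z_d is diagonal
    and invertible. If d elements spanned modulo [I], this matrix of size d + 1 would have rank at
    most d. *)
Lemma lowering_infinite (I : A -> Prop) (eps : A -> F^o) (E : A -> A)
    (z : nat -> A) (c : nat -> F) :
  linear eps -> linear E -> (forall y, I y -> eps y = 0) -> (forall y, I y -> I (E y)) ->
  E (z 0%N) = 0 -> (forall k, E (z k.+1) = c k *: z k) -> (forall k, c k != 0) ->
  eps (z 0%N) != 0 -> (forall k, eps (z k.+1) = 0) -> ~ fin_codim I.
Proof.
move=> epsl El epsI EI Ez0 EzS c0 eps0 epsS [s spans].
pose L k y := eps (iter k E y).
have Ll k : linear (L k).
  by elim: k => [|k IH] a u v; rewrite /L ?iterSr ?El; [exact: epsl | exact: IH].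
have LI k y : I y -> L k y = 0.
  by elim: k y => [|k IH] y Iy; rewrite /L ?iterSr; [exact: epsI | exact/IH/EI].
have Lz k j : L k (z j) = 0 <-> k != j.
  elim: k j => [|k IH] [|j]; rewrite /L ?iterSr ?eqSS /=.
  - by split=> // /eqP; rewrite (negPf eps0).
  - by rewrite epsS.
  - by rewrite Ez0 -[eps _]/(L k 0) lin0.
  - rewrite EzS -[eps _]/(L k _) -[_ *: _]addr0 formE // lin0 // addr0 -IH.
    by split=> [/eqP|->]; rewrite ?mulr0 // mulf_eq0 (negPf (c0 j)) => /eqP.
have [a Ha] : exists a : nat -> 'I_(size s) -> F,
    forall j k, L k (z j) = \sum_i a j i * L k s`_i.
  have [a Ha] := choice (fun j => lspan_mod (spans (z j))).
  by exists a => j k; apply: Ha => //; exact: LI.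
pose d := size s.
pose P := \matrix_(j < d.+1, i < d) a j i.
pose Q := \matrix_(i < d, k < d.+1) (L k s`_i : F).
have E0 : P *m Q = diag_mx (\row_(j < d.+1) (L j (z j) : F)).
  apply/matrixP => j k; rewrite !mxE.
  under eq_bigr => i _ do rewrite !mxE.
  rewrite -Ha; case: (eqVneq j k) => [->|jk]; first by rewrite mulr1n.
  by rewrite mulr0n; apply/Lz; rewrite eq_sym.
have : (\rank (P *m Q) <= d)%N by apply: leq_trans (mxrankM_maxl _ _) _; exact: rank_leq_col.
rewrite E0 mxrank_unit ?ltnn // unitmxE det_diag unitfE.
apply/prodf_neq0 => j _; rewrite mxE; apply/eqP => /Lz.
by rewrite eqxx.
Qed.

End FiniteCodimension.

(** * Dual bases, for finite-dimensional spaces and for M *)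

Section DualBasis.
Context (F : fieldType) (V : lmodType F).

Let spanning n (b : 'I_n -> V) := forall v, exists c : 'I_n -> F, v = \sum_i c i *: b i.

(** A nonzero coefficient would express one vector by the others and leave a shorter spanning
    family. *)
Lemma spanning_free n (b : 'I_n -> V) (c : 'I_n -> F) :
  spanning b -> (forall k (b' : 'I_k -> V), spanning b' -> (n <= k)%N) ->
  \sum_i c i *: b i = 0 -> forall i, c i = 0.
Proof.
case: n b c => [|n] b c sb nmin E i; first by case: i.
apply/eqP/negPn/negP => ci.
suff /nmin : spanning (fun j => b (lift i j)) by rewrite ltnn.
have bi : b i = - (c i)^-1 *: \sum_j c (lift i j) *: b (lift i j).
  move/eqP: E; rewrite (bigD1_ord i) //= addr_eq0 => /eqP E.
  by rewrite scaleNr -scalerN -E scalerA mulVf // scale1r.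
move=> v; have [d ->] := sb v.
exists (fun j => d (lift i j) - d i * (c i)^-1 * c (lift i j)).
rewrite (bigD1_ord i) //= bi scalerA scaler_sumr -big_split /=.
by apply: eq_bigr => j _; rewrite scalerA -scalerDl addrC mulrN mulNr.
Qed.

Lemma dual_basis (s : seq V) : (forall v, lspan (fun u => u \in s) v) ->
  exists n (b : 'I_n -> V) (f : 'I_n -> V -> F^o),
    (forall i, linear (f i)) /\ (forall v, v = \sum_i (f i v : F) *: b i).
Proof.
move=> ss.
have : exists n, `[< exists b : 'I_n -> V, spanning b >].
  exists (size s); apply/asboolP; exists (fun i => s`_i) => v.
  elim: (ss v) => [|c u w us _ [a ->]].
    by exists (fun=> 0); rewrite big1 // => i _; rewrite scale0r.
  have iu : (index u s < size s)%N by rewrite index_mem.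
  exists (fun i => c * (i == Ordinal iu)%:R + a i).
  under [RHS]eq_bigr => i _ do rewrite scalerDl.
  rewrite big_split /=; congr (_ + _).
  rewrite (bigD1 (Ordinal iu)) //= eqxx mulr1 nth_index // big1 ?addr0 // => i ne.
  by rewrite (negPf ne) mulr0 scale0r.
move=> ex; case: (ex_minnP ex) => n /asboolP[b sb] nmin.
have {}nmin k (b' : 'I_k -> V) : spanning b' -> (n <= k)%N.
  by move=> sb'; apply: nmin; apply/asboolP; exists b'.
have [c Hc] := choice sb.
exists n, b, (fun i v => c v i); split=> // i a u v.
apply/eqP; rewrite -subr_eq0; apply/eqP.
apply: (spanning_free (c := fun i => c (a *: u + v) i - (a * c u i + c v i)) sb nmin).
under eq_bigr => j _ do rewrite scalerBl scalerDl -scalerA.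
by rewrite sumrB big_split /= -scaler_sumr -!Hc subrr.
Qed.

End DualBasis.

Section SupportOfFinite.
Context (F : fieldType) (G : finGroupType) (M : ydModule F G) (X : tensor_like M).

(** The projection to degree 1 kills the Nichols ideal and is the identity on M, so a finite
    spanning set modulo the ideal projects to one of M. *)
Lemma fin_codim_dual_basis : fin_codim (ideal (@tl_nichols_rel _ _ _ X)) ->
  exists n (b : 'I_n -> M) (f : 'I_n -> M -> F^o),
    (forall i, linear (f i)) /\ (forall v, v = \sum_i (f i v : F) *: b i).
Proof.
case=> s ss.
pose L := @pi1 _ _ _ X M (fun v => v).
have idl : linear (fun v : M => v) by [].
apply: (@dual_basis _ _ (map L s)) => v.
have -> : v = L (tl_in X v).
  have := @pi1_tword _ _ _ X M _ [:: v] idl.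
  by rewrite /tword big_seq1.
apply: lspan_linear (pi1_linear idl) _ _ (ss _) => y [ys|Iy].
  by apply: lspan_gen; exact: map_f.
have -> : pi1 (fun v : M => v) y = 0 by exact: nichols_ideal_pi1.
exact: lspan0.
Qed.

End SupportOfFinite.

(** * Infinite dimension from powers of a root vector, ranks one and two *)

Section Lowering.
Context (F : fieldType) (A : algType F) (I : A -> Prop) (eps : A -> F^o).
Hypotheses (F0 : [pchar F] =i pred0) (epsl : linear eps) (eps1 : eps 1 != 0).
Hypothesis epsI : forall y, I y -> eps y = 0.

(** By induction E(z^(k+1)) = (k+1) kappa z^k, and the factor is nonzero in characteristic 0. *)
Lemma power_lowering (E : A -> A) (z : A) (kappa : F) :
  linear E -> (forall y, I y -> I (E y)) -> kappa != 0 ->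
  E 1 = 0 -> (forall k, E (z * z ^+ k) = kappa *: z ^+ k + z * E (z ^+ k)) ->
  (forall y, eps (z * y) = 0) -> ~ fin_codim I.
Proof.
move=> El EI k0 E1 Ez epsz.
apply: (lowering_infinite (eps := eps) (E := E) (z := fun k => z ^+ k)
  (c := fun k => kappa * k.+1%:R)) => //.
- elim=> [|k IH]; first by rewrite exprS Ez !expr0 E1 mulr0 addr0 mulr1.
  rewrite exprS Ez IH -scalerAr -exprS -scalerDl; congr (_ *: _).
  by rewrite -[in RHS]add1n natrD mulrDr mulr1.
- by move=> k; rewrite mulf_neq0 // (iffLR (pcharf0P F) F0).
- by move=> k; rewrite exprS.
Qed.

Lemma rank1_infinite (D : A -> A) (v : A) :
  linear D -> (forall y, I y -> I (D y)) -> D 1 = 0 ->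
  (forall y, D (v * y) = y + v * D y) -> (forall y, eps (v * y) = 0) -> ~ fin_codim I.
Proof.
move=> Dl DI D1 Dv epsv; apply: (power_lowering Dl DI (oner_neq0 F)) => // k.
by rewrite Dv scale1r.
Qed.

(** The subalgebra generated by [a] and [b], built by left multiplications. [rank2_infinite] asks
    for its Leibniz rules only there, because the second-order operators attached to reflections are
    shown to satisfy them only on such a subalgebra. *)
Inductive generated2 (a b : A) : A -> Prop :=
| generated2_1 : generated2 a b 1
| generated2_l y : generated2 a b y -> generated2 a b (a * y)
| generated2_r y : generated2 a b y -> generated2 a b (b * y)
| generated2_comb (c : F) y y' :
    generated2 a b y -> generated2 a b y' -> generated2 a b (c *: y + y').

(* The rank two diagram with vertices q and edge q^-2 is of affine type; the root
   vector z = b a - q^-1 a b of the imaginary root has self-braiding 1, so that its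
   powers do not vanish. *)
Lemma rank2_infinite (Da Db : A -> A) (a b : A) (q : F) :
  linear Da -> linear Db ->
  (forall y, I y -> I (Da y)) -> (forall y, I y -> I (Db y)) ->
  q != 0 -> q ^+ 2 != 1 -> Da 1 = 0 -> Db 1 = 0 ->
  (forall y, generated2 a b y -> Da (a * y) = y + q *: (a * Da y)) ->
  (forall y, generated2 a b y -> Da (b * y) = q^-1 *: (b * Da y)) ->
  (forall y, generated2 a b y -> Db (b * y) = y + q *: (b * Db y)) ->
  (forall y, generated2 a b y -> Db (a * y) = q^-1 *: (a * Db y)) ->
  (forall y, eps (a * y) = 0) -> (forall y, eps (b * y) = 0) -> ~ fin_codim I.
Proof.
move=> Dal Dbl DaI DbI q0 q2 Da1 Db1 Daa Dab Dbb Dba epsa epsb.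
set P := generated2 a b in Daa Dab Dbb Dba.
have P0 : P 0 by rewrite -[0](addNr 1) -scaleN1r; apply: generated2_comb; exact: generated2_1.
have PZ c y : P y -> P (c *: y) by move=> Py; rewrite -[_ *: _]addr0; exact: generated2_comb.
have PD y y' : P y -> P y' -> P (y + y').
  by move=> Py Py'; rewrite -[y]scale1r; exact: generated2_comb.
have PDb y : P y -> P (Db y).
  elim=> [|u Pu IH|u Pu IH|c u u' _ IHu _ IHu']; rewrite ?Db1 //.
  - by rewrite Dba //; apply: PZ; exact: generated2_l.
  - by rewrite Dbb //; apply: (PD) => //; apply: PZ; exact: generated2_r.
  - by rewrite Dbl; exact: generated2_comb.
pose z := (- q^-1) *: (a * b) + b * a.
have zE y : z * y = (- q^-1) *: (a * (b * y)) + b * (a * y).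
  by rewrite mulrDl -scalerAl !mulrA.
have Pz y : P y -> P (z * y).
  move=> Py; rewrite zE; apply: generated2_comb.
    by apply: generated2_l; exact: generated2_r.
  by apply: generated2_r; exact: generated2_l.
have Pzk k : P (z ^+ k).
  by elim: k => [|k IH]; [exact: generated2_1 | rewrite exprS; exact: Pz].
have Pa y : P y -> P (a * y) by exact: generated2_l.
have Pb y : P y -> P (b * y) by exact: generated2_r.
(* The coefficient -q^-1 in [z] makes the terms without [Da y] cancel. *)
have Daz y : P y -> Da (z * y) = z * Da y.
  move=> Py; rewrite !zE Dal (Daa _ (Pb _ Py)) (Dab _ Py) (Dab _ (Pa _ Py)) (Daa _ Py).
  rewrite -!scalerAr mulrDr !scalerDr -!scalerAr !scalerA.
  by rewrite addrACA scaleNr addNr add0r mulNr mulVf // mulN1r scale1r.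
have Dbz y : P y -> Db (z * y) = (1 - q ^- 2) *: (a * y) + z * Db y.
  move=> Py; rewrite !zE Dbl (Dba _ (Pb _ Py)) (Dbb _ Py) (Dbb _ (Pa _ Py)) (Dba _ Py).
  rewrite -!scalerAr mulrDr !scalerDr -!scalerAr !scalerA.
  rewrite addrACA divff // scale1r -mulrA mulVf // mulr1; congr (_ + _).
  by rewrite addrC scalerBl scale1r mulNr -invfM -expr2 scaleNr.
have Dazk k : Da (z ^+ k) = 0.
  by elim: k => [|k IH] //; rewrite exprS Daz // IH mulr0.
(* [Db] takes z to a multiple of a, and [Da] takes a to 1; as [Da] kills the powers of z, no other
   term contributes. *)
apply: (@power_lowering (fun y => Da (Db y)) z (1 - q ^- 2)).
- by move=> c u v; rewrite Dbl Dal.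
- by move=> y /DbI/DaI.
- by rewrite subr_eq0 eq_sym invr_eq1.
- by rewrite Db1 lin0.
- move=> k; rewrite Dbz // Dal Daz; last by apply: PDb.
  by rewrite Daa // Dazk mulr0 scaler0 addr0.
- by move=> y; rewrite zE formE // epsa epsb mulr0 addr0.
Qed.

End Lowering.

(** * Skew derivations of iterated brackets, and the criterion in rank four *)

Section TwistedLeibniz.
Context (F : fieldType) (A : algType F).

(** [x'] plays the part of D(x), and [kappa] is the scalar picked up when D passes [x]. *)
Definition leibniz (D : A -> A) (x x' : A) (kappa : F) : Prop :=
  forall y, D (x * y) = x' * y + kappa *: (x * D y).

(** The q-commutator l w x - mu x w. The weight [l] allows the derivative of a bracket to be a
    bracket again, as in [leibniz_bracket0r]. *)
Definition bracket (l mu : F) (w x : A) : A := (- mu) *: (x * w) + l *: (w * x).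

Lemma leibnizZ D x x' c kappa : linear D -> leibniz D x x' kappa ->
  leibniz D (c *: x) (c *: x') kappa.
Proof.
move=> Dl H y; rewrite -!scalerAl -[c *: (x * y)]addr0 Dl lin0 // addr0 H.
by rewrite scalerDr !scalerA mulrC.
Qed.

Lemma leibnizM D x x' w w' kappa lambda :
  leibniz D x x' kappa -> leibniz D w w' lambda ->
  leibniz D (x * w) (x' * w + kappa *: (x * w')) (kappa * lambda).
Proof.
move=> Hx Hw y; rewrite -mulrA Hx Hw mulrDr scalerDr !mulrDl -!scalerAr -!scalerAl.
by rewrite scalerA !mulrA addrA.
Qed.

Lemma leibniz_comb D x x' w w' c kappa : linear D ->
  leibniz D x x' kappa -> leibniz D w w' kappa ->
  leibniz D (c *: x + w) (c *: x' + w') kappa.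
Proof.
move=> Dl Hx Hw y; rewrite !mulrDl -!scalerAl Dl Hx Hw scalerDr !scalerDr !scalerA mulrC.
by rewrite addrACA.
Qed.

Lemma leibniz_bracket D l mu w x w' x' kappa lambda : linear D ->
  leibniz D x x' kappa -> leibniz D w w' lambda ->
  leibniz D (bracket l mu w x)
    ((- mu) *: (x' * w + kappa *: (x * w')) + l *: (w' * x + lambda *: (w * x')))
    (lambda * kappa).
Proof.
move=> Dl Hx Hw; apply: (leibniz_comb _ Dl); last by apply: (leibnizZ _ Dl); exact: leibnizM.
by rewrite mulrC; exact: leibnizM.
Qed.

(** In this name and the next two, the first character is the derivative of [w] and the second that
    of [x], with [r] for an arbitrary one. *)
Lemma leibniz_bracket00 D l mu w x kappa lambda nu : linear D ->
  leibniz D x 0 kappa -> leibniz D w 0 lambda -> lambda * kappa = nu ->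
  leibniz D (bracket l mu w x) 0 nu.
Proof.
move=> Dl Hx Hw <-; have := leibniz_bracket l mu Dl Hx Hw.
by rewrite !mul0r !mulr0 !scaler0 !addr0 !scaler0 addr0.
Qed.

Lemma leibniz_bracket10 D l mu w x kappa lambda nu : linear D ->
  leibniz D x 0 kappa -> leibniz D w 1 lambda -> lambda * kappa = nu ->
  leibniz D (bracket l mu w x) ((l - mu * kappa) *: x) nu.
Proof.
move=> Dl Hx Hw <-; have := leibniz_bracket l mu Dl Hx Hw.
rewrite mul0r add0r mulr1 mulr0 scaler0 addr0 mul1r scalerA -scalerDl.
by rewrite addrC mulNr.
Qed.

Lemma leibniz_bracket0r D l mu w x x' kappa lambda nu : linear D ->
  leibniz D x x' kappa -> leibniz D w 0 lambda -> lambda * kappa = nu ->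
  leibniz D (bracket l mu w x) (bracket (l * lambda) mu w x') nu.
Proof.
move=> Dl Hx Hw <-; have := leibniz_bracket l mu Dl Hx Hw.
by rewrite mul0r add0r mulr0 scaler0 addr0 scalerA.
Qed.

End TwistedLeibniz.

Section RankFour.
Context (F : fieldType) (A : algType F) (I : A -> Prop) (eps : A -> F^o).
Hypotheses (F0 : [pchar F] =i pred0) (epsl : linear eps) (eps1 : eps 1 != 0).
Hypothesis epsI : forall y, I y -> eps y = 0.

(* The diagram is a square with all vertices -1 and edges s, s^-1, s, s^-1, where
   s = alpha beta: it is affine, and the iterated bracket [c, [b, [d, a]]] is a root
   vector of the imaginary root, of self-braiding 1. *)
Lemma rank4_infinite (Da Db Dc Dd : A -> A) (a b c d : A) (alpha beta : F) :
  linear Da -> linear Db -> linear Dc -> linear Dd ->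
  (forall y, I y -> I (Da y)) -> (forall y, I y -> I (Db y)) ->
  (forall y, I y -> I (Dc y)) -> (forall y, I y -> I (Dd y)) ->
  Da 1 = 0 -> Db 1 = 0 -> Dc 1 = 0 -> Dd 1 = 0 ->
  alpha != 0 -> beta != 0 -> alpha * beta != 1 ->
  leibniz Da a 1 (-1) -> leibniz Db a 0 (-1) ->
  leibniz Dc a 0 alpha -> leibniz Dd a 0 alpha^-1 ->
  leibniz Da b 0 (-1) -> leibniz Db b 1 (-1) ->
  leibniz Dc b 0 alpha^-1 -> leibniz Dd b 0 alpha ->
  leibniz Da c 0 beta -> leibniz Db c 0 beta^-1 ->
  leibniz Dc c 1 (-1) -> leibniz Dd c 0 (-1) ->
  leibniz Da d 0 beta^-1 -> leibniz Db d 0 beta ->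
  leibniz Dc d 0 (-1) -> leibniz Dd d 1 (-1) ->
  (forall y, eps (a * y) = 0) -> (forall y, eps (b * y) = 0) ->
  (forall y, eps (c * y) = 0) -> (forall y, eps (d * y) = 0) -> ~ fin_codim I.
Proof.
move=> Dal Dbl Dcl Ddl DaI DbI DcI DdI Da1 Db1 Dc1 Dd1 al0 be0 s1.
move=> Daa Dba Dca Dda Dab Dbb Dcb Ddb Dac Dbc Dcc Ddc Dad Dbd Dcd Ddd.
move=> epsa epsb epsc epsd.
(* In the three brackets [x1], [x2] and [z], [mu] is the scalar by which the degree of the left
   entry acts on the right entry, so these are braided commutators; in particular [Da] kills
   [x1]. *)
pose x1 := bracket 1 beta^-1 d a.
have Da1' : leibniz Da x1 0 (- beta^-1).
  have -> : 0 = bracket (1 * beta^-1) beta^-1 d 1 :> A.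
    by rewrite /bracket mul1r mulr1 mul1r scaleNr addNr.
  by apply: leibniz_bracket0r Daa Dad _ => //; rewrite mulrN1.
have Db1' : leibniz Db x1 0 (- beta) by apply: leibniz_bracket00 Dba Dbd _ => //; ring.
have Dc1' : leibniz Dc x1 0 (- alpha) by apply: leibniz_bracket00 Dca Dcd _ => //; ring.
have Dd1' : leibniz Dd x1 ((1 - beta^-1 * alpha^-1) *: a) (- alpha^-1).
  by apply: leibniz_bracket10 Dda Ddd _ => //; ring.
pose x2 := bracket 1 (- alpha) b x1.
have Da2 : leibniz Da x2 0 (beta^-1) by apply: leibniz_bracket00 Da1' Dab _ => //; ring.
have Db2 : leibniz Db x2 ((1 - - alpha * - beta) *: x1) beta.
  by apply: leibniz_bracket10 Db1' Dbb _ => //; ring.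
have Dc2 : leibniz Dc x2 0 (-1) by apply: leibniz_bracket00 Dc1' Dcb _ => //; field.
pose x2d := bracket (1 * alpha) (- alpha) b ((1 - beta^-1 * alpha^-1) *: a).
have Dd2 : leibniz Dd x2 x2d (-1) by apply: leibniz_bracket0r Dd1' Ddb _ => //; field.
pose z := bracket 1 (-1) c x2.
have Da3 : leibniz Da z 0 1 by apply: leibniz_bracket00 Da2 Dac _ => //; field.
pose zb := bracket (1 * beta^-1) (-1) c ((1 - - alpha * - beta) *: x1).
have Db3 : leibniz Db z zb 1 by apply: leibniz_bracket0r Db2 Dbc _ => //; field.
have Dc3 : leibniz Dc z 0 1.
  have -> : 0 = (1 - -1 * -1) *: x2 by rewrite mulrNN mulr1 subrr scale0r.
  by apply: leibniz_bracket10 Dc2 Dcc _ => //; ring.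
pose zd := bracket (1 * -1) (-1) c x2d.
have Dd3 : leibniz Dd z zd 1 by apply: leibniz_bracket0r Dd2 Ddc _ => //; ring.
have Da2d : leibniz Da x2d 0 1.
  have -> : 0 = bracket (1 * alpha * -1) (- alpha) b ((1 - beta^-1 * alpha^-1) *: 1) :> A.
    rewrite /bracket -scalerAr -scalerAl mulr1 mul1r !scalerA mul1r -scalerDl.
    by rewrite [X in X *: _](_ : _ = 0) ?scale0r //; ring.
  apply: leibniz_bracket0r (leibnizZ _ Dal Daa) Dab _ => //; ring.
have Dazd : leibniz Da zd 0 beta by apply: leibniz_bracket00 Da2d Dac _ => //; ring.
set e := 1 - - alpha * - beta in zb Db3.
have Dczb : leibniz Dc zb ((1 * beta^-1 - -1 * - alpha) *: (e *: x1)) alpha.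
  apply: leibniz_bracket10 (_ : leibniz Dc (e *: x1) 0 (- alpha)) Dcc _ => //; last by ring.
  by rewrite -(scaler0 _ e); exact: leibnizZ.
pose Z k := z ^+ k.
have ZS k : Z k.+1 = z * Z k by rewrite /Z exprS.
have DaZ k : Da (Z k) = 0.
  by elim: k => [|k IH] //; rewrite ZS Da3 IH mul0r mulr0 scaler0 addr0.
have DcZ k : Dc (Z k) = 0.
  by elim: k => [|k IH] //; rewrite ZS Dc3 IH mul0r mulr0 scaler0 addr0.
have zd0 y : Da (zd * y) = beta *: (zd * Da y) by rewrite Dazd mul0r add0r.
have DadZ k : Da (Dd (Z k)) = 0.
  elim: k => [|k IH]; first by rewrite Dd1 (lin0 Dal).
  by rewrite ZS Dd3 scale1r linD // zd0 DaZ Da3 IH mul0r !mulr0 !scaler0 !addr0.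
have DcbZ k : Dc (Db (Z k.+1)) =
    ((1 * beta^-1 - -1 * - alpha) * e) *: (x1 * Z k) + z * Dc (Db (Z k)).
  rewrite ZS Db3 scale1r linD // Dczb DcZ Dc3 mul0r mulr0 scaler0 addr0 add0r scale1r.
  by rewrite scalerA -scalerAl.
have DacbZ k : Da (Dc (Db (Z k))) = 0.
  elim: k => [|k IH]; first by rewrite Db1 (lin0 Dcl) (lin0 Dal).
  by rewrite DcbZ Dal Da1' Da3 IH DaZ mul0r add0r mul0r !mulr0 !scaler0 !addr0.
(* [E] strips b, c, d, a in turn from z = [c, [b, [d, a]]]. The cross terms vanish because Da, Dc,
   Da Dd and Da Dc Db kill the powers of z. *)
pose E y := Da (Dd (Dc (Db y))).
pose kappa := (1 * beta^-1 - -1 * - alpha) * e * (1 - beta^-1 * alpha^-1).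
apply: (@power_lowering _ _ I eps F0 epsl eps1 epsI E z kappa).
- by move=> k u v; rewrite /E Dbl Dcl Ddl Dal.
- by move=> y /DbI/DcI/DdI/DaI.
(* Up to a unit, [kappa] is the cube of 1 - alpha beta. *)
- have -> : kappa = beta^-1 * (1 - alpha * beta) ^+ 3 * (-1) * (alpha * beta)^-1.
    by rewrite /kappa /e; field; rewrite al0 be0.
  have e0 : 1 - alpha * beta != 0 by rewrite subr_eq0 eq_sym.
  have := expf_neq0 3 e0; move: (_ ^+ 3) => e3 e30.
  by rewrite !mulf_neq0 // ?oppr_eq0 ?oner_neq0 ?invr_eq0 // mulf_neq0.
- by rewrite /E Db1 (lin0 Dcl) (lin0 Ddl) (lin0 Dal).
- move=> k; rewrite -/(Z k) -ZS /E DcbZ Ddl Dd1' Dal linD // -scalerAl linZ // Daa DaZ.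
  rewrite mulr0 scaler0 addr0 mul1r linZ // Da1' DadZ mul0r add0r mulr0 !scaler0 addr0.
  rewrite Dd3 linD // zd0 DacbZ mulr0 scaler0 add0r scale1r Da3 mul0r add0r scale1r.
  by rewrite scalerA /kappa !mul1r.

- have eb (l mu : F) w x : (forall y, eps (w * y) = 0) -> (forall y, eps (x * y) = 0) ->
      forall y, eps (bracket l mu w x * y) = 0.
    move=> ew ex y; rewrite /bracket mulrDl -!scalerAl formE // -!mulrA ex mulr0 add0r.
    by rewrite -[l *: _]addr0 formE // ew mulr0 add0r lin0.
  by apply: (eb) => //; apply: (eb) => //; apply: (eb).
Qed.

End RankFour.

(** * Bihomogeneous vectors for the rotations *)

Section SkewDerivationScaling.
Context (F : fieldType) (G : finGroupType) (M : ydModule F G) (X : tensor_like M).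

Lemma sderZ (f : M -> F^o) (c : F) (z : X) : linear f ->
  sder (fun u => c * f u) z = c *: sder f z.
Proof.
move=> fl.
have cl (h : M -> F^o) : linear h -> linear ((fun u => c * h u) : M -> F^o).
  by move=> hl a u v; rewrite hl mulrDr; congr (_ + _); rewrite -mulrCA.
move: z; apply: tl_span_eq => [|a x y|w]; first exact/sder_linear/cl.
  by rewrite sder_linear // scalerDr !scalerA mulrC.
rewrite !sder_tword //; last exact: cl.
elim: w f fl => [|v w IH] f fl /=; first by rewrite scaler0.
rewrite scalerDr scalerA; congr (_ + _); rewrite scaler_sumr; apply: eq_bigr => g _.
by rewrite scalerAr -IH //; exact: act_form_linear.
Qed.

Lemma sder_homM (f : M -> F^o) (v : M) (g : G) (z : X) : linear f -> yd_comp g v = v ->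
  sder f (tl_in X v * z) =
  (f v : F) *: z + tl_in X v * sder (fun u => f (yd_act g u)) z.
Proof.
move=> fl gv; rewrite sder_inM //; congr (_ + _).
rewrite (bigD1 g) //= gv big1 ?addr0 // => h hg.
rewrite -gv yd_comp_comp (negPf hg) (lin0 (@tl_in_linear _ _ _ X)) mul0r; reflexivity.
Qed.

End SkewDerivationScaling.

Lemma opp1_neq1 (F : fieldType) : [pchar F] =i pred0 -> (-1 : F) != 1.
Proof. by move=> F0; rewrite eq_sym -subr_eq0 opprK -mulr2n (iffLR (pcharf0P F) F0). Qed.

Section Rotations.
Context (F : fieldType) (F0 : [pchar F] =i pred0) (gT : finGroupType) (t : nat).
Local Notation m := (4 * t)%N.
Context (t_gt0 : (0 < t)%N) (omega : F) (homega : m.-primitive_root omega).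
Context (x y : gT) (x2 : (x ^+ 2 = 1)%g) (ym : (y ^+ m = 1)%g) (xy : (x * y = y^-1 * x)%g).

Lemma Zp_cast4 : (Zp_trunc m).+2 = m.
Proof. by rewrite Zp_cast //; apply: leq_trans (leq_mul (leqnn 4) t_gt0). Qed.

(** Rotations and characters are indexed by ['Z_m], so that types can be negated and sums reindexed
    by translation. *)
Definition rot (j : 'Z_m) : gT := (y ^+ j)%g.

Lemma rot_mod (a : nat) : (y ^+ (a %% (Zp_trunc m).+2) = y ^+ a)%g.
Proof. by rewrite Zp_cast4 expg_mod. Qed.

Lemma rotD i j : rot (i + j) = (rot i * rot j)%g.
Proof. by rewrite /rot -expgD -[RHS]rot_mod. Qed.

Lemma rot0 : rot 0 = 1%g.
Proof. by []. Qed.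

Lemma rotN j : rot (- j) = (rot j)^-1%g.
Proof. by apply: (mulgI (rot j)); rewrite -rotD subrr mulgV. Qed.

Lemma rot_x j : (x * rot j = rot (- j) * x)%g.
Proof.
rewrite rotN /rot; elim: (val j) => [|k IH]; first by rewrite invg1 mulg1 mul1g.
by rewrite expgSr mulgA IH -mulgA xy mulgA -invMg -expgS expgSr.
Qed.

Definition chi (j : 'Z_m) : F := omega ^+ j.

Lemma chi_mod (a : nat) : omega ^+ (a %% (Zp_trunc m).+2) = omega ^+ a.
Proof. by rewrite Zp_cast4 prim_expr_mod. Qed.

Lemma chiD i j : chi (i + j) = chi i * chi j.
Proof. by rewrite /chi -exprD -[RHS]chi_mod. Qed.

Lemma chi0 : chi 0 = 1.
Proof. by []. Qed.

Lemma chi_neq0 j : chi j != 0.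
Proof.
by apply/eqP => E; have := oner_neq0 F; rewrite -chi0 -(subrr j) chiD E mul0r eqxx.
Qed.

Lemma chiN j : chi (- j) = (chi j)^-1.
Proof. by apply: (mulfI (chi_neq0 j)); rewrite -chiD subrr mulfV ?chi_neq0. Qed.

Lemma chi_eq1 j : (chi j == 1) = (j == 0).
Proof.
rewrite /chi -(prim_order_dvd homega); have jm : (j < m)%N by rewrite -[X in (_ < X)%N]Zp_cast4.
apply/idP/eqP => [/dvdnP[k jk]|->]; last by rewrite dvdn0.
apply: val_inj; rewrite /= jk; move: jm; rewrite jk.
by case: k {jk} => // k; rewrite mulSn ltnNge leq_addr.
Qed.

Lemma sum_chi (a : 'Z_m) : \sum_j chi (a * j) = if a == 0 then m%:R else 0.
Proof.
case: eqVneq => [->|a0].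
  under eq_bigr => j _ do rewrite mul0r chi0.
  by rewrite sumr_const card_ord Zp_cast4.
have E : \sum_j chi (a * j) = chi a * \sum_j chi (a * j).
  rewrite [LHS](reindex_inj (addrI 1)) /= mulr_sumr; apply: eq_bigr => j _.
  by rewrite mulrDr mulr1 chiD.
apply/eqP; move/eqP: E; rewrite -subr_eq0 -{1}[\sum_j _]mul1r -mulrBl mulf_eq0.
by rewrite subr_eq0 eq_sym chi_eq1 (negPf a0).
Qed.

Lemma m_neq0 : (m%:R : F) != 0.
Proof. by rewrite (iffLR (pcharf0P F) F0) muln_eq0 /= -lt0n. Qed.

Context (M : ydModule F gT).
Implicit Types (v : M) (i j k p q : 'Z_m).

(** The Fourier projector onto the eigenspace of y for omega^k. *)
Definition eigenproj (k : 'Z_m) (v : M) : M :=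
  m%:R^-1 *: \sum_j chi (- (k * j)) *: yd_act (rot j) v.

Definition bigrade (i k : 'Z_m) (v : M) : M := yd_comp (rot i) (eigenproj k v).

Definition hom (i k : 'Z_m) (v : M) : Prop :=
  yd_comp (rot i) v = v /\ forall j, yd_act (rot j) v = chi (k * j) *: v.

Lemma act_sum g (J : Type) (r : seq J) (P : pred J) (f : J -> M) :
  yd_act g (\sum_(j <- r | P j) f j) = \sum_(j <- r | P j) yd_act g (f j).
Proof.
elim: r => [|j r IH]; first by rewrite !big_nil (lin0 (@yd_act_linear _ _ M g)).
by rewrite !big_cons; case: ifP => _; rewrite ?(linD _ _ (@yd_act_linear _ _ M g)) IH.
Qed.

Lemma comp_sum g (J : Type) (r : seq J) (P : pred J) (f : J -> M) :
  yd_comp g (\sum_(j <- r | P j) f j) = \sum_(j <- r | P j) yd_comp g (f j).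
Proof.
elim: r => [|j r IH]; first by rewrite !big_nil (lin0 (@yd_comp_linear _ _ M g)).
by rewrite !big_cons; case: ifP => _; rewrite ?(linD _ _ (@yd_comp_linear _ _ M g)) IH.
Qed.

Lemma actZ g a (v : M) : yd_act g (a *: v) = a *: yd_act g v.
Proof. exact: linZ (@yd_act_linear _ _ M g). Qed.

Lemma compZ g a (v : M) : yd_comp g (a *: v) = a *: yd_comp g v.
Proof. exact: linZ (@yd_comp_linear _ _ M g). Qed.

Lemma eigenproj_linear k : linear (eigenproj k).
Proof.
move=> a u v; rewrite /eigenproj scalerA mulrC -scalerA -scalerDr; congr (_ *: _).
rewrite scaler_sumr -big_split /=; apply: eq_bigr => j _.
by rewrite yd_act_linear scalerDr !scalerA mulrC.
Qed.

Lemma bigrade_linear i k : linear (bigrade i k).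
Proof. by move=> a u v; rewrite /bigrade eigenproj_linear yd_comp_linear. Qed.

Lemma act_eigenproj k j v : yd_act (rot j) (eigenproj k v) = chi (k * j) *: eigenproj k v.
Proof.
rewrite /eigenproj actZ act_sum scalerA mulrC -scalerA; congr (_ *: _).
rewrite scaler_sumr [RHS](reindex_inj (addrI j)) /=; apply: eq_bigr => l _.
rewrite actZ -yd_actM -rotD scalerA -chiD; congr (chi _ *: _).
by rewrite mulrDr opprD addrA subrr add0r.
Qed.

Lemma act_comp_rot i j v :
  yd_act (rot j) (yd_comp (rot i) v) = yd_comp (rot i) (yd_act (rot j) v).
Proof. by rewrite yd_act_comp -rotN -!rotD addrAC subrr add0r. Qed.

Lemma bigrade_hom i k v : hom i k (bigrade i k v).
Proof.
split; first by rewrite /bigrade yd_comp_comp eqxx.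
by move=> j; rewrite /bigrade act_comp_rot act_eigenproj compZ.
Qed.

Lemma bigrade_id i k v : hom i k v -> bigrade i k v = v.
Proof.
case=> hv kv; rewrite /bigrade /eigenproj.
under eq_bigr => j _ do rewrite kv scalerA -chiD addNr chi0 scale1r.
rewrite sumr_const card_ord Zp_cast4 -scaler_nat scalerA mulVf ?scale1r //.
exact: m_neq0.
Qed.

Hypothesis rot_inj : injective rot.

Lemma bigrade_other i k p q v : hom p q v -> (i, k) != (p, q) -> bigrade i k v = 0.
Proof.
case=> hv kv ne; rewrite /bigrade /eigenproj.
under eq_bigr => j _ do rewrite kv scalerA -chiD -mulNr -mulrDl addrC.
rewrite -scaler_suml sum_chi subr_eq0; have [E|_] := eqVneq q k; last first.
  by rewrite scale0r scaler0 (lin0 (@yd_comp_linear _ _ M _)).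
rewrite scalerA mulVf ?m_neq0 // scale1r -hv yd_comp_comp (inj_eq rot_inj).
by move: ne; rewrite E xpair_eqE eqxx andbT => /negPf ->.
Qed.

Lemma sum_eigenproj v : \sum_k eigenproj k v = v.
Proof.
rewrite /eigenproj -scaler_sumr exchange_big /=.
rewrite (eq_bigr (fun j => (if j == 0 then m%:R else 0) *: yd_act (rot j) v)); last first.
  move=> j _; rewrite -scaler_suml -[in RHS]oppr_eq0 -sum_chi.
  by congr (_ *: _); apply: eq_bigr => k _; rewrite mulrC mulNr.
rewrite (bigD1 0) //= rot0 yd_act1 big1 => [|j /negPf ->]; last by rewrite scale0r.
by rewrite addr0 scalerA mulVf ?m_neq0 // scale1r.
Qed.

Lemma hom_x i k v : hom i k v -> hom (- i) (- k) (yd_act x v).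
Proof.
case=> hv kv; split.
  rewrite -{2}hv yd_act_comp; congr (yd_comp _ _).
  by rewrite rot_x mulgK.
move=> j; rewrite -yd_actM.
have -> : (rot j * x = x * rot (- j))%g by rewrite rot_x opprK.
by rewrite yd_actM kv actZ mulrN mulNr.
Qed.

Lemma act_xK v : yd_act x (yd_act x v) = v.
Proof. by rewrite -yd_actM -expg2 x2 yd_act1. Qed.

Lemma act_x_neq0 v : v != 0 -> yd_act x v != 0.
Proof.
by apply: contra_neq => E; rewrite -[v]act_xK E (lin0 (@yd_act_linear _ _ M x)).
Qed.

Lemma hom_rot_comp i k v g : hom i k v -> yd_comp g v = if g == rot i then v else 0.
Proof. by case=> hv _; rewrite -{1}hv yd_comp_comp hv. Qed.

Section Forms.
Context (n : nat) (b : 'I_n -> M) (f : 'I_n -> M -> F^o).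
Hypotheses (fl : forall i : 'I_n, linear (f i)) (fb : forall v, v = \sum_(i < n) (f i v : F) *: b i).

Lemma form_neq0 v : v != 0 -> exists2 h : M -> F^o, linear h & h v = 1.
Proof.
move=> v0; have [i fi] : exists i : 'I_n, f i v != 0.
  apply/existsP; apply: contraNT v0; rewrite negb_exists => /forallP h.
  rewrite [v]fb big1 // => i _; move/eqP: (negbNE (h i)) => ->; exact: scale0r.
exists (fun u => (f i v : F)^-1 * f i u : F); last by rewrite mulVf.
by move=> a u w; rewrite fl mulrDr; congr (_ + _); rewrite -mulrCA.
Qed.

(** Being an eigenvector for the rotations makes the skew derivation of [h] obey [leibniz] at every
    bihomogeneous vector; vanishing on the other types makes such forms dual to vectors of distinct
    types. *)
Definition hom_form (i k : 'Z_m) (h : M -> F^o) : Prop :=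
  [/\ linear h, forall j v, h (yd_act (rot j) v) = chi (k * j) * h v :> F &
      forall p q v, hom p q v -> (i, k) != (p, q) -> h v = 0].

Lemma hom_form_exists i k v : hom i k v -> v != 0 ->
  exists2 h, hom_form i k h & h v = 1.
Proof.
move=> hv /form_neq0[h hl h1]; exists (fun u => h (bigrade i k u)); last by rewrite bigrade_id.
split.
- by move=> a u w; rewrite bigrade_linear hl.
- move=> j u; rewrite /bigrade.
  have -> : eigenproj k (yd_act (rot j) u) = yd_act (rot j) (eigenproj k u).
    rewrite /eigenproj actZ act_sum; congr (_ *: _); apply: eq_bigr => l _.
    by rewrite actZ -!yd_actM -!rotD addrC.
  by rewrite act_eigenproj compZ (linZ _ _ hl).
- by move=> p q u hu ne; rewrite (bigrade_other hu ne) lin0.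
Qed.

End Forms.

Lemma hom_form_leibniz (X : tensor_like M) i k p q v h : hom i k v -> hom_form p q h ->
  leibniz (sder h : X -> X) (tl_in X v) ((h v : F)%:A) (chi (q * i)).
Proof.
move=> [hv kv] [hl hr _] z; rewrite (sder_homM _ hl hv) mulr_algl; congr (_ + _).
rewrite scalerAr -sderZ //; congr (_ * sder _ _).
by apply: funext => u; rewrite hr.
Qed.

Context (X : tensor_like M) (Xfin : fin_codim (ideal (@tl_nichols_rel _ _ _ X))).

Lemma hom_form_ex i k v : hom i k v -> v != 0 -> exists2 h, hom_form i k h & h v = 1.
Proof.
by have [n [b [f [fl fb]]]] := fin_codim_dual_basis Xfin; exact: hom_form_exists fl fb _ _ _.
Qed.

Lemma hom_form_leibniz0 i k p q v h : hom i k v -> hom_form p q h -> (p, q) != (i, k) ->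
  leibniz (sder h : X -> X) (tl_in X v) 0 (chi (q * i)).
Proof.
move=> hv hh ne; have [_ _ h0] := hh.
by have := hom_form_leibniz (X := X) hv hh; rewrite (h0 _ _ _ hv ne) scale0r.
Qed.

Lemma hom_form_leibniz1 i k q v h : hom i k v -> hom_form i q h -> h v = 1 ->
  leibniz (sder h : X -> X) (tl_in X v) 1 (chi (q * i)).
Proof.
by move=> hv hh h1; have := hom_form_leibniz (X := X) hv hh; rewrite h1 scale1r.
Qed.

Local Notation eps := (@counit _ _ _ X).

Lemma eps1_neq0 : eps 1 != 0.
Proof. by rewrite counit1 oner_neq0. Qed.

Lemma hom_neg_neq i k : chi (i * k + i * k) != 1 -> (i, k) != (- i, - k).
Proof.
apply: contra_neq => -[Ei _]; rewrite -[X in chi (X * _ + _)]opprK -Ei.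
by rewrite mulNr addNr chi0.
Qed.

(** Let q be the self-braiding. If q = 1, the vector v alone gives infinite dimension. If q^2 is not
    1, the types (i,k) and (-i,-k) differ, and v, x v form the rank two diagram. Only q = -1
    remains. *)
Lemma hom_braiding i k v : hom i k v -> v != 0 -> chi (i * k) = -1.
Proof.
move=> hv v0; have [f hf f1] := hom_form_ex hv v0; have [fl _ _] := hf.
have Laa := hom_form_leibniz1 hv hf f1.
set q := chi (i * k).
have [q1|q1n] := eqVneq q 1.
  exfalso; move: Xfin; apply: (@rank1_infinite _ _ _ _ F0 (@counit_linear _ _ _ X) eps1_neq0
    (@nichols_ideal_counit _ _ _ X) (sder f) (tl_in X v)).
  - exact: sder_linear.
  - by move=> z; exact: nichols_ideal_sder.
  - exact: sder1.
  - by move=> z; rewrite Laa mulrC -/q q1 scale1r mul1r.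
  - by move=> z; exact: counit_inM.
have [q2|q2] := eqVneq (q ^+ 2) 1.
  by move/eqP: q2; rewrite sqrf_eq1 (negPf q1n) => /eqP.
have hw := hom_x hv; have w0 := act_x_neq0 v0.
have [h hh h1] := hom_form_ex hw w0; have [hl _ _] := hh.
have ne : (i, k) != (- i, - k) by apply: hom_neg_neq; rewrite chiD.
have Lbb := hom_form_leibniz1 hw hh h1.
have Lab := hom_form_leibniz0 hw hf ne.
have Lba : leibniz (sder h : X -> X) (tl_in X v) 0 (chi (- k * i)).
  by apply: hom_form_leibniz0 hv hh _; rewrite eq_sym.
exfalso; move: Xfin; apply: (@rank2_infinite _ _ _ _ F0 (@counit_linear _ _ _ X) eps1_neq0
    (@nichols_ideal_counit _ _ _ X) (sder f) (sder h) (tl_in X v) (tl_in X (yd_act x v)) q).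
- exact: sder_linear.
- exact: sder_linear.
- by move=> z; exact: nichols_ideal_sder.
- by move=> z; exact: nichols_ideal_sder.
- exact: chi_neq0.
- by [].
- exact: sder1.
- exact: sder1.
- by move=> z _; rewrite Laa mul1r mulrC.
- by move=> z _; rewrite Lab mul0r add0r mulrN mulrC chiN.
- by move=> z _; rewrite Lbb mul1r mulrNN mulrC.
- by move=> z _; rewrite Lba mul0r add0r mulNr mulrC chiN.
- by move=> z; exact: counit_inM.
- by move=> z; exact: counit_inM.
Qed.

Lemma chi_self_double i k : chi (i * k) = -1 -> chi (i * k + i * k) = 1.
Proof. by move=> E; rewrite chiD E mulrNN mulr1. Qed.

Lemma half_eq0 (a : 'Z_m) : a + a = 0 -> a = 0 \/ a = (2 * t)%:R.
Proof using t_gt0.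
clear homega.
move=> E; have ltm : (a < m)%N by rewrite -[X in (_ < X)%N]Zp_cast4.
have : (m %| nat_of_ord a + nat_of_ord a)%N.
  have dvdE (c : nat) : (c %% (Zp_trunc m).+2 == 0)%N = (m %| c)%N by rewrite Zp_cast4.
  by move/(congr1 val): E => /= /eqP; rewrite dvdE.
move=> /dvdnP[c cE].
have c1 : (c < 2)%N by rewrite -(ltn_pmul2r (leq_ltn_trans (leq0n a) ltm)) -cE; lia.
have [c0|c0] : c = 0%N \/ c = 1%N by lia.
  by left; apply: val_inj => /=; lia.
right; apply: val_inj; rewrite /= val_Zp_nat ?Zp_cast4; last by lia.
by rewrite modn_small; lia.
Qed.

(** Equality would put i and k in the 2-torsion {0, 2t} of Z/4t, where all products vanish, and
    omega^(ik) would be 1. *)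
Lemma hom_neq_opp i k : chi (i * k) = -1 -> (i, k) != (- i, - k).
Proof.
move=> E; apply/eqP => -[Ei Ek].
have m0 : (m%:R : 'Z_m) = 0.
  by apply: val_inj; rewrite /= val_Zp_nat ?Zp_cast4 ?modnn //; lia.
have ik0 : i * k = 0.
  have ii : i + i = 0 by rewrite {1}Ei addNr.
  have kk : k + k = 0 by rewrite {1}Ek addNr.
  have [->|->] := half_eq0 ii; rewrite ?mul0r //.
  have [->|->] := half_eq0 kk; rewrite ?mulr0 //.
  have E4 : (2 * t * (2 * t) = m * t)%N by rewrite mulnACA mulnA.
  by rewrite -natrM E4 natrM m0 mul0r.
by move/eqP: E; rewrite ik0 chi0 eq_sym (negPf (opp1_neq1 F0)).
Qed.

(** Unless alpha beta = 1 for alpha = omega^(ir) and beta = omega^(pk), the vectors u, x u, w, x w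
    have four distinct types, dual forms exist, and [rank4_infinite] applies. *)
Lemma hom_pair i k p r u w : hom i k u -> hom p r w -> u != 0 -> w != 0 ->
  chi (i * r + p * k) = 1.
Proof.
move=> ha hc a0 c0; apply/eqP/negPn/negP => s1.
have Eik := hom_braiding ha a0; have Epr := hom_braiding hc c0.
have hb := hom_x ha; have b0 := act_x_neq0 a0.
have hd := hom_x hc; have d0 := act_x_neq0 c0.
have [fa hfa fa1] := hom_form_ex ha a0; have [fb hfb fb1] := hom_form_ex hb b0.
have [fc hfc fc1] := hom_form_ex hc c0; have [fd hfd fd1] := hom_form_ex hd d0.
have nab := hom_neq_opp Eik; have ncd := hom_neq_opp Epr.
have nac : (i, k) != (p, r).
  apply: contra_neq s1 => -[-> ->]; exact: chi_self_double.
have nad : (i, k) != (- p, - r).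
  apply: contra_neq s1 => -[-> ->].
  by rewrite mulNr mulrN -opprD chiN chi_self_double ?invr1.
have nbc : (- i, - k) != (p, r).
  by apply: contra_neq nad => -[<- <-]; rewrite !opprK.
have nbd : (- i, - k) != (- p, - r).
  apply: contra_neq nac => /eqP; rewrite xpair_eqE => /andP[/eqP Ei /eqP Ek].
  by rewrite -[i]opprK Ei opprK -[k]opprK Ek opprK.
have L0 := hom_form_leibniz0; have L1 := hom_form_leibniz1.
have sl h i0 k0 : hom_form i0 k0 h -> linear (sder h : X -> X).
  by case=> hl _ _; exact: sder_linear.
have sI h i0 k0 : hom_form i0 k0 h -> forall z : X, ideal (@tl_nichols_rel _ _ _ X) z ->
    ideal (@tl_nichols_rel _ _ _ X) (sder h z).
  by case=> hl _ _ z; exact: nichols_ideal_sder.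
have s10 h i0 k0 : hom_form i0 k0 h -> sder h 1 = 0 :> X.
  by case=> hl _ _; exact: sder1.
have cast (D : X -> X) (z z' : X) (kap kap' : F) :
    leibniz D z z' kap -> kap = kap' -> leibniz D z z' kap'.
  by move=> + <-.
exfalso; move: Xfin; apply: (@rank4_infinite _ _ _ _ F0 (@counit_linear _ _ _ X) eps1_neq0
    (@nichols_ideal_counit _ _ _ X) (sder fa) (sder fb) (sder fc) (sder fd)
    (tl_in X u) (tl_in X (yd_act x u)) (tl_in X w) (tl_in X (yd_act x w))
    (chi (i * r)) (chi (p * k))); rewrite -?chiN;
  try (by move=> z; exact: counit_inM); try exact: chi_neq0; try (by rewrite -chiD);
  try (by apply: sl; eassumption); try (by apply: sI; eassumption); try (by apply: s10; eassumption).
- by apply: cast (L1 _ _ _ _ _ ha hfa fa1) _; rewrite mulrC.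
- by apply: cast (L0 _ _ _ _ _ _ ha hfb _) _; rewrite ?[_ == (i, k)]eq_sym // mulNr mulrC chiN Eik invrN1.
- by apply: cast (L0 _ _ _ _ _ _ ha hfc _) _; rewrite ?[_ == (i, k)]eq_sym // mulrC.
- by apply: cast (L0 _ _ _ _ _ _ ha hfd _) _; rewrite ?[_ == (i, k)]eq_sym // mulNr mulrC.
- by apply: cast (L0 _ _ _ _ _ _ hb hfa _) _; rewrite // mulrN mulrC chiN Eik invrN1.
- by apply: cast (L1 _ _ _ _ _ hb hfb fb1) _; rewrite mulrNN mulrC.
- by apply: cast (L0 _ _ _ _ _ _ hb hfc _) _; rewrite ?[_ == (- i, - k)]eq_sym // mulrN mulrC.
- by apply: cast (L0 _ _ _ _ _ _ hb hfd _) _; rewrite ?[_ == (- i, - k)]eq_sym // mulrNN mulrC.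
- by apply: cast (L0 _ _ _ _ _ _ hc hfa _) _; rewrite // mulrC.
- by apply: cast (L0 _ _ _ _ _ _ hc hfb _) _; rewrite // mulNr mulrC.
- by apply: cast (L1 _ _ _ _ _ hc hfc fc1) _; rewrite mulrC.
- by apply: cast (L0 _ _ _ _ _ _ hc hfd _) _; rewrite ?[_ == (p, r)]eq_sym // mulNr mulrC chiN Epr invrN1.
- by apply: cast (L0 _ _ _ _ _ _ hd hfa _) _; rewrite // mulrN mulrC.
- by apply: cast (L0 _ _ _ _ _ _ hd hfb _) _; rewrite // mulrNN mulrC.
- by apply: cast (L0 _ _ _ _ _ _ hd hfc _) _; rewrite // mulrN mulrC chiN Epr invrN1.
- by apply: cast (L1 _ _ _ _ _ hd hfd fd1) _; rewrite mulrNN mulrC.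
Qed.

(** * Reflections *)

Hypothesis t_ge3 : (3 <= t)%N.
Local Notation half := ((2 * t)%:R : 'Z_m).

Lemma Zp_nat_eq0 (a : nat) : (a%:R == 0 :> 'Z_m) = (m %| a)%N.
Proof using t_gt0.
clear homega t_ge3.
have E : val (a%:R : 'Z_m) = (a %% m)%N by rewrite /= val_Zp_nat //; lia.
by rewrite -(inj_eq val_inj) E.
Qed.

Lemma half_double : half + half = 0.
Proof. by apply/eqP; rewrite -natrD Zp_nat_eq0; apply/dvdnP; exists 1%N; lia. Qed.

Lemma act_comp_x v : yd_act x (yd_comp x v) = yd_comp x (yd_act x v).
Proof. by rewrite yd_act_comp mulgK. Qed.

Lemma rot_half_comm : (x * rot half = rot half * x)%g.
Proof. by rewrite rot_x; congr (rot _ * x)%g; apply/esym/eqP; rewrite -addr_eq0 half_double. Qed.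

Lemma act_half_comp v :
  yd_act (rot half) (yd_comp x v) = yd_comp x (yd_act (rot half) v).
Proof. by rewrite yd_act_comp -rot_half_comm mulgK. Qed.

Lemma act_rotD i j v : yd_act (rot i) (yd_act (rot j) v) = yd_act (rot (i + j)) v.
Proof. by rewrite rotD yd_actM. Qed.

Lemma act_x_rot j v : yd_act x (yd_act (rot j) v) = yd_act (rot (- j)) (yd_act x v).
Proof. by rewrite -!yd_actM rot_x. Qed.

Lemma two_neq0 : (2%:R : F) != 0.
Proof. by rewrite (iffLR (pcharf0P F) F0). Qed.

Lemma form_ex v : v != 0 -> exists2 h : M -> F^o, linear h & h v = 1.
Proof.
by have [n [b [f [fl fb]]]] := fin_codim_dual_basis Xfin; exact: form_neq0 fl fb _.
Qed.

(** Otherwise w = v + x v is a nonzero vector of degree x fixed by x, so of self-braiding 1.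
    Averaging a form over x gives an invariant one, whose skew derivation obeys the ordinary Leibniz
    rule at w. *)
Lemma reflection_eigen v : yd_comp x v = v -> yd_act x v = - v.
Proof.
move=> gv; apply/eqP; rewrite -addr_eq0 addrC; apply/negPn/negP => w0.
set w := v + _ in w0.
have xl := @yd_act_linear _ _ M x.
have gw : yd_comp x w = w by rewrite (linD _ _ (@yd_comp_linear _ _ M x)) -act_comp_x gv.
have xw : yd_act x w = w by rewrite (linD _ _ xl) act_xK addrC.
have [h hl h1] := form_ex w0.
pose f u : F^o := 2%:R^-1 * (h (u + yd_act x u)).
have fl : linear f.
  move=> a u u'; rewrite /f xl addrACA -scalerDr hl mulrDr; congr (_ + _).
  by rewrite -mulrCA.
have fx u : f (yd_act x u) = f u by rewrite /f act_xK addrC.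
exfalso; move: Xfin; apply: (@rank1_infinite _ _ _ _ F0 (@counit_linear _ _ _ X) eps1_neq0
    (@nichols_ideal_counit _ _ _ X) (sder f) (tl_in X w)).
- exact: sder_linear.
- by move=> z; exact: nichols_ideal_sder.
- exact: sder1.
- move=> z; rewrite (sder_homM _ fl gw) /f xw (linD _ _ hl) h1.
  have -> : (2%:R^-1 * (1 + 1 : F) : F) = 1 by rewrite mulVf // two_neq0.
  by rewrite scale1r; congr (_ + _ * sder _ _); apply: funext => u; exact: fx.
- by move=> z; exact: counit_inM.
Qed.

(** * The rotation orbit of a nonzero vector of degree a reflection *)

Section Reflection.
Context (v : M) (f : M -> F^o) (eta : F).
Hypotheses (gv : yd_comp x v = v) (fl : linear f) (fv : f v = 1).
Hypotheses (fx : forall u, f (yd_act x u) = - f u :> F).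
Hypotheses (fg : forall g u, yd_comp g u = u -> g != x -> f u = 0).
Hypotheses (eta2 : eta * eta = 1) (hv : yd_act (rot half) v = eta *: v).

(** [V j] is y^j v, of degree y^(2j) x; [fr j] is the translated form, [Phi j] its skew derivation,
    and [ev e] the pairing at distance e, supported on the 2-torsion {0, 2t}. *)
Let V (j : 'Z_m) : X := tl_in X (yd_act (rot j) v).
Let fr (j : 'Z_m) (u : M) : F^o := f (yd_act (rot (- j)) u).
Let Phi (j : 'Z_m) : X -> X := sder (fr j).
Let ev (e : 'Z_m) : F := f (yd_act (rot e) v).

Lemma fr_linear j : linear (fr j).
Proof. by move=> a u w; rewrite /fr yd_act_linear fl. Qed.

Lemma Phi_linear j : linear (Phi j).
Proof. exact/sder_linear/fr_linear. Qed.

Lemma Phi1 j : Phi j 1 = 0.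
Proof. exact/sder1/fr_linear. Qed.

Lemma rot_deg j : yd_comp (rot (j + j) * x)%g (yd_act (rot j) v) = yd_act (rot j) v.
Proof.
rewrite -{2}gv yd_act_comp; congr (yd_comp _ _).
by rewrite rotD -!mulgA; congr (_ * _)%g; rewrite -rotN rot_x opprK.
Qed.

Lemma ev0 : ev 0 = 1.
Proof. by rewrite /ev rot0 yd_act1. Qed.

Lemma ev_eq0 e : e + e != 0 -> ev e = 0.
Proof.
move=> e0; apply: (fg (rot_deg e)); apply: contra_neq e0 => E.
by apply: rot_inj; rewrite rot0; apply: (mulIg x); rewrite mul1g.
Qed.

Lemma evN e : ev (- e) = ev e.
Proof.
have [E|ne] := eqVneq (e + e) 0.
  by congr ev; apply/eqP; rewrite eq_sym -addr_eq0 E.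
by rewrite !ev_eq0 // -opprD oppr_eq0.
Qed.

Lemma ev_sqr e : ev e * ev e = (e + e == 0)%:R.
Proof.
case: eqVneq => [/half_eq0[->|->]|ne]; last by rewrite ev_eq0 // mul0r.
  by rewrite ev0 mulr1.
by rewrite /ev hv (linZ _ _ fl) fv; have -> : eta *: (1 : F^o) = eta by exact: mulr1.
Qed.

Lemma natr_Zp_neq0 (a : nat) : (0 < a < m)%N -> (a%:R : 'Z_m) != 0.
Proof.
case/andP=> a0 am; rewrite Zp_nat_eq0; apply/negP => /dvdn_leq; rewrite a0 => /(_ isT).
by rewrite leqNgt am.
Qed.

(** The doubles of e and e + 2 differ by 4, which is nonzero modulo 4t, so one of the two is not
    2-torsion. *)
Lemma ev_shift e : ev (e + 2%:R) * ev e = 0.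
Proof.
have [E|ne] := eqVneq (e + e) 0; last by rewrite (ev_eq0 ne) mulr0.
rewrite ev_eq0 ?mul0r //.
have -> : e + 2%:R + (e + 2%:R) = e + e + 4%:R by ring.
by rewrite E add0r natr_Zp_neq0 //; lia.
Qed.

(** If 2e + 1 were 2-torsion, multiplying 4e + 2 = 0 by t would give 2t = 0 modulo 4t. *)
Lemma ev_odd e : ev (e + e + 1) = 0.
Proof.
rewrite ev_eq0 //; apply/eqP => E.
have : t%:R * (e + e + 1 + (e + e + 1)) = 0 :> 'Z_m by rewrite E mulr0.
have -> : t%:R * (e + e + 1 + (e + e + 1)) = m%:R * e + half by rewrite !natrM; ring.
have /eqP -> : (m%:R : 'Z_m) == 0 by rewrite Zp_nat_eq0.
by rewrite mul0r add0r; apply/eqP; apply: natr_Zp_neq0; lia.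
Qed.

(* [ev (a - i)] is the pairing of the dual basis vector [fr i] with [V a]; the element
   rot (2 a) x, in whose degree [V a] lies, maps [fr i] to - fr (2 a - i). *)
Lemma Phi_V i a z : Phi i (V a * z) = ev (a - i) *: z - V a * Phi (a + a - i) z.
Proof.
rewrite /Phi /V (sder_homM _ (fr_linear i) (rot_deg a)); congr (_ *: _ + _).
  by rewrite /fr act_rotD addrC.
rewrite -mulrN -scaleN1r -sderZ; last exact: fr_linear.
congr (_ * sder _ _); apply: funext => u; rewrite /fr mulN1r -fx; congr (f _).
rewrite yd_actM !act_rotD act_x_rot; congr yd_act; congr rot; ring.
Qed.

Lemma Phi_VV i a b z : Phi i (V a * V b * z) =
  ev (a - i) *: (V b * z) - ev (b - (a + a - i)) *: (V a * z)
  + V a * V b * Phi (b + b - (a + a - i)) z.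
Proof.
by rewrite -mulrA !Phi_V mulrBr -scalerAr opprB addrA addrAC !mulrA.
Qed.

(** [P sg j] has degree y^(2 sg), and [U sg] is a Fourier combination on which y^(2 sg) acts by
    [zeta]. Consecutive terms of [P] are added so that the middle terms of their derivatives cancel
    in [Phi_PP]. *)
Let P (sg j : 'Z_m) : X := V (sg * (j + 1)) * V (sg * j).
Let zeta : F := chi 4%:R.
Let U (sg : 'Z_m) : X := \sum_(l : 'Z_m) chi (- (4%:R * l)) *: (P sg (l + l) + P sg (l + l + 1)).
Let S (sg i : 'Z_m) (z : X) : X :=
  \sum_(l : 'Z_m) (chi (- (4%:R * l)) * ev (l + l + 1 - sg * i)) *: (V (sg * (l + l)) * z).

Let sign (sg : 'Z_m) := sg = 1 \/ sg = -1.

Lemma ev_sign sg e : sign sg -> ev (sg * e) = ev e.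
Proof. by case=> ->; rewrite ?mul1r ?mulN1r ?evN. Qed.

Lemma sign_sqr sg : sign sg -> sg * sg = 1.
Proof. by case=> ->; rewrite ?mul1r ?mulrNN ?mulr1. Qed.

Lemma Phi_PP sg i j z : sign sg -> Phi i ((P sg j + P sg (j + 1)) * z) =
  ev (j + 1 - sg * i) *: (V (sg * j) * z) - ev (j + 3%:R - sg * i) *: (V (sg * (j + 2%:R)) * z)
  + (P sg j + P sg (j + 1)) * Phi (i - (sg + sg)) z.
Proof.
move=> sgP; have sg2 := sign_sqr sgP.
have E1 a : ev (sg * (a + 1) - i) = ev (a + 1 - sg * i).
  by rewrite -(ev_sign _ sgP) mulrBr mulrA sg2 mul1r.
have E2 a : ev (sg * a - (sg * (a + 1) + sg * (a + 1) - i)) = ev (a + 2%:R - sg * i).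
  rewrite -(ev_sign _ sgP) -evN; congr ev.
  rewrite !mulrBr !mulrDr !mulrA sg2; ring.
have E3 a : sg * a + sg * a - (sg * (a + 1) + sg * (a + 1) - i) = i - (sg + sg) by ring.
rewrite mulrDl (linD _ _ (Phi_linear i)) /P !Phi_VV !E1 !E2 !E3 mulrDl.
have -> : j + 1 + 1 = j + 2%:R by ring.
have -> : j + 1 + 2%:R = j + 3%:R by ring.
rewrite [in LHS]addrACA; congr (_ + _).
by rewrite addrA subrK.
Qed.

(** The two outer terms of [Phi_PP] give the same series, shifted by one step of l, which costs a
    factor [zeta]; hence the coefficient 1 - zeta. *)
Lemma Phi_U sg i z : sign sg ->
  Phi i (U sg * z) = (1 - zeta) *: S sg i z + U sg * Phi (i - (sg + sg)) z.
Proof.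
move=> sgP; rewrite /U mulr_suml.
have sumE (I0 : finType) (h : I0 -> X) : Phi i (\sum_l h l) = \sum_l Phi i (h l).
  by elim/big_rec2: _ => [|l a b _ <-]; rewrite ?(lin0 (Phi_linear i)) ?(linD _ _ (Phi_linear i)).
rewrite sumE; under eq_bigr => l _.
  rewrite -scalerAl (linZ _ _ (Phi_linear i)) Phi_PP // scalerDr scalerBr !scalerA.
  over.
rewrite big_split /=; congr (_ + _); last first.
  by rewrite mulr_suml; apply: eq_bigr => l _; rewrite scalerAl.
rewrite sumrB scalerBl scale1r; congr (_ - _).
rewrite /S scaler_sumr [RHS](reindex_inj (addIr 1)) /=; apply: eq_bigr => l _.
rewrite scalerA mulrA -chiD; congr ((chi _ * ev _) *: (V (sg * _) * _)); ring.
Qed.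

Lemma S_even sg k z : S sg (k + k) z = 0.
Proof.
rewrite /S big1 // => l _.
have -> : l + l + 1 - sg * (k + k) = (l - sg * k) + (l - sg * k) + 1 by ring.
by rewrite ev_odd mulr0 scale0r.
Qed.

(** A second-order operator: for tau = 1 or -1 the inner derivation has odd index and removes the
    odd letter of a product [P], the outer one the even letter. *)
Let E (tau k : 'Z_m) (z : X) : X := Phi (k + k) (Phi (k + k + tau) z).

Lemma E_linear tau k : linear (E tau k).
Proof. by move=> a z z'; rewrite /E !Phi_linear. Qed.

Lemma Phi_even_U sg k z : sign sg ->
  Phi (k + k) (U sg * z) = U sg * Phi (k - sg + (k - sg)) z.
Proof.
move=> sgP; rewrite Phi_U // S_even scaler0 add0r; congr (_ * Phi _ _); ring.
Qed.

Lemma E1 tau k : E tau k 1 = 0.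
Proof. by rewrite /E Phi1 (lin0 (Phi_linear _)). Qed.

Let gen := generated2 (U 1) (U (-1)).

(** For an even index the term [S] vanishes, so the derivation moves past each [U] as another
    derivation of even index, until it reaches 1. *)
Lemma Phi_even_gen k z : gen z -> Phi (k + k) z = 0.
Proof.
move=> gz; elim: gz k => [|{}z _ IH|{}z _ IH|c {}z z' _ IH _ IH'] k.
- exact: Phi1.
- by rewrite Phi_even_U ?IH ?mulr0 //; left.
- by rewrite Phi_even_U ?IH ?mulr0 //; right.
- by rewrite Phi_linear IH IH' scaler0 addr0.
Qed.

Lemma E_U tau sg k z : sign sg -> gen z -> E tau k (U sg * z) =
  ((1 - zeta) * \sum_(l : 'Z_m) chi (- (4%:R * l)) *
     (ev (l + l + 1 - sg * (k + k + tau)) * ev (l + l - sg * (k + k)))) *: z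
  + U sg * E tau (k - sg) z.
Proof.
move=> sgP gz; rewrite /E Phi_U // (linD _ _ (Phi_linear _)) (linZ _ _ (Phi_linear _)).
rewrite Phi_even_U //; congr (_ + _ * Phi _ (Phi _ _)); last by ring.
rewrite -scalerA; congr (_ *: _).
have sumE (I0 : finType) (h : I0 -> X) : Phi (k + k) (\sum_l h l) = \sum_l Phi (k + k) (h l).
  by elim/big_rec2: _ => [|l a b _ <-]; rewrite ?(lin0 (Phi_linear _)) ?(linD _ _ (Phi_linear _)).
rewrite /S sumE scaler_suml; apply: eq_bigr => l _.
rewrite (linZ _ _ (Phi_linear _)) Phi_V.
have -> : sg * (l + l) + sg * (l + l) - (k + k) =
   (sg * (l + l) - k) + (sg * (l + l) - k) by ring.
rewrite Phi_even_gen // mulr0 subr0 scalerA -mulrA; congr ((_ * (_ * _)) *: _).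
by rewrite -(ev_sign _ sgP) mulrBr mulrA sign_sqr // mul1r.
Qed.

(** As [C_neq0] shows, this is the number of l in Z/4t with 4 l = 0, positive because l = 0
    counts. *)
Let C : F := \sum_(l : 'Z_m) chi (- (4%:R * l)) * (ev (l + l) * ev (l + l)).

Lemma C_neq0 : C != 0.
Proof.
have -> : C = (\sum_(l : 'Z_m) (4%:R * l == 0 :> 'Z_m)%R)%:R.
  rewrite natr_sum; apply: eq_bigr => l _; rewrite ev_sqr.
  have -> : l + l + (l + l) = 4%:R * l by ring.
  by case: eqVneq => [->|_]; rewrite ?mulr0 // oppr0 chi0 mulr1.
rewrite (iffLR (pcharf0P F) F0) (bigD1 0) //= mulr0 eqxx; by [].
Qed.

Lemma E_same tau k z : sign tau -> gen z -> E tau k (U tau * z) =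
  ((1 - zeta) * (chi (- (4%:R * (tau * k))) * C)) *: z + U tau * E tau (k - tau) z.
Proof.
move=> tP gz; rewrite E_U //; congr ((_ * _) *: _ + _).
rewrite mulr_sumr [LHS](reindex_inj (addIr (tau * k))) /=; apply: eq_bigr => l _.
rewrite [in RHS]mulrA -chiD; congr (chi _ * (ev _ * ev _)); first by ring.
  by rewrite mulrDr sign_sqr //; ring.
by ring.
Qed.

(** For the opposite sign the arguments of the two pairings differ by 2, and [ev_shift] kills every
    term. *)
Lemma E_opp tau k z : sign tau -> gen z ->
  E tau k (U (- tau) * z) = U (- tau) * E tau (k + tau) z.
Proof.
move=> tP gz; have tN : sign (- tau) by case: tP => ->; [right|left; rewrite opprK].
rewrite E_U // opprK big1 ?mulr0 ?scale0r ?add0r // => l _.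
have -> : l + l + 1 - - tau * (k + k + tau) = l + l - - tau * (k + k) + 2%:R.
  by rewrite [in LHS]mulrDr mulNr [- tau * tau]mulNr sign_sqr //; ring.
by rewrite ev_shift mulr0.
Qed.

(** Brings the index k - tau or k + tau produced by the Leibniz rule back to 0; the character that
    appears supplies the braiding scalars [zeta] and its inverse. *)
Lemma E_shift tau k z : sign tau -> gen z -> E tau k z = chi (- (4%:R * (tau * k))) *: E tau 0 z.
Proof.
move=> tP gz; have t2 := sign_sqr tP.
have EN sg : sign sg -> sg = tau \/ sg = - tau.
  by case: tP => -> [->|->]; rewrite ?opprK; tauto.
have step sg w k0 : sign sg -> gen w ->
    (forall k, E tau k w = chi (- (4%:R * (tau * k))) *: E tau 0 w) ->
    E tau k0 (U sg * w) = chi (- (4%:R * (tau * k0))) *: E tau 0 (U sg * w).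
  move=> sP gw IH; case: (EN sg sP) => ->.
    rewrite !E_same // mulr0 mulr0 oppr0 chi0 mul1r (IH (k0 - tau)) (IH (0 - tau)).
    rewrite scalerDr scalerA mulrCA; congr (_ + _).
    rewrite -!scalerAr scalerA -chiD; congr (chi _ *: _); ring.
  rewrite !E_opp // (IH (k0 + tau)) (IH (0 + tau)).
  rewrite -!scalerAr scalerA -chiD; congr (chi _ *: _); ring.
elim: gz k => [|{}z gz IH|{}z gz IH|c {}z z' _ IH _ IH'] k.
- by rewrite !E1 scaler0.
- by apply: step => //; left.
- by apply: step => //; right.
- by rewrite !E_linear (IH k) (IH' k) scalerDr !scalerA mulrC.
Qed.

(** The square is omega^8, and 8 < 4t because t >= 3. *)
Lemma zeta_sqr_neq1 : zeta ^+ 2 != 1.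
Proof.
rewrite /zeta expr2 -chiD chi_eq1 -natrD; apply: natr_Zp_neq0; lia.
Qed.

(** Divided by [kappa], the operators [E] for tau = 1 and tau = -1 act on the subalgebra generated
    by [U 1] and [U (-1)] as the skew derivations of a rank two diagram with q = omega^4. *)
Lemma reflection_infinite : False.
Proof.
have z1 : zeta != 1 by apply: contra_neq zeta_sqr_neq1 => ->; rewrite expr1n.
pose kappa := (1 - zeta) * C.
have k0 : kappa != 0 by rewrite mulf_neq0 ?C_neq0 // subr_eq0 eq_sym.
pose D tau (z : X) := kappa^-1 *: E tau 0 z.
have Dsame tau z : sign tau -> gen z -> D tau (U tau * z) = z + zeta *: (U tau * D tau z).
  move=> tP gz; rewrite /D E_same // !mulr0 oppr0 chi0 mul1r (@E_shift tau (0 - tau)) //.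
  have -> : - (4%:R * (tau * (0 - tau))) = 4%:R by rewrite sub0r !mulrN opprK sign_sqr ?mulr1.
  by rewrite scalerDr scalerA mulVf // scale1r -!scalerAr !scalerA mulrC.
have Dopp tau sg z : sign tau -> sg = - tau -> gen z ->
    D tau (U sg * z) = zeta^-1 *: (U sg * D tau z).
  move=> tP -> gz; rewrite /D E_opp // (@E_shift tau (0 + tau)) //.
  have -> : - (4%:R * (tau * (0 + tau))) = - 4%:R :> 'Z_m by rewrite add0r sign_sqr ?mulr1.
  by rewrite chiN -!scalerAr !scalerA mulrC.
have s1 : sign 1 by left.
have sN1 : sign (-1) by right.
have Dl tau : linear (D tau).
  by move=> a z z'; rewrite /D E_linear scalerDr !scalerA mulrC.
have DI tau z : ideal (@tl_nichols_rel _ _ _ X) z -> ideal (@tl_nichols_rel _ _ _ X) (D tau z).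
  by move=> Iz; apply: lspanZ; do 2!(apply: nichols_ideal_sder; first exact: fr_linear).
have D1 tau : D tau 1 = 0.
  by rewrite /D E1 scaler0.
have epsU sg z : eps (U sg * z) = 0.
  have L : linear (fun w : X => eps (w * z)).
    by move=> a p q; rewrite mulrDl -scalerAl counit_linear.
  rewrite /U -[eps _]/((fun w : X => eps (w * z)) _).
  elim/big_rec: _ => [|l w _ IH]; first exact: (lin0 L).
  rewrite L IH addr0 (linD _ _ L) /P -!mulrA !counit_inM addr0.
  exact: scaler0.
move: Xfin; apply: (@rank2_infinite _ _ _ _ F0 (@counit_linear _ _ _ X) eps1_neq0
  (@nichols_ideal_counit _ _ _ X) (D 1) (D (-1)) (U 1) (U (-1)) zeta) => //.
- exact: DI.
- exact: DI.
- exact: chi_neq0.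
- exact: zeta_sqr_neq1.
- by move=> z gz; apply: Dsame.
- by move=> z gz; apply: Dopp.
- by move=> z gz; apply: Dsame.
- by move=> z gz; apply: Dopp => //; rewrite opprK.
Qed.

End Reflection.

(** The rotation y^(2t) is an involution commuting with x, so a nonzero v yields an eigenvector w of
    degree x with eigenvalue [eta] = 1 or -1. The form [f] first projects to degree x, where
    [reflection_eigen] gives its sign under x. *)
Lemma no_reflection v : yd_comp x v = v -> v = 0.
Proof.
move=> gv0; apply/eqP/negPn/negP => v0.
have rl := @yd_act_linear _ _ M (rot half); have cl := @yd_comp_linear _ _ M x.
have hh (u : M) : yd_act (rot half) (yd_act (rot half) u) = u.
  by rewrite act_rotD half_double rot0 yd_act1.
have [eta [w [eta2 [w0 [gw hw]]]]] : exists eta : F, exists w : M,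
    (eta * eta = 1) /\ w != 0 /\ yd_comp x w = w /\ yd_act (rot half) w = eta *: w.
  have [E|ne] := eqVneq (v + yd_act (rot half) v) 0.
    exists (-1), v; rewrite mulrNN mulr1 scaleN1r; split=> //; split=> //; split=> //.
    by apply/eqP; rewrite -addr_eq0 addrC E.
  exists 1, (v + yd_act (rot half) v); rewrite mulr1 scale1r; split=> //; split=> //.
  by split; rewrite ?(linD _ _ cl) ?(linD _ _ rl) -?act_half_comp ?gv0 ?hh // addrC.
have [h hl h1] := form_ex w0.
pose f u : F^o := 2%:R^-1 * (h (yd_comp x u + eta *: yd_act (rot half) (yd_comp x u))).
have fl : linear f.
  move=> a u u'; rewrite /f cl rl.
  rewrite scalerDr scalerA [eta * a]mulrC -scalerA addrACA -scalerDr hl mulrDr.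
  by congr (_ + _); rewrite -mulrCA.
have f1 : f w = 1.
  rewrite /f gw hw scalerA eta2 scale1r (linD _ _ hl) h1.
  by rewrite -[X in _ * X]/(2%:R : F) mulVf // two_neq0.
have fx u : f (yd_act x u) = - f u :> F.
  have cu : yd_comp x (yd_comp x u) = yd_comp x u by rewrite yd_comp_comp eqxx.
  rewrite /f -act_comp_x reflection_eigen // -mulrN; congr (_ * _).
  rewrite -[in LHS]scaleN1r (linZ _ _ rl) -[h _ in RHS]scale1r -scaleNr -(linZ _ _ hl).
  by rewrite scalerDr; congr (h (_ + _)); rewrite !scalerA mulrC.
have fg g u : yd_comp g u = u -> g != x -> f u = 0.
  move=> gu ne; rewrite /f -gu yd_comp_comp eq_sym (negPf ne) (lin0 rl) scaler0 addr0.
  by rewrite (lin0 hl) mulr0.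
exact: (@reflection_infinite w f eta gw fl f1 fx fg eta2 hw).
Qed.

End Rotations.

(** * Braiding equal to the negative flip *)

Section Exterior.
Context (F : fieldType) (F0 : [pchar F] =i pred0) (G : finGroupType) (M : ydModule F G).
Context (X : tensor_like M).
Hypothesis act_degree : forall g (u v : M), yd_comp g u != 0 -> yd_act g v = - v.
Local Notation io := (tl_in X).
Local Notation tens := (@tl_tens _ _ _ X).
Local Notation coprod := (@tl_coprod _ _ _ X).
Local Notation tword := (@tword _ _ _ X).

Implicit Types (z : X) (v : M).

Definition tl_exterior_rel (z : X) : Prop := exists u v : M, z = io u * io v + io v * io u.
Local Notation J := (ideal tl_exterior_rel).

Lemma sum_tens (I : finType) p (h : I -> X) :
  \sum_i tens p (h i) = tens p (\sum_i h i).
Proof.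
have Ll := @tl_tens_r _ _ _ X p.
by elim/big_rec2: _ => [|i a b _ ->]; rewrite ?(lin0 Ll) ?(linD _ _ Ll).
Qed.

Lemma sum_in_comp v : \sum_g io (yd_comp g v) = io v.
Proof.
rewrite -[in RHS](yd_comp_sum v).
by elim/big_rec2: _ => [|g a b _ ->]; rewrite ?(lin0 (@tl_in_linear _ _ _ X)) ?(linD _ _ (@tl_in_linear _ _ _ X)).
Qed.

(** Every degree that occurs in M acts by -1, which turns the braided Leibniz rule into that of a
    superderivation. *)
Lemma sder_super (f : M -> F^o) v z : linear f ->
  sder f (io v * z) = (f v : F) *: z - io v * sder f z.
Proof.
move=> fl; rewrite sder_inM //; congr (_ + _).
rewrite -(sum_in_comp v) mulr_suml -sumrN; apply: eq_bigr => g _.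
have [->|ne] := eqVneq (yd_comp g v) 0.
  by rewrite (lin0 (@tl_in_linear _ _ _ X)) !mul0r oppr0.
rewrite -mulrN -scaleN1r -sderZ //; congr (_ * sder _ _); apply: funext => u.
by rewrite (act_degree _ ne) -scaleN1r (linZ _ _ fl).
Qed.

Lemma tdeg_in v n z : tdeg n z -> tdeg n.+1 (io v * z).
Proof.
apply: lspan_linear => [a p q|_ [w wn ->]]; first by rewrite mulrDr -scalerAr.
by apply: lspan_gen; exists (v :: w); rewrite ?tword_cons //= wn.
Qed.

Lemma sder_tdeg (f : M -> F^o) n z : linear f -> tdeg n.+1 z -> tdeg n (sder f z).
Proof.
move=> fl; apply: lspan_linear; first exact: sder_linear.
move=> _ [w wn ->]; elim: w n wn => // v w IH n [wn].
rewrite tword_cons sder_super //; apply: lspanD.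
  by apply: lspanZ; apply: lspan_gen; exists w.
rewrite -scaleN1r; apply: lspanZ; case: n wn => [|n] wn.
  have -> : w = [::] by apply/nilP; rewrite /nilp wn.
  rewrite tword_nil sder1 // mulr0; exact: lspan0.
exact/tdeg_in/IH.
Qed.

Lemma tdeg0 z : tdeg 0 z -> z = counit z *: 1.
Proof.
move=> h; apply/eqP; rewrite -subr_eq0; apply/eqP.
apply: (lspan_kill (L := fun z : X => z - (counit z : F) *: 1) _ _ h).
  move=> a u v; rewrite (formE _ _ _ (@counit_linear _ _ _ X)) scalerDl -scalerA.
  by rewrite opprD addrACA scalerBr.
by move=> _ [[|? ?] // _ ->]; rewrite counit_tword tword_nil scale1r subrr.
Qed.

Section Basis.
Context (n : nat) (b : 'I_n -> M) (f : 'I_n -> M -> F^o).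
Hypotheses (fl : forall i : 'I_n, linear (f i)).
Hypothesis fb : forall v, v = \sum_(i < n) (f i v : F) *: b i.

Lemma in_basis v : io v = \sum_(i < n) (f i v : F) *: io (b i).
Proof.
rewrite [in LHS](fb v).
by elim/big_rec2: _ => [|i x y _ <-]; rewrite ?(lin0 (@tl_in_linear _ _ _ X)) ?(@tl_in_linear _ _ _ X).
Qed.

(** Euler's formula modulo J. For a word v w, the terms f_i(v) b_i sum to v and raise the factor by
    one; in the others, moving b_i past v costs an exterior relation. *)
Lemma euler k z : tdeg k z -> J (\sum_(i < n) io (b i) * sder (f i) z - k%:R *: z).
Proof.
apply: (lspan_linear (L := fun z => \sum_(i < n) io (b i) * sder (f i) z - k%:R *: z)).
  have Ll : linear (fun z => \sum_(i < n) io (b i) * sder (f i) z).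
    move=> a u v; rewrite scaler_sumr -big_split /=; apply: eq_bigr => i _.
    by rewrite sder_linear // mulrDr -scalerAr.
  move=> a u v; rewrite Ll [_%:R *: (_ + _)]scalerDr opprD addrACA scalerBr !scalerA.
  by rewrite [_%:R * a]mulrC.
move=> _ [w <- ->]; elim: w => [|v w IH].
  rewrite scale0r subr0 big1 => [|i _]; first exact: lspan0.
  by rewrite tword_nil sder1 // mulr0.
rewrite tword_cons.
have -> : \sum_(i < n) io (b i) * sder (f i) (io v * tword w) - (size (v :: w))%:R *: (io v * tword w)
  = io v * (\sum_(i < n) io (b i) * sder (f i) (tword w) - (size w)%:R *: tword w)
    - \sum_(i < n) (io (b i) * io v + io v * io (b i)) * sder (f i) (tword w).
  under eq_bigr => i _ do rewrite sder_super // mulrBr -scalerAr scalerAl mulrA.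
  rewrite sumrB -mulr_suml -in_basis.
  under [X in _ = _ - X]eq_bigr => i _ do rewrite mulrDl -[io v * _ * _]mulrA.
  rewrite [X in _ = _ - X]big_split /= -mulr_sumr opprD.
  have -> : (size (v :: w))%:R = (size w)%:R + 1 :> F by rewrite natr1.
  rewrite scalerDl scale1r mulrBr -scalerAr opprD.
  rewrite [LHS]addrC [LHS]addrA subrK [RHS]addrC [RHS]addrA subrK; exact: addrC.
apply: lspanD; first exact: idealMl.
rewrite -scaleN1r; apply: lspanZ; apply: lspan_sum => i _; apply: idealMr.
by apply: ideal_gen; exists (b i), v.
Qed.

(** Induction on the degree: the derivatives of z stay in the coideal and have smaller degree, so
    they lie in J, and [euler] recovers a nonzero multiple of z. In degree 0 the counit gives z =
    0. *)
Lemma homogeneous_in_exterior (S : X -> Prop) k z : homogeneous2 S ->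
  tl_coideal (ideal S) -> tdeg k z -> ideal S z -> J z.
Proof.
move=> hS cS; elim: k z => [|k IH] z kz Sz.
  rewrite (tdeg0 kz) (ideal_kill (@counit_linear _ _ _ X) _ hS Sz) ?scale0r; first exact: lspan0.
  by case=> // ? ? _; rewrite counit_tword.
have k0 : (k.+1%:R : F) != 0 by rewrite (iffLR (pcharf0P F) F0).
rewrite -[z]scale1r -(mulVf k0) -scalerA; apply: lspanZ.
have -> : k.+1%:R *: z = \sum_(i < n) io (b i) * sder (f i) z
    - (\sum_(i < n) io (b i) * sder (f i) z - k.+1%:R *: z) by rewrite opprB addrC subrK.
apply: lspanD; last by rewrite -scaleN1r; apply: lspanZ; exact: euler.
apply: lspan_sum => i _; apply: idealMl; apply: IH; first exact: sder_tdeg.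
exact: sder_ideal.
Qed.

Lemma nichols_sub_exterior z : ideal (@tl_nichols_rel _ _ _ X) z -> J z.
Proof.
apply: (lspan_linear (L := fun z : X => z)) => // _ [a [s [c [[S [hS cS Ss]] ->]]]].
suff : J s by exact: idealM2.
move: Ss; rewrite -[s]/((fun z : X => z) s).
elim=> [|e u v [a' [s' [c' [Ss' ->]]]] _ IH]; first exact: lspan0.
apply: lspanD IH; apply: lspanZ; apply: idealM2.
have [k _ ks'] := hS s' Ss'; apply: homogeneous_in_exterior hS cS ks' _.
exact: ideal_gen.
Qed.

End Basis.

Lemma exterior_words z : J z -> lspan (fun s => exists p u v q,
  s = tword p * (io u * io v + io v * io u) * tword q) z.
Proof.
apply: (lspan_linear (L := fun z : X => z)) => // _ [a [s [c [[u [v ->]] ->]]]].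
move: (tl_span a); apply: (lspan_linear (L := fun a : X => a * _ * c)).
  by move=> k y y'; rewrite !mulrDl -!scalerAl.
move=> _ [p ->]; move: (tl_span c); apply: (lspan_linear (L := fun c : X => _ * _ * c)).
  by move=> k y y'; rewrite mulrDr -scalerAr.
by move=> _ [q ->]; apply: lspan_gen; exists p, u, v, q.
Qed.

(** The grading automorphism, through which every degree occurring in M acts on T(M). *)
Definition parity_word w : X := (-1) ^+ size w *: tword w.

Definition parity : X -> X := tl_lift parity_word.

Lemma parity_multilinear : multilinear parity_word.
Proof.
move=> p p' a u v; rewrite /parity_word tword_linear !size_cat /= scalerDr !scalerA.
by rewrite mulrC.
Qed.

Lemma parity_linear : linear parity.
Proof. exact/tl_lift_linear/parity_multilinear. Qed.

Lemma parity_tword w : parity (tword w) = (-1) ^+ size w *: tword w.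
Proof. by rewrite /parity tl_lift_word //; exact: parity_multilinear. Qed.

Lemma parity_in v z : parity (io v * z) = - (io v * parity z).
Proof.
move: z; apply: tl_span_eq => [a y y'|a y y'|w].
- by rewrite mulrDr -scalerAr parity_linear.
- by rewrite parity_linear mulrDr -scalerAr opprD scalerN.
- by rewrite -tword_cons !parity_tword /= exprS mulN1r scaleNr tword_cons scalerAr.
Qed.

Lemma parityK z : parity (parity z) = z.
Proof.
move: z; apply: tl_span_eq => [a y y'|a y y'|w] //; first by rewrite !parity_linear.
by rewrite parity_tword (linZ _ _ parity_linear) parity_tword scalerA -expr2 sqrr_sign scale1r.
Qed.

Lemma parity_exterior z : J z -> J (parity z).
Proof.
move/exterior_words; apply: lspan_linear; first exact: parity_linear.
move=> _ [p [u [v [q ->]]]].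
have -> : parity (tword p * (io u * io v + io v * io u) * tword q) =
    (-1) ^+ (size p + (size q).+2) *: (tword p * (io u * io v + io v * io u) * tword q).
  have E w1 w2 : tword p * (io w1 * io w2) * tword q = tword (p ++ [:: w1, w2 & q]).
    by rewrite tword_cat !tword_cons !mulrA.
  rewrite mulrDr mulrDl !E (linD _ _ parity_linear) !parity_tword !size_cat /=.
  by rewrite scalerDr.
apply: lspanZ; apply: lspan_gen.
by exists (tword p), (io u * io v + io v * io u), (tword q); split => //; exists u, v.
Qed.

(** Left multiplication by v (x) 1 + 1 (x) v in the super tensor product. *)
Definition coprod_mul (v : M) : tl_prod X -> tl_prod X :=
  tl_blift (fun p q => tens (io v * p) q + tens (parity p) (io v * q)).

Lemma coprod_mul_bilinear_l v q :
  linear (fun p => tens (io v * p) q + tens (parity p) (io v * q)).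
Proof.
move=> a p p'; rewrite mulrDr -scalerAr parity_linear !(@tl_tens_l _ _ _ X).
by rewrite scalerDr addrACA.
Qed.

Lemma coprod_mul_bilinear_r v p :
  linear (fun q => tens (io v * p) q + tens (parity p) (io v * q)).
Proof.
move=> a q q'; rewrite mulrDr -scalerAr !(@tl_tens_r _ _ _ X).
by rewrite scalerDr addrACA.
Qed.

Lemma coprod_mul_linear v : linear (coprod_mul v).
Proof. by apply: tl_blift_linear; [exact: coprod_mul_bilinear_l | exact: coprod_mul_bilinear_r]. Qed.

Lemma coprod_mul_tens v p q :
  coprod_mul v (tens p q) = tens (io v * p) q + tens (parity p) (io v * q).
Proof. by rewrite /coprod_mul tl_blift_tens //; [exact: coprod_mul_bilinear_l | exact: coprod_mul_bilinear_r]. Qed.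

Lemma tword_opp p : tword [seq - v | v <- p] = (-1) ^+ size p *: tword p.
Proof.
elim: p => [|v p IH] /=; first by rewrite scale1r.
rewrite !tword_cons IH -scaleN1r (linZ _ _ (@tl_in_linear _ _ _ X)) exprS.
by rewrite -scalerAl -scalerAr scalerA.
Qed.

Lemma coprod_in v z : coprod (io v * z) = coprod_mul v (coprod z).
Proof.
move: z; apply: tl_span_eq => [a y y'|a y y'|w].
- by rewrite mulrDr -scalerAr tl_coprod_linear.
- by rewrite tl_coprod_linear coprod_mul_linear.
rewrite -tword_cons !tl_coprod_word (coprod_words_sum (fun p q => tens (tword p) (tword q))).
elim: (coprod_words w) => [|[p q] s IH]; first by rewrite !big_nil (lin0 (coprod_mul_linear v)).
rewrite !big_cons IH (linD _ _ (coprod_mul_linear v)) coprod_mul_tens /=; congr (_ + _ + _).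
  by rewrite tword_cons.
rewrite -(sum_in_comp v) mulr_suml -sum_tens; apply: eq_bigr => g _.
rewrite tword_cons; have [->|ne] := eqVneq (yd_comp g v) 0.
  by rewrite (lin0 (@tl_in_linear _ _ _ X)) mul0r !(lin0 (@tl_tens_r _ _ _ X _)).
rewrite -[\prod_(v0 <- p) io v0]/(tword p) parity_tword -tword_opp; congr (tens (tword _) _).
by apply: eq_map => u; exact: (act_degree u ne).
Qed.

(** Left factors are absorbed because [coprod_mul] preserves J (x) T + T (x) J. On the relation
    itself the mixed terms of Delta(u) Delta(v) + Delta(v) Delta(u) cancel, leaving (uv + vu) (x) 1
    + 1 (x) (uv + vu). *)
Lemma exterior_coideal : tl_coideal J.
Proof.
move=> z /exterior_words; apply: lspan_linear; first exact: tl_coprod_linear.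
move=> _ [p [u [v [q ->]]]].
elim: p => [|v0 p IH]; last first.
  rewrite tword_cons -!mulrA coprod_in mulrA.
  move: IH; apply: lspan_linear; first exact: coprod_mul_linear.
  move=> _ [p0 [q0 [pq ->]]]; rewrite coprod_mul_tens.
  case: pq => h; apply: lspanD; apply: lspan_gen.
  - by exists (io v0 * p0), q0; split=> //; left; exact: idealMl.
  - by exists (parity p0), (io v0 * q0); split=> //; left; exact: parity_exterior.
  - by exists (io v0 * p0), q0; split=> //; right.
  - by exists (parity p0), (io v0 * q0); split=> //; right; exact: idealMl.
rewrite tword_nil mul1r mulrDl -!mulrA (linD _ _ (@tl_coprod_linear _ _ _ X)) !coprod_in.
pose L t := coprod_mul u (coprod_mul v t) + coprod_mul v (coprod_mul u t).
have Ll : linear L by move=> a x y; rewrite /L !coprod_mul_linear scalerDr addrACA.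
rewrite -[_ + _]/(L (coprod (tword q))).
rewrite tl_coprod_word; elim: (coprod_words q) => [|[p0 q0] s IH].
  rewrite big_nil (lin0 Ll); exact: lspan0.
rewrite big_cons (linD _ _ Ll); apply: lspanD IH; rewrite /=.
rewrite -/(tword p0) -/(tword q0); move: (tword p0) (tword q0) => {}p0 {}q0.
have Jext w1 w2 : J (io w1 * io w2 + io w2 * io w1) by apply: ideal_gen; exists w1, w2.
have -> : L (tens p0 q0) = tens ((io u * io v + io v * io u) * p0) q0
    + tens p0 ((io u * io v + io v * io u) * q0).
  rewrite /L !coprod_mul_tens !(linD _ _ (coprod_mul_linear _)) !coprod_mul_tens !parity_in.
  rewrite !parityK !mulrDl !(linD _ _ (@tl_tens_l _ _ _ X _)) !(linD _ _ (@tl_tens_r _ _ _ X _)).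
  have TN p1 q1 : tens (- p1) q1 = - tens p1 q1.
    by have := linZ (-1) p1 (@tl_tens_l _ _ _ X q1); rewrite !scaleN1r.
  rewrite !TN !mulrA.
  set a1 := tens (io u * io v * p0) q0; set a2 := tens (io v * io u * p0) q0.
  set b1 := tens p0 (io u * io v * q0); set b2 := tens p0 (io v * io u * q0).
  set c1 := tens (io v * parity p0) _; set c2 := tens (io u * parity p0) _.
  rewrite [c2 + b1]addrC [c1 + b2]addrC ![_ - _ + (_ + _)]addrACA [LHS]addrACA.
  have -> : - c1 + c2 + (- c2 + c1) = 0 by rewrite addrA addrK addNr.
  by rewrite addr0 addrACA.
apply: lspanD; apply: lspan_gen.
  by exists ((io u * io v + io v * io u) * p0), q0; split=> //; left; exact: idealMr.
by exists p0, ((io u * io v + io v * io u) * q0); split=> //; right; exact: idealMr.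
Qed.

Lemma exterior_sub_nichols z : J z -> ideal (@tl_nichols_rel _ _ _ X) z.
Proof.
move=> Jz; apply: ideal_gen; exists tl_exterior_rel; split=> //; last exact: exterior_coideal.
move=> s [u [v ->]]; exists 2 => //; apply: lspanD; apply: lspan_gen.
  by exists [:: u; v]; rewrite // !tword_cons tword_nil mulr1.
by exists [:: v; u]; rewrite // !tword_cons tword_nil mulr1.
Qed.

End Exterior.

(** * Decomposition *)

(** The square (a - b)^2 = (a + b)^2 - 4ab is divisible by (2n)^2, so a and b are n(c + d) and n(c -
    d) in some order. Moreover d^2 + 2e + 1 = c^2, which makes c + d odd. *)
Lemma odd_factor (n a b c e : nat) : (0 < n)%N ->
  (a * b = n * n * (2 * e + 1))%N -> (a + b = 2 * n * c)%N -> exists d, (a = n * (2 * d + 1))%N.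
Proof.
move=> n0 ab s.
(* Ordering the two factors keeps the natural subtraction exact. *)
have main (a' b' : nat) : (b' <= a')%N -> (a' * b' = n * n * (2 * e + 1))%N ->
    (a' + b' = 2 * n * c)%N ->
    exists d, [/\ (a' = n * (c + d))%N, (b' = n * (c - d))%N, (d <= c)%N & odd (c + d)].
  move=> le E1 E2; pose r := (a' - b')%N.
  have Er : (r ^ 2 + (2 * n) ^ 2 * (2 * e + 1) = (2 * n) ^ 2 * c ^ 2)%N.
    have aE : (a' = b' + r)%N by rewrite /r subnKC.
    have {}E1 : (b' * (b' + r) = n * n * (2 * e + 1))%N by rewrite mulnC -aE.
    have {}E2 : (2 * b' + r = 2 * n * c)%N by lia.
    have -> : ((2 * n) ^ 2 * (2 * e + 1) = 4 * (b' * (b' + r)))%N by rewrite E1; ring.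
    by rewrite -expnMn -E2; ring.
  have : (2 * n %| r)%N.
    rewrite -(@dvdn_pexp2r _ _ 2) // -(dvdn_addl _ (dvdn_mulr (2 * e + 1) (dvdnn _))) Er.
    exact: dvdn_mulr.
  case/dvdnP=> d rE; exists d.
  have aE : (a' = b' + r)%N by rewrite /r subnKC.
  have dE : (d ^ 2 + (2 * e + 1) = c ^ 2)%N.
    have /eqP := Er; rewrite rE expnMn [(d ^ 2 * _)%N]mulnC -mulnDr.
    by rewrite eqn_pmul2l ?expn_gt0 ?muln_gt0 ?n0 // => /eqP.
  have dc : (d <= c)%N by rewrite -leq_sqr -dE leq_addr.
  have a2 : (2 * a' = 2 * (n * (c + d)))%N by lia.
  have b2 : (2 * b' = 2 * (n * (c - d)))%N by rewrite mulnBr; nia.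
  split => //; [lia|lia|].
  have : odd (d ^ 2 + (2 * e + 1)) = odd (c ^ 2) by rewrite dE.
  by rewrite mul2n !oddD odd_double !oddX /=; case: (odd c); case: (odd d).
have [ba|/ltnW ba] := leqP b a.
  have [d [-> _ _ o]] := main a b ba ab s.
  by exists (c + d)./2; rewrite mul2n -[in LHS](odd_double_half (c + d)) o addnC.
rewrite mulnC in ab; rewrite addnC in s.
have [d [_ -> dc o]] := main b a ba ab s.
exists (c - d)./2; rewrite mul2n -[in LHS](odd_double_half (c - d)).
by rewrite oddB // -oddD o addnC.
Qed.

Section RootArithmetic.
Context (F : fieldType) (F0 : [pchar F] =i pred0) (t : nat) (t_gt0 : (0 < t)%N).
Local Notation m := (4 * t)%N.
Context (omega : F) (homega : m.-primitive_root omega).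

Lemma omega_half : omega ^+ (2 * t) = -1.
Proof.
have /eqP : (omega ^+ (2 * t)) ^+ 2 = 1.
  by rewrite -exprM mulnAC -[(2 * 2)%N]/4%N prim_expr_order.
rewrite sqrf_eq1 => /orP[|/eqP //]; rewrite -(prim_order_dvd homega) => /dvdn_leq; lia.
Qed.

Lemma omega_opp1 (a : nat) : omega ^+ a = -1 -> exists e, a = (2 * t * (2 * e + 1))%N.
Proof.
move=> E; have : omega ^+ (a + 2 * t) == 1 by rewrite exprD E omega_half mulrNN mulr1.
rewrite -(prim_order_dvd homega) => /dvdnP[[|q] qE]; first by lia.
by exists q; lia.
Qed.

Lemma omega_odd (a : nat) : omega ^+ (2 * t * a) = -1 -> odd a.
Proof.
rewrite exprM omega_half -signr_odd; case: (odd a) => // /eqP.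
by rewrite expr0 eq_sym (negPf (opp1_neq1 F0)).
Qed.

(** Here ik and pr are odd multiples of 2t and ir + pk is a multiple of 4t; [odd_factor] with n =
    2t, a = ir, b = pk makes ir an odd multiple of 2t. *)
Lemma chi_opp1 (i k p r : 'Z_m) :
  chi omega (i * k) = -1 -> chi omega (p * r) = -1 -> chi omega (i * r + p * k) = 1 ->
  chi omega (i * r) = -1.
Proof.
have M (a b : 'Z_m) : chi omega (a * b) = omega ^+ (a * b).
  by rewrite /chi -[RHS](chi_mod t_gt0 homega).
rewrite chiD // !M => /omega_opp1[e1 E1] /omega_opp1[e2 E2] /eqP.
rewrite -exprD -(prim_order_dvd homega) => /dvdnP[c Ec].
have n0 : (0 < 2 * t)%N by rewrite muln_gt0.
have [||d ->] := @odd_factor (2 * t) (i * r) (p * k) c (2 * e1 * e2 + e1 + e2) n0.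
- have -> : (i * r * (p * k) = (i * k) * (p * r))%N by ring.
  by rewrite E1 E2; ring.
- by rewrite Ec; ring.
by rewrite exprM omega_half exprD mulnC exprM sqrr_sign expr1 mul1r.
Qed.

End RootArithmetic.

(** * Degrees and types occurring in M *)

Section Classification.
Context (F : fieldType) (F0 : [pchar F] =i pred0) (t : nat) (t_ge3 : (3 <= t)%N).
Local Notation m := (4 * t)%N.
Context (omega : F) (homega : m.-primitive_root omega).
Context (gT : finGroupType) (x y : gT) (hD : dihedral_presented m x y).
Local Notation rot := (@rot gT t y).
Local Notation chi := (@chi F t omega).
Local Notation component N := (@bigrade F gT t omega y N).

Lemma dih_rels : [/\ (0 < t)%N, (x ^+ 2 = 1)%g, (y ^+ m = 1)%g & (x * y = y^-1 * x)%g].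
Proof. by case: hD => h1 h2 h3 _ _; split=> //; apply: leq_trans t_ge3. Qed.

Let t0 : (0 < t)%N. Proof. by case: dih_rels. Qed.
Let x2 : (x ^+ 2 = 1)%g. Proof. by case: dih_rels. Qed.
Let ym : (y ^+ m = 1)%g. Proof. by case: dih_rels. Qed.
Let xy : (x * y = y^-1 * x)%g. Proof. by case: dih_rels. Qed.

Lemma rot_inj : injective rot.
Proof.
move=> i j E.
have : dih_elt x y (val i, false) = dih_elt x y (val j, false) by rewrite /dih_elt /= !mulg1.
case/(dih_elt_inj hD) => /= + _; have lt (a : 'Z_m) : (a < m)%N by rewrite -[X in (_ < X)%N](Zp_cast4 t0).
by rewrite !modn_small // => /val_inj.
Qed.

Lemma rot_nat (a : nat) : rot a%:R = (y ^+ a)%g.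
Proof.
by rewrite /rot -[RHS](rot_mod t0 ym) val_Zp_nat // ?(Zp_cast4 t0) //; lia.
Qed.

Lemma chi_nat (a : nat) : chi a%:R = omega ^+ a.
Proof.
by rewrite /chi -[RHS](chi_mod t0 homega) val_Zp_nat // ?(Zp_cast4 t0) //; lia.
Qed.

Lemma dihP (g : gT) : (exists i, g = rot i) \/ (exists i, g = rot i * x)%g.
Proof.
have [[a e] /eqP ->] := dih_elt_surj hD g; rewrite /dih_elt /= -rot_nat.
by case: e; [right | left]; exists (val a)%:R; rewrite ?expg1 ?mulg1.
Qed.

Section Module.
Context (M : ydModule F gT) (X : tensor_like M).
Hypothesis Xfin : fin_codim (ideal (@tl_nichols_rel _ _ _ X)).
Local Notation hom := (@hom F gT t omega y M).
Implicit Types (v w : M).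

(** The element y^i x satisfies the same relations with y as x does, so [no_reflection] applies to
    it in place of x. *)
Lemma reflection_comp i v : yd_comp (rot i * x)%g v = 0.
Proof.
apply: (no_reflection F0 t0 homega (x := (rot i * x)%g) (y := y) _ ym _ rot_inj Xfin t_ge3).
- by rewrite expg2 -mulgA [(x * _)%g]mulgA (rot_x t0 ym xy) -mulgA -expg2 x2 mulg1 (rotN t0 ym) mulgV.
- rewrite -mulgA xy -[(y^-1)%g]/(y ^- 1)%g.
  have -> : (y ^+ 1)^-1%g = rot (- 1%:R) by rewrite (rotN t0 ym) rot_nat.
  by rewrite !mulgA -!(rotD t0 ym) addrC.
- by rewrite yd_comp_comp eqxx.
Qed.

Lemma sum_bigrade v : v = \sum_(p : 'Z_m * 'Z_m) component M p.1 p.2 v.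
Proof.
rewrite -(pair_bigA _ (fun i k => component M i k v)) /=.
rewrite (eq_bigr (fun i => yd_comp (rot i) v)); last first.
  by move=> i _; rewrite -comp_sum (sum_eigenproj F0 t0 homega).
rewrite -[LHS]yd_comp_sum (bigID (fun g => g \in codom rot)) /=.
rewrite [X in _ + X]big1 ?addr0; last first.
  move=> g /codomP ng; have [[i gi]|[i ->]] := dihP g; last exact: reflection_comp.
  by case: ng; exists i.
rewrite -big_uniq /=; first by rewrite /codom big_image.
by rewrite map_inj_uniq ?enum_uniq //; exact: rot_inj.
Qed.

Lemma bigrade_in i k v : hom i k (component M i k v).
Proof. exact: bigrade_hom. Qed.

Lemma hom_chi i k p r v w : hom i k v -> v != 0 -> hom p r w -> w != 0 -> chi (i * r) = -1.
Proof.
move=> hv v0 hw w0.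
have B := hom_braiding F0 t0 homega x2 ym xy rot_inj Xfin.
apply: (chi_opp1 t0 homega (B _ _ _ hv v0) (B _ _ _ hw w0)).
exact: (hom_pair F0 t0 homega x2 ym xy rot_inj Xfin hv hw v0 w0).
Qed.

(** A degree that occurs is a rotation and carries a bihomogeneous vector; [hom_chi] compares its
    type with that of each component of w. *)
Lemma act_degree_opp g v w : yd_comp g v != 0 -> yd_act g w = - w.
Proof.
have [[i ->]|[i ->]] := dihP g; last by rewrite reflection_comp eqxx.
rewrite {1}[v]sum_bigrade comp_sum => v0.
have [[p q] /= nz] : exists p : 'Z_m * 'Z_m, yd_comp (rot i) (component M p.1 p.2 v) != 0.
  apply/existsP; apply: contraNT v0; rewrite negb_exists => /forallP h.
  by rewrite big1 // => p _; apply/eqP/negbNE/h.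
have hv := bigrade_in p q v.
move: nz; rewrite (hom_rot_comp _ hv); case: (rot i =P rot p) => [E nz|_]; last by rewrite eqxx.
have ip := rot_inj E.
rewrite [w]sum_bigrade act_sum -sumrN; apply: eq_bigr => -[r s] _ /=.
have [->|w0] := eqVneq (component M r s w) 0.
  by rewrite (lin0 (@yd_act_linear _ _ M _)) oppr0.
have hw := bigrade_in r s w; have [_ ->] := hw.
by rewrite mulrC ip (hom_chi hv nz hw w0) scaleN1r.
Qed.

End Module.

(** * Adjoining a two-dimensional summand to an embedding into M *)

Section Embedding.
Context (M : ydModule F gT).
Local Notation hom := (@hom F gT t omega y M).

Definition yd_embedding (N : ydModule F gT) (h : N -> M) : Prop :=
  [/\ linear h, injective h, forall g v, h (yd_act g v) = yd_act g (h v) &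
      forall g v, h (yd_comp g v) = yd_comp g (h v)].

Lemma embedding_bigrade (N : ydModule F gT) (h : N -> M) i k n :
  yd_embedding h -> h (component N i k n) = component M i k (h n).
Proof.
case=> hl _ ha hc; rewrite /bigrade hc /eigenproj (linZ _ _ hl); congr (yd_comp _ (_ *: _)).
elim/big_rec2: _ => [|j a b _ <-]; first exact: lin0 hl.
by rewrite hl ha.
Qed.

Lemma embedding_iso (N : ydModule F gT) (h : N -> M) :
  yd_embedding h -> (forall v, exists n, h n = v) -> yd_iso M N.
Proof.
case=> hl hi ha hc hs; have [f fK] := choice hs.
have Kf : cancel h f by move=> n; apply: hi; rewrite fK.
exists f; split.
- by move=> a u v; apply: hi; rewrite hl !fK.
- by exists h.
- by move=> g v; apply: hi; rewrite ha !fK.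
- by move=> g v; apply: hi; rewrite hc !fK.
Qed.

Lemma hom_act_nat i k v (a : nat) : hom i k%:R v -> yd_act (y ^+ a)%g v = omega ^+ (k * a) *: v.
Proof. by case=> _ hv; rewrite -rot_nat hv -natrM chi_nat. Qed.

Definition pair_map (u : M) (d : pair_mod F) : M := d.1 *: u + d.2 *: yd_act x u.

Lemma pair_map_linear u : linear (pair_map u).
Proof.
move=> a d e; rewrite /pair_map /= !scalerDl -!scalerA addrACA -scalerDr; reflexivity.
Qed.

Lemma pair_map_act u (p q : nat) g (d : dih_yd homega hD p q) : hom p%:R q%:R u ->
  pair_map u (yd_act g d) = yd_act g (pair_map u d).
Proof.
move=> hu; rewrite /= -[in RHS](dih_coordK hD g); move: (dih_coord hD g) => [a e].
have hx : yd_act (y ^+ a)%g (yd_act x u) = omega ^- (q * a) *: yd_act x u.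
  have := hom_x t0 ym xy hu; rewrite /hom => -[_ /(_ a%:R)].
  by rewrite rot_nat mulNr (chiN t0 homega) -natrM chi_nat.
rewrite /dih_elt /dih_pair_act /pair_map /=.
rewrite (linD _ _ (@yd_act_linear _ _ M _)) !actZ.
case: e => /=; rewrite ?mulg1 ?expg1 ?yd_actM ?(act_xK x2) (hom_act_nat _ hu) hx !scalerA.
  by rewrite addrC ![omega ^+ _ * _]mulrC ![omega ^- _ * _]mulrC.
by rewrite ![omega ^+ _ * _]mulrC ![omega ^- _ * _]mulrC.
Qed.

Lemma pair_map_comp u (p q : nat) g (d : dih_yd homega hD p q) : hom p%:R q%:R u ->
  pair_map u (yd_comp g d) = yd_comp g (pair_map u d).
Proof.
move=> hu; rewrite /= /pair_map /dih_pair_comp (linD _ _ (@yd_comp_linear _ _ M _)) !compZ.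
rewrite (hom_rot_comp _ hu) (hom_rot_comp _ (hom_x t0 ym xy hu)) (rotN t0 ym) !rot_nat /=.
by case: ifP => _; case: ifP => _; rewrite ?scaler0 ?scale0r.
Qed.

(** [N'] is the sum of [dih_yd] and [N], given by its two projections so that the new summand can
    sit in either part of [M_IL]. For injectivity, the bihomogeneous projectors separate u from x u,
    and a nonzero coefficient at either would put u in the image of [h]. *)
Lemma embedding_extend (N N' : ydModule F gT) (p q : nat) (h : N -> M)
    (pD : N' -> dih_yd homega hD p q) (pN : N' -> N) (u : M) :
  yd_embedding h -> linear pD -> linear pN ->
  (forall g n, pD (yd_act g n) = yd_act g (pD n)) ->
  (forall g n, pD (yd_comp g n) = yd_comp g (pD n)) ->
  (forall g n, pN (yd_act g n) = yd_act g (pN n)) ->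
  (forall g n, pN (yd_comp g n) = yd_comp g (pN n)) ->
  (forall n, pD n = 0 -> pN n = 0 -> n = 0) ->
  (forall d n, exists2 n', pD n' = d & pN n' = n) ->
  hom p%:R q%:R u -> (p%:R, q%:R) != (- p%:R, - q%:R) :> 'Z_m * 'Z_m ->
  (forall n, h n <> u) ->
  exists h' : N' -> M, [/\ yd_embedding h', exists n', h' n' = u &
    forall n, exists n', h' n' = h n].
Proof.
move=> he pDl pNl pDa pDc pNa pNc p0 ps hu ne nu; have [hl hi ha hc] := he.
exists (fun n' => pair_map u (pD n') + h (pN n')).
have h'l : linear (fun n' => pair_map u (pD n') + h (pN n')).
  by move=> a n1 n2; rewrite pDl pNl pair_map_linear hl addrACA -scalerDr.
split; last first.
- move=> n; have [n' E1 E2] := ps 0 n; exists n'.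
  by rewrite E1 E2 (lin0 (pair_map_linear u)) add0r.
- have [n' E1 E2] := ps (1, 0) 0; exists n'.
  by rewrite E1 E2 (lin0 hl) addr0 /pair_map /= scale1r scale0r addr0.
split=> //; first last.
- by move=> g n'; rewrite pDc pNc pair_map_comp // hc (linD _ _ (@yd_comp_linear _ _ M g)).
- by move=> g n'; rewrite pDa pNa pair_map_act // ha (linD _ _ (@yd_act_linear _ _ M g)).
suff inj0 n' : pair_map u (pD n') + h (pN n') = 0 -> n' = 0.
  move=> n1 n2 E; apply/eqP; rewrite -subr_eq0; apply/eqP/inj0.
  have EE : n1 - n2 = -1 *: n2 + n1 by rewrite scaleN1r addrC.
  by have := h'l (-1) n2 n1; rewrite -EE /= E scaleN1r addNr.
move: (pD n') (p0 n') => [al be] pn'.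
have hux := hom_x t0 ym xy hu.
have bl i k := @bigrade_linear F gT t omega y M i k.
have bid := bigrade_id F0 t0 homega; have both := bigrade_other F0 t0 homega rot_inj.
have [ux uu] : component M p%:R q%:R (yd_act x u) = 0 /\ component M (- p%:R) (- q%:R) u = 0.
  by split; [apply: both hux _ | apply: both hu _; rewrite eq_sym].
move=> E; rewrite /pair_map /= in E.
have al0 : al = 0.
  apply/eqP/negPn/negP => a0.
  have := congr1 (component M p%:R q%:R) E.
  rewrite (lin0 (bl _ _)) !(linD _ _ (bl _ _)) !(linZ _ _ (bl _ _)) ux (bid _ _ _ _ _ _ hu).
  rewrite scaler0 addr0 -embedding_bigrade // => /eqP; rewrite addr_eq0 => /eqP E1.
  apply: (nu (- al^-1 *: component N p%:R q%:R (pN n'))).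
  by rewrite (linZ _ _ hl) scaleNr -scalerN -E1 scalerA mulVf // scale1r.
have be0 : be = 0.
  apply/eqP/negPn/negP => b0.
  have := congr1 (component M (- p%:R) (- q%:R)) E.
  rewrite (lin0 (bl _ _)) !(linD _ _ (bl _ _)) !(linZ _ _ (bl _ _)) uu (bid _ _ _ _ _ _ hux).
  rewrite scaler0 add0r -embedding_bigrade // => /eqP; rewrite addr_eq0 => /eqP E1.
  apply: (nu (yd_act x (- be^-1 *: component N (- p%:R) (- q%:R) (pN n')))).
  rewrite ha (linZ _ _ hl) scaleNr -scalerN -E1 scalerA mulVf // scale1r.
  exact: act_xK.
apply: pn'; first by rewrite al0 be0.
by apply: hi; rewrite (lin0 hl); move: E; rewrite al0 be0 !scale0r !add0r.
Qed.

End Embedding.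

(** * Exhausting M by irreducible summands *)

Section Assembly.
Context (M : ydModule F gT) (X : tensor_like M).
Hypothesis Xfin : fin_codim (ideal (@tl_nichols_rel _ _ _ X)).
Local Notation hom := (@hom F gT t omega y M).

Definition occurs (p : nat * nat) : Prop := exists2 u : M, u != 0 & hom p.1%:R p.2%:R u.

Definition occursI (p : nat * nat) : Prop :=
  [/\ (1 <= p.1 < 2 * t)%N, (p.2 < m)%N & occurs p].

Definition occursL (l : nat) : Prop := (l < 2 * t)%N /\ occurs (m./2, l).

Lemma half_m : (m./2 = 2 * t)%N.
Proof. by lia. Qed.

Lemma occurs_omega p q : occurs p -> occurs q -> omega ^+ (p.1 * q.2) = -1.
Proof.
case=> u u0 hu [w w0 hw]; rewrite -chi_nat natrM.
by have := hom_chi Xfin hu u0 hw w0.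
Qed.

Lemma occurs_odd l p : occurs (m./2, l) -> occurs p -> odd p.2.
Proof.
by move=> Ol Op; apply: (omega_odd F0 t0 homega); rewrite -half_m; exact: (occurs_omega Ol Op).
Qed.

Lemma occurs_gt0 p q : occurs p -> occurs q -> (0 < q.2)%N.
Proof.
move=> Op Oq; have := occurs_omega Op Oq; case: (q.2) => // /eqP.
by rewrite muln0 expr0 eq_sym (negPf (opp1_neq1 F0)).
Qed.

(** All conditions come from omega^(ir) = -1 for any two occurring types (i,k) and (p,r); when i =
    2t this says that r is odd. *)
Lemma occurs_in_K (I : seq (nat * nat)) (L : seq nat) :
  (forall p, p \in I -> occursI p) -> (forall l, l \in L -> occursL l) ->
  in_K m omega I L.
Proof.
move=> OI OL.
have inI : in_I m omega I.
  split=> [p pI|p q pI qI].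
    have [p1 p2 Op] := OI p pI; split; rewrite ?half_m.
    - by lia.
    - by have := occurs_gt0 Op Op; lia.
    - exact: (occurs_omega Op Op).
  have [_ _ Op] := OI p pI; have [_ _ Oq] := OI q qI.
  by rewrite /simJ exprD (occurs_omega Op Oq) (occurs_omega Oq Op) mulrNN mulr1.
split=> // [l lL|p l pI lL].
  have [l2 Ol] := OL l lL; have := occurs_odd Ol Ol; rewrite /= => lo.
  by split=> //; rewrite half_m l2 andbT; case: (l) lo.
have [p1 p2 Op] := OI p pI; have [l2 Ol] := OL l lL.
split; first exact: occurs_odd Ol Op.
split; rewrite /= ?half_m; first by lia.
  by have := occurs_gt0 Op Ol; rewrite /=; lia.
exact: (occurs_omega Op Ol).
Qed.

Definition partial_iso (I : seq (nat * nat)) (L : seq nat)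
    (h : M_IL homega hD I L -> M) : Prop :=
  [/\ forall p, p \in I -> occursI p, forall l, l \in L -> occursL l & yd_embedding h].

Definition extends (I : seq (nat * nat)) (L : seq nat) (h : M_IL homega hD I L -> M)
    (u : M) : Prop :=
  exists I' L' (h' : M_IL homega hD I' L' -> M), [/\ partial_iso h',
    forall n, exists n', h' n' = h n & exists n', h' n' = u].

Lemma extendI I L (h : M_IL homega hD I L -> M) (i k : 'Z_m) u : partial_iso h ->
  hom i k u -> (forall n, h n <> u) -> u != 0 -> (1 <= i < 2 * t)%N -> extends h u.
Proof.
move=> [OI OL he] hu nu u0 i2.
have hu' : hom (val i)%:R (val k)%:R u by rewrite !natr_Zp.
have km : (k < m)%N by rewrite -[X in (_ < X)%N](Zp_cast4 t0).
have ne : (i, k) != (- i, - k).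
  exact: (hom_neq_opp F0 t0 homega (hom_chi Xfin hu u0 hu u0)).
have [] := @embedding_extend M (M_IL homega hD I L) (M_IL homega hD ((val i, val k) :: I) L)
  (val i) (val k) h (fun n => n.1.1) (fun n => (n.1.2, n.2)) u he.
- by [].
- by [].
- by [].
- by [].
- by [].
- by [].
- by move=> [[d n1] n2] /= -> [-> ->].
- by move=> d [n1 n2]; exists ((d, n1), n2).
- exact: hu'.
- by rewrite !natr_Zp.
- exact: nu.
move=> h' [he' im_u im_h]; exists ((val i, val k) :: I), L, h'; split=> //; split=> //.
move=> p; rewrite inE => /orP[/eqP ->|]; last exact: OI.
by split=> //; exists u.
Qed.

Lemma extendL I L (h : M_IL homega hD I L -> M) (k : 'Z_m) u : partial_iso h ->
  hom (m./2)%:R k u -> (forall n, h n <> u) -> u != 0 -> (k < 2 * t)%N -> extends h u.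
Proof.
move=> [OI OL he] hu nu u0 k2.
have hu' : hom (m./2)%:R (val k)%:R u by rewrite natr_Zp.
have ne : ((m./2)%:R, k) != (- (m./2)%:R, - k) :> 'Z_m * 'Z_m.
  exact: (hom_neq_opp F0 t0 homega (hom_chi Xfin hu u0 hu u0)).
have [] := @embedding_extend M (M_IL homega hD I L) (M_IL homega hD I (val k :: L))
  m./2 (val k) h (fun n => n.2.1) (fun n => (n.1, n.2.2)) u he.
- by [].
- by [].
- by [].
- by [].
- by [].
- by [].
- by move=> [n1 [d n2]] /= -> [-> ->].
- by move=> d [n1 n2]; exists (n1, (d, n2)).
- exact: hu'.
- by rewrite natr_Zp.
- exact: nu.
move=> h' [he' im_u im_h]; exists I, (val k :: L), h'; split=> //; split=> //.
move=> l; rewrite inE => /orP[/eqP ->|]; last exact: OL.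
by split=> //; exists u.
Qed.

(** If the component w is not yet in the image, its summand is adjoined. Replacing w by x w negates
    its type: this brings i below 2t or, when i = 2t, keeps i and brings k below 2t. The case k = 2t
    is excluded because k is then odd. *)
Lemma extend_component I L (h : M_IL homega hD I L -> M) (i k : 'Z_m) v :
  partial_iso h -> extends h (component M i k v).
Proof.
move=> hp; have [OI OL he] := hp; have [hl _ ha _] := he.
set w := component M i k v.
case: (pselect (exists n, h n = w)) => [im_w|nw].
  by exists I, L, h; split=> // n; exists n.
have {}nw n : h n <> w by move=> E; apply: nw; exists n.
have w0 : w != 0 by apply/eqP => E; apply: (nw 0); rewrite E (lin0 hl).
have hw : hom i k w by exact: bigrade_in.
have hxw := hom_x t0 ym xy hw; have xw0 := act_x_neq0 x2 w0.
have nxw n : h n <> yd_act x w.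
  by move=> E; apply: (nw (yd_act x n)); rewrite ha E (act_xK x2).
have ext_x : extends h (yd_act x w) -> extends h w.
  case=> I' [L' [h' [hp' im [n En]]]]; exists I', L', h'; split=> //.
  have [_ _ [_ _ ha' _]] := hp'.
  by exists (yd_act x n); rewrite ha' En (act_xK x2).
have lt (a : 'Z_m) : (a < m)%N by rewrite -[X in (_ < X)%N](Zp_cast4 t0).
have valN (a : 'Z_m) : a != 0 -> nat_of_ord (- a) = (m - a)%N.
  have modE (c : nat) : (((Zp_trunc m).+2 - c) %% (Zp_trunc m).+2 = (m - c) %% m)%N.
    by rewrite (Zp_cast4 t0).
  move=> a0; have E : nat_of_ord (- a) = ((m - a) %% m)%N by exact: modE.
  rewrite E modn_small // ltn_subrL (leq_ltn_trans _ (lt a)) // andbT lt0n.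
  by apply: contra_neq a0 => a0; apply: val_inj.
have E := hom_chi Xfin hw w0 hw w0.
have i0 : i != 0.
  by apply: contra_eq_neq E => ->; rewrite mul0r chi0 eq_sym (opp1_neq1 F0).
have k0 : k != 0.
  by apply: contra_eq_neq E => ->; rewrite mulr0 chi0 eq_sym (opp1_neq1 F0).
have i1 : (0 < i)%N by rewrite lt0n; apply: contra_neq i0 => i0; apply: val_inj.
case: (ltngtP i (2 * t)) => i2.
- by apply: extendI hp hw nw w0 _; rewrite i1.
- apply: ext_x; apply: extendI hp hxw nxw xw0 _.
  by rewrite valN //; have := lt i; lia.
have iE : i = (m./2)%:R by rewrite half_m -i2 natr_Zp.
have ko : odd k.
  by apply: (@occurs_odd k (m./2, val k)); exists w; rewrite //= natr_Zp -iE.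
case: (ltngtP k (2 * t)) => k2.
- by rewrite iE in hw; exact: extendL hp hw nw w0 k2.
- have iN : - i = (m./2)%:R.
    by apply: ord_inj; rewrite valN // -iE; have := lt i; lia.
  rewrite iN in hxw; apply: ext_x; apply: extendL hp hxw nxw xw0 _.
  by rewrite valN //; have := lt k; lia.
by move: ko; rewrite k2 mul2n odd_double.
Qed.

Lemma partial_iso0 : exists h : M_IL homega hD [::] [::] -> M, partial_iso h.
Proof.
exists (fun=> 0); split=> //; split=> [a u v|u v _|g v|g v].
- by rewrite scaler0 addr0.
- case: u v => u1 u2 [v1 v2].
  by congr pair; [rewrite [LHS]thinmx0 [RHS]thinmx0 | rewrite [LHS]thinmx0 [RHS]thinmx0].
- by rewrite (lin0 (@yd_act_linear _ _ M g)).
- by rewrite (lin0 (@yd_comp_linear _ _ M g)).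
Qed.

(** The components of a finite spanning family are adjoined one after another; they span M, so the
    final embedding is onto. *)
Lemma classification : exists I L, in_K m omega I L /\ yd_iso M (M_IL homega hD I L).
Proof.
have [n [b [f [fl fb]]]] := fin_codim_dual_basis Xfin.
have span (s : seq ('I_n * ('Z_m * 'Z_m))) : exists I L (h : M_IL homega hD I L -> M),
    partial_iso h /\ forall c, c \in s -> exists u, h u = component M c.2.1 c.2.2 (b c.1).
  elim: s => [|c s [I [L [h [hp hs]]]]].
    by have [h hp] := partial_iso0; exists [::], [::], h.
  have [I' [L' [h' [hp' im Ec]]]] := extend_component c.2.1 c.2.2 (b c.1) hp.
  exists I', L', h'; split=> // d; rewrite inE => /orP[/eqP -> //|/hs[u <-]].
  exact: im.
have [I [L [h [[OI OL he] hs]]]] := span (enum {: 'I_n * ('Z_m * 'Z_m)}).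
exists I, L; split; first exact: occurs_in_K.
have [hl _ _ _] := he.
apply: (embedding_iso he) => v.
have im_sum (J : finType) (a : J -> F) (e : J -> M) :
    (forall j, exists u, h u = e j) -> exists u, h u = \sum_j a j *: e j.
  move=> He; elim/big_ind: _ => [|u1 u2 [n1 <-] [n2 <-]|j _].
  - by exists 0; rewrite (lin0 hl).
  - by exists (n1 + n2); rewrite (linD _ _ hl).
  - by have [u <-] := He j; exists (a j *: u); rewrite (linZ _ _ hl).
rewrite (fb v); apply: (im_sum) => j; rewrite (sum_bigrade Xfin (b j)).
have [u Eu] : exists u, h u = \sum_(p : 'Z_m * 'Z_m) 1 *: component M p.1 p.2 (b j).
  by apply: (im_sum _ (fun=> 1)) => p; apply: (hs (j, p)); rewrite mem_enum.
by exists u; rewrite Eu; apply: eq_bigr => p _; rewrite scale1r.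
Qed.

End Assembly.

End Classification.

(** * Quotient algebras and the conclusion *)

Section QuotientAlgebras.
Context (F : fieldType) (A : algType F).

Lemma quot_alg_fin_codim (S : A -> Prop) :
  finite_dim (quot_alg S) -> fin_codim (ideal S).
Proof.
case=> s ss; exists (map repr s) => z.
have Imod u v : qproj S u = qproj S v ->
    lspan (fun y => y \in map repr s \/ ideal S y) v ->
    lspan (fun y => y \in map repr s \/ ideal S y) u.
  move=> /qproj_eq uv sv; rewrite -[u](subrK v); apply: lspanD sv.
  by apply: lspan_gen; right.
have {}ss (q : quot_alg S) : lspan (fun y => y \in map repr s \/ ideal S y) (repr q).
  elim: (ss q) => [|a u v us _ IH].
    by apply: (Imod _ 0); [rewrite qprojK (lin0 (@qproj_linear _ _ S)) | exact: lspan0].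
  apply: (Imod _ (a *: repr u + repr v)); first by rewrite qproj_linear !qprojK.
  by apply: lspan_cons IH; left; exact: map_f.
by apply: Imod (ss (qproj S z)); rewrite qprojK.
Qed.

Lemma quot_alg_iso (S S' : A -> Prop) : (forall z, ideal S z <-> ideal S' z) ->
  exists phi : quot_alg S -> quot_alg S',
    [/\ bijective phi, linear phi, monoid_morphism phi &
        forall z, phi (qproj S z) = qproj S' z].
Proof.
move=> SS'.
have phiE z : qproj S' (repr (qproj S z)) = qproj S' z.
  by apply/qproj_eq/SS'/qproj_eq; rewrite qprojK.
have psiE z : qproj S (repr (qproj S' z)) = qproj S z.
  by apply/qproj_eq/SS'/qproj_eq; rewrite qprojK.
exists (fun q => qproj S' (repr q)); split=> //.
- exists (fun q => qproj S (repr q)) => q; first by rewrite psiE qprojK.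
  by rewrite phiE qprojK.
- move=> a u v; rewrite -[u]qprojK -[v]qprojK; move: (repr u) (repr v) => {}u {}v.
  have -> : a *: qproj S u + qproj S v = qproj S (a *: u + v) by rewrite qproj_linear.
  by rewrite !phiE qproj_linear.
- split=> [|u v]; first exact: phiE.
  by rewrite -[u]qprojK -[v]qprojK -qprojM !phiE qprojM.
Qed.

End QuotientAlgebras.

Theorem theoremA (K : closedFieldType) (hK : [pchar K] =i pred0)
    (t : nat) (ht : (3 <= t)%N)
    (omega : K) (homega : (4 * t)%N.-primitive_root omega)
    (gT : finGroupType) (x y : gT) (hD : dihedral_presented (4 * t)%N x y)
    (M : ydModule K gT) (hM : finite_dim (nichols M)) :
  nichols_is_exterior M /\
  ((exists2 I : seq (nat * nat), in_I (4 * t)%N omega I &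
      yd_iso M (M_I homega hD I)) \/
   (exists2 L : seq nat, in_L (4 * t)%N L &
      yd_iso M (M_L homega hD L)) \/
   (exists I : seq (nat * nat), exists2 L : seq nat,
      in_K (4 * t)%N omega I L &
      yd_iso M (M_IL homega hD I L))).
Proof.
have Xfin : fin_codim (ideal (@tl_nichols_rel _ _ _ (tensor_alg_like M))).
  exact: quot_alg_fin_codim hM.
split; last first.
  have [I [L [IL iso]]] := classification hK ht homega hD Xfin.
  (* The third alternative is always available, because [I] and [L] may be empty. *)
  by right; right; exists I, L.
have [n [b [f [fl fb]]]] := fin_codim_dual_basis Xfin.
have opp := act_degree_opp hK ht homega hD Xfin.
have [z|phi [bij lin mor phiE]] := @quot_alg_iso _ _ (@nichols_rel _ _ M) (@exterior_rel _ M).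
  split; first exact: (nichols_sub_exterior (X := tensor_alg_like M) hK opp fl fb).
  exact: (exterior_sub_nichols (X := tensor_alg_like M) opp).
by exists phi; split=> // v; exact: phiE.
Qed.
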